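(* There is a strict triple category $\mathsf{ICat}$ whose objects are intercategories, with colax-lax morphisms as transversal arrows, lax-lax morphisms as horizontal arrows, colax-colax morphisms as vertical arrows, with the three kinds of double cells defined in the context (lax-lax/colax-lax, colax-lax/colax-colax and lax-lax/colax-colax), and with commuting cubes (as defined in the context) as triple cells.
   Context: **Intercategories.** A pseudocategory in $\mathbf{Cat}$ is $\partial_0,\partial_1:\mathbf Y_1\rightrightarrows\mathbf Y_0$, with $\mathbf Y_2=\mathbf Y_1\times_{\mathbf Y_0}\mathbf Y_1$, an identity functor $\mathbf Y_0\to\mathbf Y_1$ and a composition functor $\mathbf Y_2\to\mathbf Y_1$ respecting $\partial_i$, associative and unitary up to natural isomorphisms which are sent to identities by $\partial_i$ and satisfy pentagon and triangle. An intercategory (double pseudocategory in $\mathbf{Cat}$) consists of categories $\mathbf A_i,\mathbf B_i,\mathbf C_i$ ($i=0,1,2$), forming three rows with functors $p^i_1,p^i_2,m^i:\mathbf C_i\to\mathbf B_i$, $\partial^i_0,\partial^i_1:\mathbf B_i\to\mathbf A_i$, $\mathrm{id}^i:\mathbf A_i\to\mathbf B_i$, and three columns with functors $P_1,P_2,M:\mathbf X_2\to\mathbf X_1$, $D_0,D_1:\mathbf X_1\to\mathbf X_0$, $\mathrm{Id}:\mathbf X_0\to\mathbf X_1$ ($\mathbf X=\mathbf A,\mathbf B,\mathbf C$). Each row is a pseudocategory in $\mathbf{Cat}$ with isomorphisms $\kappa,\lambda,\rho$; each column is a pseudocategory in $\mathbf{Cat}$ with isomorphisms $\kappa',\lambda',\rho'$.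 The row functors $\partial_0,\partial_1,p_1,p_2$ commute with all column functors and preserve $\kappa',\lambda',\rho'$; the column functors $D_0,D_1,P_1,P_2$ commute with all row functors and preserve $\kappa,\lambda,\rho$. Objects and transversal arrows are the objects and morphisms of $\mathbf A_0$; vertical arrows $v,w$ and vertical cells are those of $\mathbf A_1$; horizontal arrows $h,k,l$ and horizontal cells are those of $\mathbf B_0$; basic cells $\alpha,\beta,\dots$ and cubes are those of $\mathbf B_1$. Write $x|y$ for composites by $m$, $\frac xy$ for composites by $M$ ($x$ above $y$), $\circ$ or juxtaposition for (transversal) composition in the categories. There are natural interchangers, sent to identities by $\partial_i$ and $D_i$: $\tau_A:\mathrm{Id}_{\mathrm{id}_A}\to\mathrm{id}_{\mathrm{Id}_A}$, $\mu(v,\bar v):\frac{\mathrm{id}_v}{\mathrm{id}_{\bar v}}\to\mathrm{id}_{\frac v{\bar v}}$, $\delta(h,k):\mathrm{Id}_{h|k}\to\mathrm{Id}_h|\mathrm{Id}_k$, $\chi(\alpha,\beta;\bar\alpha,\bar\beta):\frac{\alpha|\beta}{\bar\alpha|\bar\beta}\to\frac\alpha{\bar\alpha}|\frac\beta{\bar\beta}$. With $\kappa:x|(y|z)\to(x|y)|z$, $\kappa':\frac x{y/z}\to\frac{x/y}z$, $\lambda_\alpha:\mathrm{id}_v|\alpha\to\alpha$, $\rho_\alpha:\alpha|\mathrm{id}_w\to\alpha$, $\lambda'_\alpha:\frac{\mathrm{Id}_h}\alpha\to\alpha$, $\rho'_\alpha:\frac\alpha{\mathrm{Id}_{\bar h}}\to\alpha$,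 the coherence conditions are: 1. $\mathrm{id}_{\kappa'}\circ\mu(v,\frac{\bar v}{\tilde v})\circ\frac{\mathrm{id}_v}{\mu(\bar v,\tilde v)}=\mu(\frac v{\bar v},\tilde v)\circ\frac{\mu(v,\bar v)}{\mathrm{id}_{\tilde v}}\circ\kappa'$. 2. $\mathrm{id}_{\lambda'_v}\circ\mu(\mathrm{Id}_A,v)\circ\frac{\tau_A}{\mathrm{id}_v}=\lambda'_{\mathrm{id}_v}$ and $\mathrm{id}_{\rho'_v}\circ\mu(v,\mathrm{Id}_{\bar A})\circ\frac{\mathrm{id}_v}{\tau_{\bar A}}=\rho'_{\mathrm{id}_v}$, for $v$ from $A$ to $\bar A$. 3. $(\kappa'|\kappa')\circ\chi(\alpha,\beta;\frac\gamma\epsilon,\frac\zeta\eta)\circ\frac{\alpha|\beta}{\chi(\gamma,\zeta;\epsilon,\eta)}=\chi(\frac\alpha\gamma,\frac\beta\zeta;\epsilon,\eta)\circ\frac{\chi(\alpha,\beta;\gamma,\zeta)}{\epsilon|\eta}\circ\kappa'$. 4. $(\lambda'_\alpha|\lambda'_\beta)\circ\chi(\mathrm{Id}_h,\mathrm{Id}_k;\alpha,\beta)\circ\frac{\delta(h,k)}{\alpha|\beta}=\lambda'_{\alpha|\beta}$ and $(\rho'_\alpha|\rho'_\beta)\circ\chi(\alpha,\beta;\mathrm{Id}_{\bar h},\mathrm{Id}_{\bar k})\circ\frac{\alpha|\beta}{\delta(\bar h,\bar k)}=\rho'_{\alpha|\beta}$. 5. $\kappa\circ(\frac\alpha\zeta|\chi(\beta,\gamma;\epsilon,\eta))\circ\chi(\alpha,\beta|\gamma;\zeta,\epsilon|\eta)=(\chi(\alpha,\beta;\zeta,\epsilon)|\frac\gamma\eta)\circ\chi(\alpha|\beta,\gamma;\zeta|\epsilon,\eta)\circ\frac\kappa\kappa$.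 6. $\kappa\circ(\mathrm{Id}_h|\delta(k,l))\circ\delta(h,k|l)=(\delta(h,k)|\mathrm{Id}_l)\circ\delta(h|k,l)\circ\mathrm{Id}_\kappa$. 7. $\lambda_{\frac\alpha\beta}\circ(\mu(v,\bar v)|\frac\alpha\beta)\circ\chi(\mathrm{id}_v,\alpha;\mathrm{id}_{\bar v},\beta)=\frac{\lambda_\alpha}{\lambda_\beta}$ and $\rho_{\frac\alpha\beta}\circ(\frac\alpha\beta|\mu(w,\bar w))\circ\chi(\alpha,\mathrm{id}_w;\beta,\mathrm{id}_{\bar w})=\frac{\rho_\alpha}{\rho_\beta}$. 8. $\lambda_{\mathrm{Id}_h}\circ(\tau_A|\mathrm{Id}_h)\circ\delta(\mathrm{id}_A,h)=\mathrm{Id}_{\lambda_h}$ and $\rho_{\mathrm{Id}_h}\circ(\mathrm{Id}_h|\tau_B)\circ\delta(h,\mathrm{id}_B)=\mathrm{Id}_{\rho_h}$, for $h$ from $A$ to $B$. **Morphisms.** All three kinds of morphism $\Phi$ consist of functors $\mathbf A_0\to\mathbf A'_0$, $\mathbf A_1\to\mathbf A'_1$, $\mathbf B_0\to\mathbf B'_0$, $\mathbf B_1\to\mathbf B'_1$ (all written $\Phi$) commuting with $\partial_0,\partial_1,D_0,D_1$, together with natural comparisons $\phi_v$ (sent to identities by $D_i$, compatible with $\partial_i$) and $\phi_h$ (sent to identities by $\partial_i$, compatible with $D_i$). ''X-Y'' means X horizontally and Y vertically. - Vertically lax: $\phi_v(x):\mathrm{Id}_{\Phi x}\to\Phi(\mathrm{Id}_x)$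 ($x$ an object or horizontal arrow), $\phi_v(x,\bar x):\frac{\Phi x}{\Phi\bar x}\to\Phi(\frac x{\bar x})$ ($x,\bar x$ vertical arrows or basic cells), with $\Phi(\lambda'_\alpha)\circ\phi_v(\mathrm{Id}_h,\alpha)\circ\frac{\phi_v(h)}{\Phi\alpha}=\lambda'_{\Phi\alpha}$, $\Phi(\rho'_\alpha)\circ\phi_v(\alpha,\mathrm{Id}_{\bar h})\circ\frac{\Phi\alpha}{\phi_v(\bar h)}=\rho'_{\Phi\alpha}$, $\Phi(\kappa')\circ\phi_v(\alpha,\frac\beta\gamma)\circ\frac{\Phi\alpha}{\phi_v(\beta,\gamma)}=\phi_v(\frac\alpha\beta,\gamma)\circ\frac{\phi_v(\alpha,\beta)}{\Phi\gamma}\circ\kappa'$. - Vertically colax: $\phi_v(x):\Phi(\mathrm{Id}_x)\to\mathrm{Id}_{\Phi x}$, $\phi_v(x,\bar x):\Phi(\frac x{\bar x})\to\frac{\Phi x}{\Phi\bar x}$, with $\lambda'_{\Phi\alpha}\circ\frac{\phi_v(h)}{\Phi\alpha}\circ\phi_v(\mathrm{Id}_h,\alpha)=\Phi(\lambda'_\alpha)$, $\rho'_{\Phi\alpha}\circ\frac{\Phi\alpha}{\phi_v(\bar h)}\circ\phi_v(\alpha,\mathrm{Id}_{\bar h})=\Phi(\rho'_\alpha)$, $\kappa'\circ\frac{\Phi\alpha}{\phi_v(\beta,\gamma)}\circ\phi_v(\alpha,\frac\beta\gamma)=\frac{\phi_v(\alpha,\beta)}{\Phi\gamma}\circ\phi_v(\frac\alpha\beta,\gamma)\circ\Phi(\kappa')$.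 - Horizontally lax: $\phi_h(x):\mathrm{id}_{\Phi x}\to\Phi(\mathrm{id}_x)$ ($x$ an object or vertical arrow), $\phi_h(x,y):\Phi x|\Phi y\to\Phi(x|y)$ ($x,y$ horizontal arrows or basic cells), with $\Phi(\lambda_\alpha)\circ\phi_h(\mathrm{id}_v,\alpha)\circ(\phi_h(v)|\Phi\alpha)=\lambda_{\Phi\alpha}$, $\Phi(\rho_\alpha)\circ\phi_h(\alpha,\mathrm{id}_w)\circ(\Phi\alpha|\phi_h(w))=\rho_{\Phi\alpha}$, $\Phi(\kappa)\circ\phi_h(\alpha,\beta|\gamma)\circ(\Phi\alpha|\phi_h(\beta,\gamma))=\phi_h(\alpha|\beta,\gamma)\circ(\phi_h(\alpha,\beta)|\Phi\gamma)\circ\kappa$. - Horizontally colax: $\phi_h(x):\Phi(\mathrm{id}_x)\to\mathrm{id}_{\Phi x}$, $\phi_h(x,y):\Phi(x|y)\to\Phi x|\Phi y$, with $\lambda_{\Phi\alpha}\circ(\phi_h(v)|\Phi\alpha)\circ\phi_h(\mathrm{id}_v,\alpha)=\Phi(\lambda_\alpha)$, $\rho_{\Phi\alpha}\circ(\Phi\alpha|\phi_h(w))\circ\phi_h(\alpha,\mathrm{id}_w)=\Phi(\rho_\alpha)$, $\kappa\circ(\Phi\alpha|\phi_h(\beta,\gamma))\circ\phi_h(\alpha,\beta|\gamma)=(\phi_h(\alpha,\beta)|\Phi\gamma)\circ\phi_h(\alpha|\beta,\gamma)\circ\Phi(\kappa)$. Vertical/horizontal compatibility: - Lax-lax: $\Phi(\tau_A)\phi_v(\mathrm{id}_A)\mathrm{Id}_{\phi_h(A)}=\phi_h(\mathrm{Id}_A)\,\mathrm{id}_{\phi_v(A)}\,\tau_{\Phi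 A}$; $\Phi(\mu(v,\bar v))\,\phi_v(\mathrm{id}_v,\mathrm{id}_{\bar v})\,\frac{\phi_h(v)}{\phi_h(\bar v)}=\phi_h(\frac v{\bar v})\,\mathrm{id}_{\phi_v(v,\bar v)}\,\mu(\Phi v,\Phi\bar v)$; $\Phi(\delta(h,k))\,\phi_v(h|k)\,\mathrm{Id}_{\phi_h(h,k)}=\phi_h(\mathrm{Id}_h,\mathrm{Id}_k)\,(\phi_v(h)|\phi_v(k))\,\delta(\Phi h,\Phi k)$; $\Phi(\chi)\,\phi_v(\alpha|\beta,\bar\alpha|\bar\beta)\,\frac{\phi_h(\alpha,\beta)}{\phi_h(\bar\alpha,\bar\beta)}=\phi_h(\frac\alpha{\bar\alpha},\frac\beta{\bar\beta})\,(\phi_v(\alpha,\bar\alpha)|\phi_v(\beta,\bar\beta))\,\chi$. - Colax-lax: $\phi_h(\mathrm{Id}_A)\Phi(\tau_A)\phi_v(\mathrm{id}_A)=\mathrm{id}_{\phi_v(A)}\,\tau_{\Phi A}\,\mathrm{Id}_{\phi_h(A)}$; $\phi_h(\frac v{\bar v})\,\Phi(\mu(v,\bar v))\,\phi_v(\mathrm{id}_v,\mathrm{id}_{\bar v})=\mathrm{id}_{\phi_v(v,\bar v)}\,\mu(\Phi v,\Phi\bar v)\,\frac{\phi_h(v)}{\phi_h(\bar v)}$; $\phi_h(\mathrm{Id}_h,\mathrm{Id}_k)\,\Phi(\delta(h,k))\,\phi_v(h|k)=(\phi_v(h)|\phi_v(k))\,\delta(\Phi h,\Phi k)\,\mathrm{Id}_{\phi_h(h,k)}$;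 $\phi_h(\frac\alpha{\bar\alpha},\frac\beta{\bar\beta})\,\Phi(\chi)\,\phi_v(\alpha|\beta,\bar\alpha|\bar\beta)=(\phi_v(\alpha,\bar\alpha)|\phi_v(\beta,\bar\beta))\,\chi\,\frac{\phi_h(\alpha,\beta)}{\phi_h(\bar\alpha,\bar\beta)}$. - Colax-colax: $\tau_{\Phi A}\,\mathrm{Id}_{\phi_h(A)}\,\phi_v(\mathrm{id}_A)=\mathrm{id}_{\phi_v(A)}\,\phi_h(\mathrm{Id}_A)\,\Phi(\tau_A)$; $\mu(\Phi v,\Phi\bar v)\,\frac{\phi_h(v)}{\phi_h(\bar v)}\,\phi_v(\mathrm{id}_v,\mathrm{id}_{\bar v})=\mathrm{id}_{\phi_v(v,\bar v)}\,\phi_h(\frac v{\bar v})\,\Phi(\mu(v,\bar v))$; $\delta(\Phi h,\Phi k)\,\mathrm{Id}_{\phi_h(h,k)}\,\phi_v(h|k)=(\phi_v(h)|\phi_v(k))\,\phi_h(\mathrm{Id}_h,\mathrm{Id}_k)\,\Phi(\delta(h,k))$; $\chi\,\frac{\phi_h(\alpha,\beta)}{\phi_h(\bar\alpha,\bar\beta)}\,\phi_v(\alpha|\beta,\bar\alpha|\bar\beta)=(\phi_v(\alpha,\bar\alpha)|\phi_v(\beta,\bar\beta))\,\phi_h(\frac\alpha{\bar\alpha},\frac\beta{\bar\beta})\,\Phi(\chi)$. Morphisms of the same kind compose by composing the functors and the comparisons in the evident way. **Double cells.** Consider morphisms $\Phi:\mathsf A\to\mathsf B$, $\Psi:\mathsf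 C\to\mathsf D$ of one kind and $\Sigma:\mathsf A\to\mathsf C$, $\Theta:\mathsf B\to\mathsf D$ of another kind, where (kind of $\Phi,\Psi$ / kind of $\Sigma,\Theta$) is lax-lax/colax-lax, or colax-lax/colax-colax, or lax-lax/colax-colax. A cell $\pi$ with this boundary assigns to each object, vertical arrow, horizontal arrow and basic cell $x$ of $\mathsf A$ a transversal arrow, vertical cell, horizontal cell, cube respectively $\pi x:\Theta\Phi x\to\Psi\Sigma x$ of $\mathsf D$, naturally in the transversal direction and compatibly with $\partial_i,D_i$, satisfying, in the vertical direction (for $x\star y=\frac xy$ and the comparisons with subscript $v$, and for $\mathrm{Id}$) and in the horizontal direction (for $x\star y=x|y$ and the comparisons with subscript $h$, and for $\mathrm{id}$), the following (here $\phi,\psi,\sigma,\theta$ are the comparisons of $\Phi,\Psi,\Sigma,\Theta$, and the identity $\mathrm{Id}$ or $\mathrm{id}$ is written $I$): - if all four are lax in that direction: $\pi(x\star y)\,\Theta(\phi(x,y))\,\theta(\Phi x,\Phi y)=\Psi(\sigma(x,y))\,\psi(\Sigma x,\Sigma y)\,(\pi x\star\pi y)$ and $\pi(I_x)\,\Theta(\phi(x))\,\theta(\Phi x)=\Psi(\sigma(x))\,\psi(\Sigma x)\,I_{\pi x}$; - if $\Phi,\Psi$ are lax and $\Sigma,\Theta$ colax in that direction: $\Psi(\sigma(x,y))\,\pi(x\star y)\,\Theta(\phi(x,y))=\psi(\Sigma x,\Sigma y)\,(\pi x\star\pi y)\,\theta(\Phi x,\Phi y)$ and $\Psi(\sigma(x))\,\pi(I_x)\,\Theta(\phi(x))=\psi(\Sigma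 x)\,I_{\pi x}\,\theta(\Phi x)$; - if all four are colax in that direction: $\psi(\Sigma x,\Sigma y)\,\Psi(\sigma(x,y))\,\pi(x\star y)=(\pi x\star\pi y)\,\theta(\Phi x,\Phi y)\,\Theta(\phi(x,y))$ and $\psi(\Sigma x)\,\Psi(\sigma(x))\,\pi(I_x)=I_{\pi x}\,\theta(\Phi x)\,\Theta(\phi(x))$. Cells compose by: if $\pi'$ has boundary $\Phi':\mathsf B\to\mathsf B'$, $\Psi':\mathsf D\to\mathsf D'$, $\Theta,\Theta'$, then $(\pi|\pi')(\alpha)=(\Psi'\pi\alpha)(\pi'\Phi\alpha)$; if $\bar\pi$ has boundary $\Psi,\bar\Psi$, $\bar\Sigma,\bar\Theta$, then $\frac{\pi}{\bar\pi}(\alpha)=(\bar\pi\Sigma\alpha)(\bar\Theta\pi\alpha)$. **Commuting cubes.** A cube has lax-lax edges $\Phi:\mathsf A\to\mathsf B$, $\Psi:\mathsf C\to\mathsf D$, $\Phi':\mathsf A'\to\mathsf B'$, $\Psi':\mathsf C'\to\mathsf D'$; colax-colax edges $\Sigma:\mathsf A\to\mathsf C$, $\Theta:\mathsf B\to\mathsf D$, $\Sigma':\mathsf A'\to\mathsf C'$, $\Theta':\mathsf B'\to\mathsf D'$; colax-lax edges $K:\mathsf A\to\mathsf A'$, $K':\mathsf B\to\mathsf B'$, $L:\mathsf C\to\mathsf C'$, $L':\mathsf D\to\mathsf D'$; and faces that are cells $\pi:\Theta\Phi\to\Psi\Sigma$, $\pi':\Theta'\Phi'\to\Psi'\Sigma'$,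 $\kappa:K'\Phi\to\Phi'K$, $\bar\kappa:L'\Psi\to\Psi'L$, $\lambda:\Sigma'K\to L\Sigma$, $\bar\lambda:\Theta'K'\to L'\Theta$. It commutes if for every $\alpha$ in $\mathsf A$ $$(\Psi'\lambda\alpha)(\pi'K\alpha)(\Theta'\kappa\alpha)=(\bar\kappa\Sigma\alpha)(L'\pi\alpha)(\bar\lambda\Phi\alpha):\ \Theta'K'\Phi\alpha\to\Psi'L\Sigma\alpha .$$ A strict triple category is a category object in the category of strict double categories: three kinds of arrows, for each pair of kinds double cells forming a strict double category, and triple cells (cubes) with three strictly associative and unitary compositions, any two satisfying interchange. *)

(* Defs.v *)
From mathcomp Require Import ssreflect ssrfun ssrbool.

Set Implicit Arguments.
Unset Strict Implicit.
Unset Printing Implicit Defensive.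

(** * Partial terms

    Strict commutation of functors with sources, targets and composition is
    kept free of transports by presenting all structures essentially
    algebraically: a partially defined operation takes its values in [option],
    with an axiom saying exactly when it is defined.  [x ≐ y] is the equation of
    partial terms: both sides are defined, and they are equal. *)

Definition peq {T : Type} (x y : option T) : Prop :=
  exists t : T, x = Some t /\ y = Some t.

Definition defined {T : Type} (x : option T) : Prop := exists t : T, x = Some t.

Notation "↑ x" := (Some x) (at level 9, x at level 9, format "↑ x").
Notation "x ≐ y" := (peq x y) (at level 70, no associativity).

Definition lift2 {A B R : Type} (f : A -> B -> option R)
    (x : option A) (y : option B) : option R :=
  obind (fun a => obind (f a) y) x.

Definition lift3 {A B C R : Type} (f : A -> B -> C -> option R)
    (x : option A) (y : option B) (z : option C) : option R :=
  obind (fun a => lift2 (f a) y z) x.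

Definition lift4 {A B C D R : Type} (f : A -> B -> C -> D -> option R)
    (x : option A) (y : option B) (z : option C) (t : option D) : option R :=
  obind (fun a => lift3 (f a) y z t) x.

(** * Strict categories *)

Record graph (O M : Type) := Graph { dom : M -> O; cod : M -> O }.

(** [comp g f] is "[g] after [f]". *)
Record category_on (O M : Type) (G : graph O M) := CategoryOn {
  idm : O -> M;
  comp : M -> M -> option M;
  dom_idm : forall x, dom G (idm x) = x;
  cod_idm : forall x, cod G (idm x) = x;
  comp_defined : forall g f, defined (comp g f) <-> dom G g = cod G f;
  dom_comp : forall g f h, comp g f = Some h -> dom G h = dom G f;
  cod_comp : forall g f h, comp g f = Some h -> cod G h = cod G g;
  comp_idl : forall f, comp (idm (cod G f)) f = Some f;
  comp_idr : forall f, comp f (idm (dom G f)) = Some f;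
  comp_assoc : forall h g f, dom G h = cod G g -> dom G g = cod G f ->
    lift2 comp ↑h (comp g f) ≐ lift2 comp (comp h g) ↑f }.

Record category := Category {
  ob : Type;
  arr : Type;
  cat_graph : graph ob arr;
  cat_str : category_on cat_graph }.

Definition src {C : category} (f : arr C) : ob C := dom (cat_graph C) f.
Definition tgt {C : category} (f : arr C) : ob C := cod (cat_graph C) f.
Definition id1 {C : category} (x : ob C) : arr C := idm (cat_str C) x.
Definition after {C : category} (g f : arr C) : option (arr C) :=
  comp (cat_str C) g f.

Definition oid {C : category} : option (ob C) -> option (arr C) := omap id1.
Definition oafter {C : category} := lift2 (@after C).
Notation "g ∘ f" := (oafter g f) (at level 40, left associativity).

Definition is_identity {C : category} (f : arr C) : Prop :=
  exists x : ob C, f = id1 x.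

Definition is_iso {C : category} (f : arr C) : Prop :=
  exists g : arr C, after g f = Some (id1 (src f)) /\
                    after f g = Some (id1 (tgt f)).

Record functor (C D : category) := Functor {
  fob :> ob C -> ob D;
  farr : arr C -> arr D;
  farr_src : forall f, src (farr f) = fob (src f);
  farr_tgt : forall f, tgt (farr f) = fob (tgt f);
  farr_id : forall x, farr (id1 x) = id1 (fob x);
  farr_after : forall g f h, after g f = Some h ->
    after (farr g) (farr f) = Some (farr h) }.

Notation "F <o> x" := (omap (fob F) x) (at level 30, right associativity).
Notation "F <a> f" := (omap (farr F) f) (at level 30, right associativity).

Definition fid (C : category) : functor C C :=
  @Functor C C id id (fun=> erefl) (fun=> erefl) (fun=> erefl)
    (fun _ _ _ e => e).

Definition fcomp (C D E : category) (G : functor D E) (F : functor C D) :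
  functor C E.
Proof.
exists (fun x => G (F x)) (fun f => farr G (farr F f)) => [f|f|x|g f h e].
- by rewrite !farr_src.
- by rewrite !farr_tgt.
- by rewrite !farr_id.
- by do 2!apply: farr_after.
Defined.

Record natural (C D : category) (F G : functor C D) (t : ob C -> arr D) :
    Prop := Natural {
  nat_src : forall x, src (t x) = F x;
  nat_tgt : forall x, tgt (t x) = G x;
  nat_sq : forall f, ↑(farr G f) ∘ ↑(t (src f)) ≐ ↑(t (tgt f)) ∘ ↑(farr F f) }.

(** * Pseudocategories in Cat

    [pob] and [parr] are the object and arrow parts of the composition functor
    [Y2 -> Y1], the pullback [Y2] of [pd1] and [pd0] being its domain of
    definition.  The arguments are in diagrammatic order: [pob x y] is [x|y] in
    a row and "[x] above [y]" in a column. *)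

Record pseudocat_data (Y0 Y1 : category) := PseudocatData {
  pd0 : functor Y1 Y0;
  pd1 : functor Y1 Y0;
  punit : functor Y0 Y1;
  pob : ob Y1 -> ob Y1 -> option (ob Y1);
  parr : arr Y1 -> arr Y1 -> option (arr Y1);
  passoc : ob Y1 -> ob Y1 -> ob Y1 -> option (arr Y1);
  plam : ob Y1 -> arr Y1;
  prho : ob Y1 -> arr Y1 }.

Notation "x ⋆[ P ] y" := (lift2 (pob P) x y) (at level 36, no associativity).
Notation "f ⊛[ P ] g" := (lift2 (parr P) f g) (at level 36, no associativity).

Section Pseudocategories.
Variables (Y0 Y1 : category) (P : pseudocat_data Y0 Y1).

Definition kappa := lift3 (passoc P).
Definition lam := omap (plam P).
Definition rho := omap (prho P).

Definition composable (x y : ob Y1) : Prop := pd1 P x = pd0 P y.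
Definition composable_arr (f g : arr Y1) : Prop :=
  farr (pd1 P) f = farr (pd0 P) g.

Definition globular (f : arr Y1) : Prop :=
  is_identity (farr (pd0 P) f) /\ is_identity (farr (pd1 P) f).

Record pseudocat_axioms : Prop := PseudocatAxioms {
  pd0_unit : fcomp (pd0 P) (punit P) = fid Y0;
  pd1_unit : fcomp (pd1 P) (punit P) = fid Y0;
  pob_defined : forall x y, defined (pob P x y) <-> composable x y;
  parr_defined : forall f g, defined (parr P f g) <-> composable_arr f g;
  pd0_pob : forall x y z, pob P x y = Some z -> pd0 P z = pd0 P x;
  pd1_pob : forall x y z, pob P x y = Some z -> pd1 P z = pd1 P y;
  pd0_parr : forall f g h,
    parr P f g = Some h -> farr (pd0 P) h = farr (pd0 P) f;
  pd1_parr : forall f g h,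
    parr P f g = Some h -> farr (pd1 P) h = farr (pd1 P) g;
  parr_src : forall f g h,
    parr P f g = Some h -> pob P (src f) (src g) = Some (src h);
  parr_tgt : forall f g h,
    parr P f g = Some h -> pob P (tgt f) (tgt g) = Some (tgt h);
  parr_id : forall x y, composable x y ->
    ↑(id1 x) ⊛[P] ↑(id1 y) ≐ oid (↑x ⋆[P] ↑y);
  parr_after : forall f' f g' g,
    src f' = tgt f -> src g' = tgt g ->
    composable_arr f g -> composable_arr f' g' ->
    (↑f' ∘ ↑f) ⊛[P] (↑g' ∘ ↑g) ≐ (↑f' ⊛[P] ↑g') ∘ (↑f ⊛[P] ↑g);

  passoc_defined : forall x y z,
    defined (passoc P x y z) <-> composable x y /\ composable y z;
  passoc_src : forall x y z k, passoc P x y z = Some k ->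
    ↑x ⋆[P] (↑y ⋆[P] ↑z) = Some (src k);
  passoc_tgt : forall x y z k, passoc P x y z = Some k ->
    (↑x ⋆[P] ↑y) ⋆[P] ↑z = Some (tgt k);
  passoc_globular : forall x y z k, passoc P x y z = Some k -> globular k;
  passoc_iso : forall x y z k, passoc P x y z = Some k -> is_iso k;
  passoc_natural : forall f g h, composable_arr f g -> composable_arr g h ->
    ((↑f ⊛[P] ↑g) ⊛[P] ↑h) ∘ kappa ↑(src f) ↑(src g) ↑(src h)
    ≐ kappa ↑(tgt f) ↑(tgt g) ↑(tgt h) ∘ (↑f ⊛[P] (↑g ⊛[P] ↑h));

  plam_src : forall x,
    ↑(punit P (pd0 P x)) ⋆[P] ↑x = Some (src (plam P x));
  plam_tgt : forall x, tgt (plam P x) = x;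
  plam_globular : forall x, globular (plam P x);
  plam_iso : forall x, is_iso (plam P x);
  plam_natural : forall f,
    ↑f ∘ lam ↑(src f)
    ≐ lam ↑(tgt f) ∘ (↑(farr (punit P) (farr (pd0 P) f)) ⊛[P] ↑f);

  prho_src : forall x,
    ↑x ⋆[P] ↑(punit P (pd1 P x)) = Some (src (prho P x));
  prho_tgt : forall x, tgt (prho P x) = x;
  prho_globular : forall x, globular (prho P x);
  prho_iso : forall x, is_iso (prho P x);
  prho_natural : forall f,
    ↑f ∘ rho ↑(src f)
    ≐ rho ↑(tgt f) ∘ (↑f ⊛[P] ↑(farr (punit P) (farr (pd1 P) f)));

  pentagon : forall w x y z,
    composable w x -> composable x y -> composable y z ->
    kappa (↑w ⋆[P] ↑x) ↑y ↑z ∘ kappa ↑w ↑x (↑y ⋆[P] ↑z)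
    ≐ (kappa ↑w ↑x ↑y ⊛[P] oid ↑z) ∘ kappa ↑w (↑x ⋆[P] ↑y) ↑z
      ∘ (oid ↑w ⊛[P] kappa ↑x ↑y ↑z);
  triangle : forall x y, composable x y ->
    (rho ↑x ⊛[P] oid ↑y) ∘ kappa ↑x ↑(punit P (pd1 P x)) ↑y
    ≐ oid ↑x ⊛[P] lam ↑y }.

End Pseudocategories.

Record pseudocat (Y0 Y1 : category) := Pseudocat {
  pseudocat_str :> pseudocat_data Y0 Y1;
  pseudocat_ax : pseudocat_axioms pseudocat_str }.

Record strict_pseudofunctor (Y0 Y1 Z0 Z1 : category)
    (P : pseudocat Y0 Y1) (Q : pseudocat Z0 Z1)
    (F0 : functor Y0 Z0) (F1 : functor Y1 Z1) : Prop := StrictPseudofunctor {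
  strict_d0 : fcomp F0 (pd0 P) = fcomp (pd0 Q) F1;
  strict_d1 : fcomp F0 (pd1 P) = fcomp (pd1 Q) F1;
  strict_unit : fcomp F1 (punit P) = fcomp (punit Q) F0;
  strict_pob : forall x y z,
    pob P x y = Some z -> pob Q (F1 x) (F1 y) = Some (F1 z);
  strict_parr : forall f g h,
    parr P f g = Some h -> parr Q (farr F1 f) (farr F1 g) = Some (farr F1 h);
  strict_passoc : forall x y z k, passoc P x y z = Some k ->
    passoc Q (F1 x) (F1 y) (F1 z) = Some (farr F1 k);
  strict_plam : forall x, farr F1 (plam P x) = plam Q (F1 x);
  strict_prho : forall x, farr F1 (prho P x) = prho Q (F1 x) }.

(** * Intercategories

    The third row and the third column are not separate data: their categories
    are pullbacks, and commutation with the projections determines their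
    structure from the rest, as the domains of definition of the compositions.
    In [row0] and [row1] the functors [pd0], [pd1], [punit] are ∂0, ∂1, id, and
    [pob], [parr] are m; in [colA] and [colB] they are D0, D1, Id and M. *)

Record intercat_data := IntercatData {
  A0 : category;
  A1 : category;
  B0 : category;
  B1 : category;
  row0 : pseudocat A0 B0;
  row1 : pseudocat A1 B1;
  colA : pseudocat A0 A1;
  colB : pseudocat B0 B1;
  tau : ob A0 -> arr B1;
  mu : ob A1 -> ob A1 -> option (arr B1);
  delta : ob B0 -> ob B0 -> option (arr B1);
  chi : ob B1 -> ob B1 -> ob B1 -> ob B1 -> option (arr B1) }.

Section Intercategories.
Variable X : intercat_data.

Local Notation R0 := (row0 X).
Local Notation R1 := (row1 X).
Local Notation CA := (colA X).
Local Notation CB := (colB X).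
Local Notation idr0 := (punit R0).
Local Notation idr1 := (punit R1).
Local Notation IdA := (punit CA).
Local Notation IdB := (punit CB).

Definition otau := omap (@tau X).
Definition omu := lift2 (@mu X).
Definition odelta := lift2 (@delta X).
Definition ochi := lift4 (@chi X).

(** [a] [b] side by side, above [a'] [b'] side by side. *)
Definition composable4 (a b a' b' : ob (B1 X)) : Prop :=
  [/\ composable R1 a b, composable R1 a' b',
      composable CB a a' & composable CB b b'].
Definition composable4_arr (a b a' b' : arr (B1 X)) : Prop :=
  [/\ composable_arr R1 a b, composable_arr R1 a' b',
      composable_arr CB a a' & composable_arr CB b b'].

Definition interchanger_globular (c : arr (B1 X)) : Prop :=
  globular R1 c /\ globular CB c.

Record intercat_axioms : Prop := IntercatAxioms {
  d0_strict : strict_pseudofunctor CB CA (pd0 R0) (pd0 R1);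
  d1_strict : strict_pseudofunctor CB CA (pd1 R0) (pd1 R1);
  D0_strict : strict_pseudofunctor R1 R0 (pd0 CA) (pd0 CB);
  D1_strict : strict_pseudofunctor R1 R0 (pd1 CA) (pd1 CB);

  tau_natural : natural (fcomp IdB idr0) (fcomp idr1 IdA) (@tau X);
  tau_globular : forall A, interchanger_globular (tau A);

  mu_defined : forall v v', defined (mu v v') <-> composable CA v v';
  mu_src : forall v v' c, mu v v' = Some c ->
    ↑(idr1 v) ⋆[CB] ↑(idr1 v') = Some (src c);
  mu_tgt : forall v v' c, mu v v' = Some c ->
    idr1 <o> (↑v ⋆[CA] ↑v') = Some (tgt c);
  mu_globular : forall v v' c, mu v v' = Some c -> interchanger_globular c;
  mu_natural : forall f f' : arr (A1 X), composable_arr CA f f' ->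
    (idr1 <a> (↑f ⊛[CA] ↑f')) ∘ omu ↑(src f) ↑(src f')
    ≐ omu ↑(tgt f) ↑(tgt f') ∘ (↑(farr idr1 f) ⊛[CB] ↑(farr idr1 f'));

  delta_defined : forall h k, defined (delta h k) <-> composable R0 h k;
  delta_src : forall h k c, delta h k = Some c ->
    IdB <o> (↑h ⋆[R0] ↑k) = Some (src c);
  delta_tgt : forall h k c, delta h k = Some c ->
    ↑(IdB h) ⋆[R1] ↑(IdB k) = Some (tgt c);
  delta_globular : forall h k c,
    delta h k = Some c -> interchanger_globular c;
  delta_natural : forall f g : arr (B0 X), composable_arr R0 f g ->
    (↑(farr IdB f) ⊛[R1] ↑(farr IdB g)) ∘ odelta ↑(src f) ↑(src g)
    ≐ odelta ↑(tgt f) ↑(tgt g) ∘ (IdB <a> (↑f ⊛[R0] ↑g));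

  chi_defined : forall a b a' b',
    defined (chi a b a' b') <-> composable4 a b a' b';
  chi_src : forall a b a' b' c, chi a b a' b' = Some c ->
    (↑a ⋆[R1] ↑b) ⋆[CB] (↑a' ⋆[R1] ↑b') = Some (src c);
  chi_tgt : forall a b a' b' c, chi a b a' b' = Some c ->
    (↑a ⋆[CB] ↑a') ⋆[R1] (↑b ⋆[CB] ↑b') = Some (tgt c);
  chi_globular : forall a b a' b' c,
    chi a b a' b' = Some c -> interchanger_globular c;
  chi_natural : forall f g f' g', composable4_arr f g f' g' ->
    ((↑f ⊛[CB] ↑f') ⊛[R1] (↑g ⊛[CB] ↑g'))
      ∘ ochi ↑(src f) ↑(src g) ↑(src f') ↑(src g')
    ≐ ochi ↑(tgt f) ↑(tgt g) ↑(tgt f') ↑(tgt g')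
      ∘ ((↑f ⊛[R1] ↑g) ⊛[CB] (↑f' ⊛[R1] ↑g'));

  mu_assoc : forall v v' v'', composable CA v v' -> composable CA v' v'' ->
    (idr1 <a> kappa CA ↑v ↑v' ↑v'') ∘ omu ↑v (↑v' ⋆[CA] ↑v'')
      ∘ (oid ↑(idr1 v) ⊛[CB] omu ↑v' ↑v'')
    ≐ omu (↑v ⋆[CA] ↑v') ↑v'' ∘ (omu ↑v ↑v' ⊛[CB] oid ↑(idr1 v''))
      ∘ kappa CB ↑(idr1 v) ↑(idr1 v') ↑(idr1 v'');

  mu_tau_l : forall v,
    (idr1 <a> lam CA ↑v) ∘ omu ↑(IdA (pd0 CA v)) ↑v
      ∘ (otau ↑(pd0 CA v) ⊛[CB] oid ↑(idr1 v))
    ≐ lam CB ↑(idr1 v);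
  mu_tau_r : forall v,
    (idr1 <a> rho CA ↑v) ∘ omu ↑v ↑(IdA (pd1 CA v))
      ∘ (oid ↑(idr1 v) ⊛[CB] otau ↑(pd1 CA v))
    ≐ rho CB ↑(idr1 v);

  chi_vassoc : forall a b c z e n,
    composable4 a b c z -> composable4 c z e n ->
    (kappa CB ↑a ↑c ↑e ⊛[R1] kappa CB ↑b ↑z ↑n)
      ∘ ochi ↑a ↑b (↑c ⋆[CB] ↑e) (↑z ⋆[CB] ↑n)
      ∘ (oid (↑a ⋆[R1] ↑b) ⊛[CB] ochi ↑c ↑z ↑e ↑n)
    ≐ ochi (↑a ⋆[CB] ↑c) (↑b ⋆[CB] ↑z) ↑e ↑n
      ∘ (ochi ↑a ↑b ↑c ↑z ⊛[CB] oid (↑e ⋆[R1] ↑n))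
      ∘ kappa CB (↑a ⋆[R1] ↑b) (↑c ⋆[R1] ↑z) (↑e ⋆[R1] ↑n);

  chi_delta_l : forall a b, composable R1 a b ->
    (lam CB ↑a ⊛[R1] lam CB ↑b)
      ∘ ochi ↑(IdB (pd0 CB a)) ↑(IdB (pd0 CB b)) ↑a ↑b
      ∘ (odelta ↑(pd0 CB a) ↑(pd0 CB b) ⊛[CB] oid (↑a ⋆[R1] ↑b))
    ≐ lam CB (↑a ⋆[R1] ↑b);
  chi_delta_r : forall a b, composable R1 a b ->
    (rho CB ↑a ⊛[R1] rho CB ↑b)
      ∘ ochi ↑a ↑b ↑(IdB (pd1 CB a)) ↑(IdB (pd1 CB b))
      ∘ (oid (↑a ⋆[R1] ↑b) ⊛[CB] odelta ↑(pd1 CB a) ↑(pd1 CB b))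
    ≐ rho CB (↑a ⋆[R1] ↑b);

  chi_hassoc : forall a b c z e n,
    composable4 a b z e -> composable4 b c e n ->
    kappa R1 (↑a ⋆[CB] ↑z) (↑b ⋆[CB] ↑e) (↑c ⋆[CB] ↑n)
      ∘ (oid (↑a ⋆[CB] ↑z) ⊛[R1] ochi ↑b ↑c ↑e ↑n)
      ∘ ochi ↑a (↑b ⋆[R1] ↑c) ↑z (↑e ⋆[R1] ↑n)
    ≐ (ochi ↑a ↑b ↑z ↑e ⊛[R1] oid (↑c ⋆[CB] ↑n))
      ∘ ochi (↑a ⋆[R1] ↑b) ↑c (↑z ⋆[R1] ↑e) ↑n
      ∘ (kappa R1 ↑a ↑b ↑c ⊛[CB] kappa R1 ↑z ↑e ↑n);

  delta_assoc : forall h k l, composable R0 h k -> composable R0 k l ->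
    kappa R1 ↑(IdB h) ↑(IdB k) ↑(IdB l)
      ∘ (oid ↑(IdB h) ⊛[R1] odelta ↑k ↑l) ∘ odelta ↑h (↑k ⋆[R0] ↑l)
    ≐ (odelta ↑h ↑k ⊛[R1] oid ↑(IdB l)) ∘ odelta (↑h ⋆[R0] ↑k) ↑l
      ∘ (IdB <a> kappa R0 ↑h ↑k ↑l);

  chi_mu_l : forall a b, composable CB a b ->
    lam R1 (↑a ⋆[CB] ↑b)
      ∘ (omu ↑(pd0 R1 a) ↑(pd0 R1 b) ⊛[R1] oid (↑a ⋆[CB] ↑b))
      ∘ ochi ↑(idr1 (pd0 R1 a)) ↑a ↑(idr1 (pd0 R1 b)) ↑b
    ≐ lam R1 ↑a ⊛[CB] lam R1 ↑b;
  chi_mu_r : forall a b, composable CB a b ->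
    rho R1 (↑a ⋆[CB] ↑b)
      ∘ (oid (↑a ⋆[CB] ↑b) ⊛[R1] omu ↑(pd1 R1 a) ↑(pd1 R1 b))
      ∘ ochi ↑a ↑(idr1 (pd1 R1 a)) ↑b ↑(idr1 (pd1 R1 b))
    ≐ rho R1 ↑a ⊛[CB] rho R1 ↑b;

  delta_tau_l : forall h,
    lam R1 ↑(IdB h) ∘ (otau ↑(pd0 R0 h) ⊛[R1] oid ↑(IdB h))
      ∘ odelta ↑(idr0 (pd0 R0 h)) ↑h
    ≐ IdB <a> lam R0 ↑h;
  delta_tau_r : forall h,
    rho R1 ↑(IdB h) ∘ (oid ↑(IdB h) ⊛[R1] otau ↑(pd1 R0 h))
      ∘ odelta ↑h ↑(idr0 (pd1 R0 h))
    ≐ IdB <a> rho R0 ↑h }.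

End Intercategories.

Record intercat := Intercat {
  intercat_str :> intercat_data;
  intercat_ax : intercat_axioms intercat_str }.

(** * Lax and colax functors between pseudocategories *)

(** The same data serve for lax and for colax functors; only the direction of
    the comparisons [cunit] (at identities) and [cmul] (at composites) differs. *)
Record comparison (Y0 Y1 Z1 : category) := Comparison {
  cunit : ob Y0 -> arr Z1;
  cmul : ob Y1 -> ob Y1 -> option (arr Z1) }.

Record pmap (Y0 Y1 Z0 Z1 : category) := PMap {
  pmap0 : functor Y0 Z0;
  pmap1 : functor Y1 Z1;
  pcmp :> comparison Y0 Y1 Z1 }.

Section LaxColax.
Variables (Y0 Y1 Z0 Z1 : category).
Variables (P : pseudocat Y0 Y1) (Q : pseudocat Z0 Z1).
Variable F : pmap Y0 Y1 Z0 Z1.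
Local Notation F0 := (pmap0 F).
Local Notation F1 := (pmap1 F).

Definition ocunit := omap (cunit F).
Definition ocmul := lift2 (cmul F).

Record pmap_axioms : Prop := PMapAxioms {
  pmap_d0 : fcomp F0 (pd0 P) = fcomp (pd0 Q) F1;
  pmap_d1 : fcomp F0 (pd1 P) = fcomp (pd1 Q) F1;
  cunit_globular : forall a, globular Q (cunit F a);
  cmul_defined : forall x y, defined (cmul F x y) <-> composable P x y;
  cmul_globular : forall x y c, cmul F x y = Some c -> globular Q c }.

Record lax : Prop := Lax {
  lax_pmap : pmap_axioms;
  lax_unit_natural :
    natural (fcomp (punit Q) F0) (fcomp F1 (punit P)) (cunit F);
  lax_mul_src : forall x y c, cmul F x y = Some c ->
    ↑(F1 x) ⋆[Q] ↑(F1 y) = Some (src c);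
  lax_mul_tgt : forall x y c, cmul F x y = Some c ->
    F1 <o> (↑x ⋆[P] ↑y) = Some (tgt c);
  lax_mul_natural : forall f g, composable_arr P f g ->
    (F1 <a> (↑f ⊛[P] ↑g)) ∘ ocmul ↑(src f) ↑(src g)
    ≐ ocmul ↑(tgt f) ↑(tgt g) ∘ (↑(farr F1 f) ⊛[Q] ↑(farr F1 g));
  lax_lam : forall x,
    (F1 <a> lam P ↑x) ∘ ocmul ↑(punit P (pd0 P x)) ↑x
      ∘ (ocunit ↑(pd0 P x) ⊛[Q] oid ↑(F1 x))
    ≐ lam Q ↑(F1 x);
  lax_rho : forall x,
    (F1 <a> rho P ↑x) ∘ ocmul ↑x ↑(punit P (pd1 P x))
      ∘ (oid ↑(F1 x) ⊛[Q] ocunit ↑(pd1 P x))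
    ≐ rho Q ↑(F1 x);
  lax_kappa : forall x y z, composable P x y -> composable P y z ->
    (F1 <a> kappa P ↑x ↑y ↑z) ∘ ocmul ↑x (↑y ⋆[P] ↑z)
      ∘ (oid ↑(F1 x) ⊛[Q] ocmul ↑y ↑z)
    ≐ ocmul (↑x ⋆[P] ↑y) ↑z ∘ (ocmul ↑x ↑y ⊛[Q] oid ↑(F1 z))
      ∘ kappa Q ↑(F1 x) ↑(F1 y) ↑(F1 z) }.

Record colax : Prop := Colax {
  colax_pmap : pmap_axioms;
  colax_unit_natural :
    natural (fcomp F1 (punit P)) (fcomp (punit Q) F0) (cunit F);
  colax_mul_src : forall x y c, cmul F x y = Some c ->
    F1 <o> (↑x ⋆[P] ↑y) = Some (src c);
  colax_mul_tgt : forall x y c, cmul F x y = Some c ->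
    ↑(F1 x) ⋆[Q] ↑(F1 y) = Some (tgt c);
  colax_mul_natural : forall f g, composable_arr P f g ->
    (↑(farr F1 f) ⊛[Q] ↑(farr F1 g)) ∘ ocmul ↑(src f) ↑(src g)
    ≐ ocmul ↑(tgt f) ↑(tgt g) ∘ (F1 <a> (↑f ⊛[P] ↑g));
  colax_lam : forall x,
    lam Q ↑(F1 x) ∘ (ocunit ↑(pd0 P x) ⊛[Q] oid ↑(F1 x))
      ∘ ocmul ↑(punit P (pd0 P x)) ↑x
    ≐ F1 <a> lam P ↑x;
  colax_rho : forall x,
    rho Q ↑(F1 x) ∘ (oid ↑(F1 x) ⊛[Q] ocunit ↑(pd1 P x))
      ∘ ocmul ↑x ↑(punit P (pd1 P x))
    ≐ F1 <a> rho P ↑x;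
  colax_kappa : forall x y z, composable P x y -> composable P y z ->
    kappa Q ↑(F1 x) ↑(F1 y) ↑(F1 z) ∘ (oid ↑(F1 x) ⊛[Q] ocmul ↑y ↑z)
      ∘ ocmul ↑x (↑y ⋆[P] ↑z)
    ≐ (ocmul ↑x ↑y ⊛[Q] oid ↑(F1 z)) ∘ ocmul (↑x ⋆[P] ↑y) ↑z
      ∘ (F1 <a> kappa P ↑x ↑y ↑z) }.

End LaxColax.

Inductive laxity := IsLax | IsColax.

Definition has_laxity (l : laxity) (Y0 Y1 Z0 Z1 : category)
    (P : pseudocat Y0 Y1) (Q : pseudocat Z0 Z1) (F : pmap Y0 Y1 Z0 Z1) : Prop :=
  match l with IsLax => lax P Q F | IsColax => colax P Q F end.

(** * Morphisms of intercategories *)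

(** Lax-lax, colax-lax and colax-colax: horizontal laxity first. *)
Inductive kind := LL | CL | CC.

Definition hlaxity (k : kind) : laxity :=
  match k with LL => IsLax | CL | CC => IsColax end.
Definition vlaxity (k : kind) : laxity :=
  match k with LL | CL => IsLax | CC => IsColax end.

Record inter_map (X Y : intercat) := InterMap {
  onA0 : functor (A0 X) (A0 Y);
  onA1 : functor (A1 X) (A1 Y);
  onB0 : functor (B0 X) (B0 Y);
  onB1 : functor (B1 X) (B1 Y);
  cmp_row0 : comparison (A0 X) (B0 X) (B0 Y);
  cmp_row1 : comparison (A1 X) (B1 X) (B1 Y);
  cmp_colA : comparison (A0 X) (A1 X) (A1 Y);
  cmp_colB : comparison (B0 X) (B1 X) (B1 Y) }.

Section Morphisms.
Variables (X Y : intercat) (Φ : inter_map X Y).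

Definition map_row0 := PMap (onA0 Φ) (onB0 Φ) (cmp_row0 Φ).
Definition map_row1 := PMap (onA1 Φ) (onB1 Φ) (cmp_row1 Φ).
Definition map_colA := PMap (onA0 Φ) (onA1 Φ) (cmp_colA Φ).
Definition map_colB := PMap (onB0 Φ) (onB1 Φ) (cmp_colB Φ).

(** φh is [phi_h0] on objects and horizontal arrows, [phi_h1] on vertical
    arrows and basic cells; φv is [phi_vA] on objects and vertical arrows,
    [phi_vB] on horizontal arrows and basic cells. *)
Local Notation phi_h0 := (ocunit map_row0).
Local Notation phi_h1 := (ocunit map_row1).
Local Notation phi_vA := (ocunit map_colA).
Local Notation phi_vB := (ocunit map_colB).
Local Notation phi2_h0 := (ocmul map_row0).
Local Notation phi2_h1 := (ocmul map_row1).
Local Notation phi2_vA := (ocmul map_colA).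
Local Notation phi2_vB := (ocmul map_colB).

(** [F0], [F1] send the comparisons [c1] of one level to those, [c0], of the
    level below. *)
Definition cmp_compatible (U0 U1 V0 V1 W Z : category)
    (F0 : functor U0 V0) (F1 : functor U1 V1) (G : functor W Z)
    (c1 : comparison U0 U1 W) (c0 : comparison V0 V1 Z) : Prop :=
  (forall a, farr G (cunit c1 a) = cunit c0 (F0 a)) /\
  (forall x y c, cmul c1 x y = Some c ->
     cmul c0 (F1 x) (F1 y) = Some (farr G c)).

(** The four vertical/horizontal compatibilities of a kind have the same shape,
    [a1 a2 a3] and [b1 b2 b3] being the two sides of the lax-lax one. *)
Definition compat_eq (k : kind) (C : category)
    (a1 a2 a3 b1 b2 b3 : option (arr C)) : Prop :=
  match k with
  | LL => a1 ∘ a2 ∘ a3 ≐ b1 ∘ b2 ∘ b3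
  | CL => b1 ∘ a1 ∘ a2 ≐ b2 ∘ b3 ∘ a3
  | CC => b3 ∘ a3 ∘ a2 ≐ b2 ∘ b1 ∘ a1
  end.

Record morphism_axioms (k : kind) : Prop := MorphismAxioms {
  mor_row0 : has_laxity (hlaxity k) (row0 X) (row0 Y) map_row0;
  mor_row1 : has_laxity (hlaxity k) (row1 X) (row1 Y) map_row1;
  mor_colA : has_laxity (vlaxity k) (colA X) (colA Y) map_colA;
  mor_colB : has_laxity (vlaxity k) (colB X) (colB Y) map_colB;

  mor_d0 : cmp_compatible (pd0 (row0 X)) (pd0 (row1 X)) (pd0 (row1 Y))
             (cmp_colB Φ) (cmp_colA Φ);
  mor_d1 : cmp_compatible (pd1 (row0 X)) (pd1 (row1 X)) (pd1 (row1 Y))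
             (cmp_colB Φ) (cmp_colA Φ);
  mor_D0 : cmp_compatible (pd0 (colA X)) (pd0 (colB X)) (pd0 (colB Y))
             (cmp_row1 Φ) (cmp_row0 Φ);
  mor_D1 : cmp_compatible (pd1 (colA X)) (pd1 (colB X)) (pd1 (colB Y))
             (cmp_row1 Φ) (cmp_row0 Φ);

  mor_tau : forall A, compat_eq k
    (onB1 Φ <a> otau ↑A)
    (phi_vB ↑(punit (row0 X) A))
    (punit (colB Y) <a> phi_h0 ↑A)
    (phi_h1 ↑(punit (colA X) A))
    (punit (row1 Y) <a> phi_vA ↑A)
    (otau ↑(onA0 Φ A));
  mor_mu : forall v v', composable (colA X) v v' -> compat_eq k
    (onB1 Φ <a> omu ↑v ↑v')
    (phi2_vB ↑(punit (row1 X) v) ↑(punit (row1 X) v'))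
    (phi_h1 ↑v ⊛[colB Y] phi_h1 ↑v')
    (phi_h1 (↑v ⋆[colA X] ↑v'))
    (punit (row1 Y) <a> phi2_vA ↑v ↑v')
    (omu ↑(onA1 Φ v) ↑(onA1 Φ v'));
  mor_delta : forall h h', composable (row0 X) h h' -> compat_eq k
    (onB1 Φ <a> odelta ↑h ↑h')
    (phi_vB (↑h ⋆[row0 X] ↑h'))
    (punit (colB Y) <a> phi2_h0 ↑h ↑h')
    (phi2_h1 ↑(punit (colB X) h) ↑(punit (colB X) h'))
    (phi_vB ↑h ⊛[row1 Y] phi_vB ↑h')
    (odelta ↑(onB0 Φ h) ↑(onB0 Φ h'));
  mor_chi : forall a b a' b', composable4 a b a' b' -> compat_eq k
    (onB1 Φ <a> ochi ↑a ↑b ↑a' ↑b')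
    (phi2_vB (↑a ⋆[row1 X] ↑b) (↑a' ⋆[row1 X] ↑b'))
    (phi2_h1 ↑a ↑b ⊛[colB Y] phi2_h1 ↑a' ↑b')
    (phi2_h1 (↑a ⋆[colB X] ↑a') (↑b ⋆[colB X] ↑b'))
    (phi2_vB ↑a ↑a' ⊛[row1 Y] phi2_vB ↑b ↑b')
    (ochi ↑(onB1 Φ a) ↑(onB1 Φ b) ↑(onB1 Φ a') ↑(onB1 Φ b')) }.

End Morphisms.

Record morphism (k : kind) (X Y : intercat) := Morphism {
  mor_map :> inter_map X Y;
  mor_ax : morphism_axioms mor_map k }.

(** Composite and identity morphisms, specified on the underlying data. *)

Definition composite_comparison (l : laxity) (Y0 Y1 Z0 Z1 W0 W1 : category)
    (G : pmap Z0 Z1 W0 W1) (F : pmap Y0 Y1 Z0 Z1)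
    (c : comparison Y0 Y1 W1) : Prop :=
  match l with
  | IsLax =>
      (forall a, Some (cunit c a)
         = (pmap1 G <a> ocunit F ↑a) ∘ ocunit G ↑(pmap0 F a)) /\
      (forall x y, cmul c x y
         = (pmap1 G <a> ocmul F ↑x ↑y) ∘ ocmul G ↑(pmap1 F x) ↑(pmap1 F y))
  | IsColax =>
      (forall a, Some (cunit c a)
         = ocunit G ↑(pmap0 F a) ∘ (pmap1 G <a> ocunit F ↑a)) /\
      (forall x y, cmul c x y
         = ocmul G ↑(pmap1 F x) ↑(pmap1 F y) ∘ (pmap1 G <a> ocmul F ↑x ↑y))
  end.

Record is_composite_morphism (k : kind) (X Y Z : intercat)
    (Ψ : morphism k Y Z) (Φ : morphism k X Y) (Ξ : morphism k X Z) : Prop :=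
  IsCompositeMorphism {
  composite_A0 : onA0 Ξ = fcomp (onA0 Ψ) (onA0 Φ);
  composite_A1 : onA1 Ξ = fcomp (onA1 Ψ) (onA1 Φ);
  composite_B0 : onB0 Ξ = fcomp (onB0 Ψ) (onB0 Φ);
  composite_B1 : onB1 Ξ = fcomp (onB1 Ψ) (onB1 Φ);
  composite_row0 : composite_comparison (hlaxity k)
    (map_row0 Ψ) (map_row0 Φ) (cmp_row0 Ξ);
  composite_row1 : composite_comparison (hlaxity k)
    (map_row1 Ψ) (map_row1 Φ) (cmp_row1 Ξ);
  composite_colA : composite_comparison (vlaxity k)
    (map_colA Ψ) (map_colA Φ) (cmp_colA Ξ);
  composite_colB : composite_comparison (vlaxity k)
    (map_colB Ψ) (map_colB Φ) (cmp_colB Ξ) }.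

Definition identity_comparison (Y0 Y1 : category) (P : pseudocat Y0 Y1)
    (c : comparison Y0 Y1 Y1) : Prop :=
  (forall a, cunit c a = id1 (punit P a)) /\
  (forall x y, cmul c x y = oid (↑x ⋆[P] ↑y)).

Record is_identity_morphism (k : kind) (X : intercat) (Ξ : morphism k X X) :
    Prop := IsIdentityMorphism {
  identity_A0 : onA0 Ξ = fid (A0 X);
  identity_A1 : onA1 Ξ = fid (A1 X);
  identity_B0 : onB0 Ξ = fid (B0 X);
  identity_B1 : onB1 Ξ = fid (B1 X);
  identity_row0 : identity_comparison (row0 X) (cmp_row0 Ξ);
  identity_row1 : identity_comparison (row1 X) (cmp_row1 Ξ);
  identity_colA : identity_comparison (colA X) (cmp_colA Ξ);
  identity_colB : identity_comparison (colB X) (cmp_colB Ξ) }.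

(** * Double cells *)

(** [square_eq s P S φ ψ σ θ t0 t1]: compatibility of the components [t0], [t1]
    of [π : θφ -> ψσ] with the comparisons, where [P] is the relevant row or
    column of the domain of [φ] and [σ], and [S] that of the codomain of [ψ]
    and [θ]. *)
Inductive square_kind := AllLax | LaxColax | AllColax.

Definition square_eq (s : square_kind)
    (Y0 Y1 Z0 Z1 W0 W1 V0 V1 : category)
    (P : pseudocat Y0 Y1) (S : pseudocat V0 V1)
    (φ : pmap Y0 Y1 Z0 Z1) (ψ : pmap W0 W1 V0 V1)
    (σ : pmap Y0 Y1 W0 W1) (θ : pmap Z0 Z1 V0 V1)
    (t0 : ob Y0 -> arr V0) (t1 : ob Y1 -> arr V1) : Prop :=
  match s with
  | AllLax =>
      (forall x y, composable P x y ->
         omap t1 (↑x ⋆[P] ↑y) ∘ (pmap1 θ <a> ocmul φ ↑x ↑y)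
           ∘ ocmul θ ↑(pmap1 φ x) ↑(pmap1 φ y)
         ≐ (pmap1 ψ <a> ocmul σ ↑x ↑y) ∘ ocmul ψ ↑(pmap1 σ x) ↑(pmap1 σ y)
           ∘ (↑(t1 x) ⊛[S] ↑(t1 y))) /\
      (forall a,
         ↑(t1 (punit P a)) ∘ (pmap1 θ <a> ocunit φ ↑a)
           ∘ ocunit θ ↑(pmap0 φ a)
         ≐ (pmap1 ψ <a> ocunit σ ↑a) ∘ ocunit ψ ↑(pmap0 σ a)
           ∘ ↑(farr (punit S) (t0 a)))
  | LaxColax =>
      (forall x y, composable P x y ->
         (pmap1 ψ <a> ocmul σ ↑x ↑y) ∘ omap t1 (↑x ⋆[P] ↑y)
           ∘ (pmap1 θ <a> ocmul φ ↑x ↑y)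
         ≐ ocmul ψ ↑(pmap1 σ x) ↑(pmap1 σ y) ∘ (↑(t1 x) ⊛[S] ↑(t1 y))
           ∘ ocmul θ ↑(pmap1 φ x) ↑(pmap1 φ y)) /\
      (forall a,
         (pmap1 ψ <a> ocunit σ ↑a) ∘ ↑(t1 (punit P a))
           ∘ (pmap1 θ <a> ocunit φ ↑a)
         ≐ ocunit ψ ↑(pmap0 σ a) ∘ ↑(farr (punit S) (t0 a))
           ∘ ocunit θ ↑(pmap0 φ a))
  | AllColax =>
      (forall x y, composable P x y ->
         ocmul ψ ↑(pmap1 σ x) ↑(pmap1 σ y) ∘ (pmap1 ψ <a> ocmul σ ↑x ↑y)
           ∘ omap t1 (↑x ⋆[P] ↑y)
         ≐ (↑(t1 x) ⊛[S] ↑(t1 y)) ∘ ocmul θ ↑(pmap1 φ x) ↑(pmap1 φ y)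
           ∘ (pmap1 θ <a> ocmul φ ↑x ↑y)) /\
      (forall a,
         ocunit ψ ↑(pmap0 σ a) ∘ (pmap1 ψ <a> ocunit σ ↑a)
           ∘ ↑(t1 (punit P a))
         ≐ ↑(farr (punit S) (t0 a)) ∘ ocunit θ ↑(pmap0 φ a)
           ∘ (pmap1 θ <a> ocunit φ ↑a))
  end.

(** The kind of [Φ], [Ψ], then that of [Σ], [Θ]. *)
Inductive cell_kind := LL_CL | CL_CC | LL_CC.

Definition hkind (c : cell_kind) : kind :=
  match c with LL_CL | LL_CC => LL | CL_CC => CL end.
Definition vkind (c : cell_kind) : kind :=
  match c with LL_CL => CL | CL_CC | LL_CC => CC end.

Definition hsquare (c : cell_kind) : square_kind :=
  match c with LL_CL | LL_CC => LaxColax | CL_CC => AllColax end.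
Definition vsquare (c : cell_kind) : square_kind :=
  match c with LL_CL => AllLax | CL_CC | LL_CC => LaxColax end.

Record inter_trans (X Y : intercat) := InterTrans {
  tA0 : ob (A0 X) -> arr (A0 Y);
  tA1 : ob (A1 X) -> arr (A1 Y);
  tB0 : ob (B0 X) -> arr (B0 Y);
  tB1 : ob (B1 X) -> arr (B1 Y) }.

Section Cells.
Variables (c : cell_kind) (A B C D : intercat).
Variables (Φ : morphism (hkind c) A B) (Ψ : morphism (hkind c) C D).
Variables (Σ : morphism (vkind c) A C) (Θ : morphism (vkind c) B D).

Record cell_axioms (π : inter_trans A D) : Prop := CellAxioms {
  cell_A0 : natural (fcomp (onA0 Θ) (onA0 Φ)) (fcomp (onA0 Ψ) (onA0 Σ)) (tA0 π);
  cell_A1 : natural (fcomp (onA1 Θ) (onA1 Φ)) (fcomp (onA1 Ψ) (onA1 Σ)) (tA1 π);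
  cell_B0 : natural (fcomp (onB0 Θ) (onB0 Φ)) (fcomp (onB0 Ψ) (onB0 Σ)) (tB0 π);
  cell_B1 : natural (fcomp (onB1 Θ) (onB1 Φ)) (fcomp (onB1 Ψ) (onB1 Σ)) (tB1 π);

  cell_d0 : forall h, farr (pd0 (row0 D)) (tB0 π h) = tA0 π (pd0 (row0 A) h);
  cell_d1 : forall h, farr (pd1 (row0 D)) (tB0 π h) = tA0 π (pd1 (row0 A) h);
  cell_d0' : forall a, farr (pd0 (row1 D)) (tB1 π a) = tA1 π (pd0 (row1 A) a);
  cell_d1' : forall a, farr (pd1 (row1 D)) (tB1 π a) = tA1 π (pd1 (row1 A) a);
  cell_D0 : forall v, farr (pd0 (colA D)) (tA1 π v) = tA0 π (pd0 (colA A) v);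
  cell_D1 : forall v, farr (pd1 (colA D)) (tA1 π v) = tA0 π (pd1 (colA A) v);
  cell_D0' : forall a, farr (pd0 (colB D)) (tB1 π a) = tB0 π (pd0 (colB A) a);
  cell_D1' : forall a, farr (pd1 (colB D)) (tB1 π a) = tB0 π (pd1 (colB A) a);

  cell_row0 : square_eq (hsquare c) (row0 A) (row0 D)
    (map_row0 Φ) (map_row0 Ψ) (map_row0 Σ) (map_row0 Θ) (tA0 π) (tB0 π);
  cell_row1 : square_eq (hsquare c) (row1 A) (row1 D)
    (map_row1 Φ) (map_row1 Ψ) (map_row1 Σ) (map_row1 Θ) (tA1 π) (tB1 π);
  cell_colA : square_eq (vsquare c) (colA A) (colA D)
    (map_colA Φ) (map_colA Ψ) (map_colA Σ) (map_colA Θ) (tA0 π) (tA1 π);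
  cell_colB : square_eq (vsquare c) (colB A) (colB D)
    (map_colB Φ) (map_colB Ψ) (map_colB Σ) (map_colB Θ) (tB0 π) (tB1 π) }.

Record cell := Cell {
  cell_trans :> inter_trans A D;
  cell_ax : cell_axioms cell_trans }.

End Cells.

(** The components of [(π|π')] for [π' : Θ'Φ' -> Ψ'Θ], namely
    [(Ψ'πα)(π'Φα)]. *)
Record is_hpasting (A B D D' : intercat)
    (Φ : inter_map A B) (Ψ' : inter_map D D')
    (π : inter_trans A D) (π' : inter_trans B D') (r : inter_trans A D') :
    Prop := IsHPasting {
  hpasting_A0 : forall x,
    Some (tA0 r x) = ↑(farr (onA0 Ψ') (tA0 π x)) ∘ ↑(tA0 π' (onA0 Φ x));
  hpasting_A1 : forall x,
    Some (tA1 r x) = ↑(farr (onA1 Ψ') (tA1 π x)) ∘ ↑(tA1 π' (onA1 Φ x));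
  hpasting_B0 : forall x,
    Some (tB0 r x) = ↑(farr (onB0 Ψ') (tB0 π x)) ∘ ↑(tB0 π' (onB0 Φ x));
  hpasting_B1 : forall x,
    Some (tB1 r x) = ↑(farr (onB1 Ψ') (tB1 π x)) ∘ ↑(tB1 π' (onB1 Φ x)) }.

(** The components of [π] above [π'], for [π' : Θ'Ψ -> Ψ'Σ'], namely
    [(π'Σα)(Θ'πα)]. *)
Record is_vpasting (A C D D' : intercat)
    (Σ : inter_map A C) (Θ' : inter_map D D')
    (π : inter_trans A D) (π' : inter_trans C D') (r : inter_trans A D') :
    Prop := IsVPasting {
  vpasting_A0 : forall x,
    Some (tA0 r x) = ↑(tA0 π' (onA0 Σ x)) ∘ ↑(farr (onA0 Θ') (tA0 π x));
  vpasting_A1 : forall x,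
    Some (tA1 r x) = ↑(tA1 π' (onA1 Σ x)) ∘ ↑(farr (onA1 Θ') (tA1 π x));
  vpasting_B0 : forall x,
    Some (tB0 r x) = ↑(tB0 π' (onB0 Σ x)) ∘ ↑(farr (onB0 Θ') (tB0 π x));
  vpasting_B1 : forall x,
    Some (tB1 r x) = ↑(tB1 π' (onB1 Σ x)) ∘ ↑(farr (onB1 Θ') (tB1 π x)) }.

Record is_identity_trans (A C : intercat) (Σ : inter_map A C)
    (r : inter_trans A C) : Prop := IsIdentityTrans {
  identity_trans_A0 : forall x, tA0 r x = id1 (onA0 Σ x);
  identity_trans_A1 : forall x, tA1 r x = id1 (onA1 Σ x);
  identity_trans_B0 : forall x, tB0 r x = id1 (onB0 Σ x);
  identity_trans_B1 : forall x, tB1 r x = id1 (onB1 Σ x) }.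

(** * Commuting cubes *)

Section Cubes.
Variables (A B C D A' B' C' D' : intercat).
Variables (Φ : morphism LL A B) (Ψ : morphism LL C D).
Variables (Φ' : morphism LL A' B') (Ψ' : morphism LL C' D').
Variables (Σ : morphism CC A C) (Θ : morphism CC B D).
Variables (Σ' : morphism CC A' C') (Θ' : morphism CC B' D').
Variables (K : morphism CL A A') (K' : morphism CL B B').
Variables (L : morphism CL C C') (L' : morphism CL D D').
Variables (π : @cell LL_CC _ _ _ _ Φ Ψ Σ Θ).
Variables (π' : @cell LL_CC _ _ _ _ Φ' Ψ' Σ' Θ').
Variables (κ : @cell LL_CL _ _ _ _ Φ Φ' K K').
Variables (κb : @cell LL_CL _ _ _ _ Ψ Ψ' L L').
Variables (λ : @cell CL_CC _ _ _ _ K L Σ Σ').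
Variables (λb : @cell CL_CC _ _ _ _ K' L' Θ Θ').

Record cube_commutes : Prop := CubeCommutes {
  cube_A0 : forall x,
    ↑(farr (onA0 Ψ') (tA0 λ x)) ∘ ↑(tA0 π' (onA0 K x))
      ∘ ↑(farr (onA0 Θ') (tA0 κ x))
    ≐ ↑(tA0 κb (onA0 Σ x)) ∘ ↑(farr (onA0 L') (tA0 π x))
      ∘ ↑(tA0 λb (onA0 Φ x));
  cube_A1 : forall x,
    ↑(farr (onA1 Ψ') (tA1 λ x)) ∘ ↑(tA1 π' (onA1 K x))
      ∘ ↑(farr (onA1 Θ') (tA1 κ x))
    ≐ ↑(tA1 κb (onA1 Σ x)) ∘ ↑(farr (onA1 L') (tA1 π x))
      ∘ ↑(tA1 λb (onA1 Φ x));
  cube_B0 : forall x,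
    ↑(farr (onB0 Ψ') (tB0 λ x)) ∘ ↑(tB0 π' (onB0 K x))
      ∘ ↑(farr (onB0 Θ') (tB0 κ x))
    ≐ ↑(tB0 κb (onB0 Σ x)) ∘ ↑(farr (onB0 L') (tB0 π x))
      ∘ ↑(tB0 λb (onB0 Φ x));
  cube_B1 : forall x,
    ↑(farr (onB1 Ψ') (tB1 λ x)) ∘ ↑(tB1 π' (onB1 K x))
      ∘ ↑(farr (onB1 Θ') (tB1 κ x))
    ≐ ↑(tB1 κb (onB1 Σ x)) ∘ ↑(farr (onB1 L') (tB1 π x))
      ∘ ↑(tB1 λb (onB1 Φ x)) }.

End Cubes.

(** * Strict double and triple categories *)

(** A category object in Cat, with [(O, H)] as category of objects and [(V, C)]
    as category of arrows: source ([dom gV], [dom gCv]), target, identities and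
    composition are functors. *)
Record strict_double_category (O H V C : Type)
    (gH : graph O H) (gV : graph O V) (gCh : graph V C) (gCv : graph H C)
    (cH : category_on gH) (cV : category_on gV)
    (cCh : category_on gCh) (cCv : category_on gCv) : Prop :=
  StrictDoubleCategory {
  dc_corner00 : forall c, dom gV (dom gCh c) = dom gH (dom gCv c);
  dc_corner01 : forall c, dom gV (cod gCh c) = cod gH (dom gCv c);
  dc_corner10 : forall c, cod gV (dom gCh c) = dom gH (cod gCv c);
  dc_corner11 : forall c, cod gV (cod gCh c) = cod gH (cod gCv c);

  dc_dom_idh : forall v, dom gCv (idm cCh v) = idm cH (dom gV v);
  dc_cod_idh : forall v, cod gCv (idm cCh v) = idm cH (cod gV v);
  dc_dom_comph : forall y x z, comp cCh y x = Some z ->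
    comp cH (dom gCv y) (dom gCv x) = Some (dom gCv z);
  dc_cod_comph : forall y x z, comp cCh y x = Some z ->
    comp cH (cod gCv y) (cod gCv x) = Some (cod gCv z);

  dc_dom_idv : forall h, dom gCh (idm cCv h) = idm cV (dom gH h);
  dc_cod_idv : forall h, cod gCh (idm cCv h) = idm cV (cod gH h);
  dc_dom_compv : forall y x z, comp cCv y x = Some z ->
    comp cV (dom gCh y) (dom gCh x) = Some (dom gCh z);
  dc_cod_compv : forall y x z, comp cCv y x = Some z ->
    comp cV (cod gCh y) (cod gCh x) = Some (cod gCh z);

  dc_id_id : forall o, idm cCh (idm cV o) = idm cCv (idm cH o);
  dc_idv_comph : forall k h l, comp cH k h = Some l ->
    comp cCh (idm cCv k) (idm cCv h) = Some (idm cCv l);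
  dc_idh_compv : forall w v u, comp cV w v = Some u ->
    comp cCv (idm cCh w) (idm cCh v) = Some (idm cCh u);
  dc_interchange : forall x y x' y',
    cod gCh x = dom gCh y -> cod gCh x' = dom gCh y' ->
    cod gCv x = dom gCv x' -> cod gCv y = dom gCv y' ->
    lift2 (comp cCv) (comp cCh y' x') (comp cCh y x)
    ≐ lift2 (comp cCh) (comp cCv y' y) (comp cCv x' x) }.

(** The sorts of a triple category and their sources and targets:
    [g_HT_h : graph s_T s_HT], say, gives the source and target in the
    horizontal direction of a horizontal/transversal cell, which are
    transversal arrows. *)
Record triple_graph := TripleGraph {
  s_O : Type;
  s_T : Type;
  s_H : Type;
  s_V : Type;
  s_HT : Type;
  s_TV : Type;
  s_HV : Type;
  s_HTV : Type;
  g_T : graph s_O s_T;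
  g_H : graph s_O s_H;
  g_V : graph s_O s_V;
  g_HT_h : graph s_T s_HT;
  g_HT_t : graph s_H s_HT;
  g_TV_t : graph s_V s_TV;
  g_TV_v : graph s_T s_TV;
  g_HV_h : graph s_V s_HV;
  g_HV_v : graph s_H s_HV;
  g_HTV_h : graph s_TV s_HTV;
  g_HTV_t : graph s_HV s_HTV;
  g_HTV_v : graph s_HT s_HTV }.

(** A category object in strict double categories, with [tc_HV] as the double
    category of objects and [tc_over_T] as that of (transversal) arrows; the
    other four double categories say that transversal source, target, identity
    and composition are double functors. *)
Record strict_triple_category (G : triple_graph) := StrictTripleCategory {
  c_T : category_on (g_T G);
  c_H : category_on (g_H G);
  c_V : category_on (g_V G);
  c_HT_h : category_on (g_HT_h G);
  c_HT_t : category_on (g_HT_t G);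
  c_TV_t : category_on (g_TV_t G);
  c_TV_v : category_on (g_TV_v G);
  c_HV_h : category_on (g_HV_h G);
  c_HV_v : category_on (g_HV_v G);
  c_HTV_h : category_on (g_HTV_h G);
  c_HTV_t : category_on (g_HTV_t G);
  c_HTV_v : category_on (g_HTV_v G);
  tc_HV : strict_double_category c_H c_V c_HV_h c_HV_v;
  tc_HT : strict_double_category c_H c_T c_HT_h c_HT_t;
  tc_TV : strict_double_category c_T c_V c_TV_t c_TV_v;
  tc_over_T : strict_double_category c_HT_h c_TV_v c_HTV_h c_HTV_v;
  tc_over_H : strict_double_category c_HT_t c_HV_v c_HTV_t c_HTV_v;
  tc_over_V : strict_double_category c_TV_t c_HV_h c_HTV_t c_HTV_h }.

(** * The data of ICat *)

Record mor (k : kind) := Mor {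
  mor_dom : intercat;
  mor_cod : intercat;
  mor_mor : morphism k mor_dom mor_cod }.

Definition mor_graph (k : kind) : graph intercat (mor k) :=
  Graph (@mor_dom k) (@mor_cod k).

Record dcell (c : cell_kind) := DCell {
  dcell_A : intercat;
  dcell_B : intercat;
  dcell_C : intercat;
  dcell_D : intercat;
  dcell_top : morphism (hkind c) dcell_A dcell_B;
  dcell_bot : morphism (hkind c) dcell_C dcell_D;
  dcell_left : morphism (vkind c) dcell_A dcell_C;
  dcell_right : morphism (vkind c) dcell_B dcell_D;
  dcell_cell : cell dcell_top dcell_bot dcell_left dcell_right }.

(** The direction of [Φ] and [Ψ]. *)
Definition dcell_hgraph (c : cell_kind) : graph (mor (vkind c)) (dcell c) :=
  Graph (fun x => Mor (dcell_left x)) (fun x => Mor (dcell_right x)).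

(** The direction of [Σ] and [Θ]. *)
Definition dcell_vgraph (c : cell_kind) : graph (mor (hkind c)) (dcell c) :=
  Graph (fun x => Mor (dcell_top x)) (fun x => Mor (dcell_bot x)).

Record cube := Cube {
  cb_A : intercat; cb_B : intercat; cb_C : intercat; cb_D : intercat;
  cb_A' : intercat; cb_B' : intercat; cb_C' : intercat; cb_D' : intercat;
  cb_Φ : morphism LL cb_A cb_B;
  cb_Ψ : morphism LL cb_C cb_D;
  cb_Φ' : morphism LL cb_A' cb_B';
  cb_Ψ' : morphism LL cb_C' cb_D';
  cb_Σ : morphism CC cb_A cb_C;
  cb_Θ : morphism CC cb_B cb_D;
  cb_Σ' : morphism CC cb_A' cb_C';
  cb_Θ' : morphism CC cb_B' cb_D';
  cb_K : morphism CL cb_A cb_A';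
  cb_K' : morphism CL cb_B cb_B';
  cb_L : morphism CL cb_C cb_C';
  cb_L' : morphism CL cb_D cb_D';
  cb_π : @cell LL_CC _ _ _ _ cb_Φ cb_Ψ cb_Σ cb_Θ;
  cb_π' : @cell LL_CC _ _ _ _ cb_Φ' cb_Ψ' cb_Σ' cb_Θ';
  cb_κ : @cell LL_CL _ _ _ _ cb_Φ cb_Φ' cb_K cb_K';
  cb_κb : @cell LL_CL _ _ _ _ cb_Ψ cb_Ψ' cb_L cb_L';
  cb_λ : @cell CL_CC _ _ _ _ cb_K cb_L cb_Σ cb_Σ';
  cb_λb : @cell CL_CC _ _ _ _ cb_K' cb_L' cb_Θ cb_Θ';
  cb_commutes : cube_commutes cb_π cb_π' cb_κ cb_κb cb_λ cb_λb }.

Definition cube_hgraph : graph (dcell CL_CC) cube :=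
  Graph (fun x => DCell (cb_λ x)) (fun x => DCell (cb_λb x)).
Definition cube_tgraph : graph (dcell LL_CC) cube :=
  Graph (fun x => DCell (cb_π x)) (fun x => DCell (cb_π' x)).
Definition cube_vgraph : graph (dcell LL_CL) cube :=
  Graph (fun x => DCell (cb_κ x)) (fun x => DCell (cb_κb x)).

Definition ICat_graph : triple_graph := {|
  s_O := intercat;
  s_T := mor CL;
  s_H := mor LL;
  s_V := mor CC;
  s_HT := dcell LL_CL;
  s_TV := dcell CL_CC;
  s_HV := dcell LL_CC;
  s_HTV := cube;
  g_T := mor_graph CL;
  g_H := mor_graph LL;
  g_V := mor_graph CC;
  g_HT_h := dcell_hgraph LL_CL;
  g_HT_t := dcell_vgraph LL_CL;
  g_TV_t := dcell_hgraph CL_CC;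
  g_TV_v := dcell_vgraph CL_CC;
  g_HV_h := dcell_hgraph LL_CC;
  g_HV_v := dcell_vgraph LL_CC;
  g_HTV_h := cube_hgraph;
  g_HTV_t := cube_tgraph;
  g_HTV_v := cube_vgraph |}.

(** That the operations are those of morphisms and of cells of intercategories.
    Commuting cubes being determined by their faces, nothing is to be specified
    for their compositions. *)

Definition mor_operations (k : kind) (c : category_on (mor_graph k)) : Prop :=
  (forall X : intercat, exists I : morphism k X X,
     is_identity_morphism I /\ idm c X = Mor I) /\
  (forall (X Y Z : intercat) (Ψ : morphism k Y Z) (Φ : morphism k X Y),
     exists Ξ : morphism k X Z,
       is_composite_morphism Ψ Φ Ξ /\ comp c (Mor Ψ) (Mor Φ) = Some (Mor Ξ)).

Definition cell_hoperations (k : cell_kind)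
    (c : category_on (dcell_hgraph k)) : Prop :=
  (forall (A C : intercat) (Σ : morphism (vkind k) A C),
     exists (I : morphism (hkind k) A A) (J : morphism (hkind k) C C)
            (r : cell I J Σ Σ),
       is_identity_trans Σ r /\ idm c (Mor Σ) = DCell r) /\
  (forall (A B C D B' D' : intercat)
      (Φ : morphism (hkind k) A B) (Ψ : morphism (hkind k) C D)
      (Φ' : morphism (hkind k) B B') (Ψ' : morphism (hkind k) D D')
      (Σ : morphism (vkind k) A C) (Θ : morphism (vkind k) B D)
      (Θ' : morphism (vkind k) B' D')
      (π : cell Φ Ψ Σ Θ) (π' : cell Φ' Ψ' Θ Θ'),
     exists (Φ2 : morphism (hkind k) A B') (Ψ2 : morphism (hkind k) C D')
            (r : cell Φ2 Ψ2 Σ Θ'),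
       is_hpasting Φ Ψ' π π' r /\ comp c (DCell π') (DCell π) = Some (DCell r)).

Definition cell_voperations (k : cell_kind)
    (c : category_on (dcell_vgraph k)) : Prop :=
  (forall (A B : intercat) (Φ : morphism (hkind k) A B),
     exists (I : morphism (vkind k) A A) (J : morphism (vkind k) B B)
            (r : cell Φ Φ I J),
       is_identity_trans Φ r /\ idm c (Mor Φ) = DCell r) /\
  (forall (A B C D C' D' : intercat)
      (Φ : morphism (hkind k) A B) (Ψ : morphism (hkind k) C D)
      (Ψ' : morphism (hkind k) C' D')
      (Σ : morphism (vkind k) A C) (Θ : morphism (vkind k) B D)
      (Σ' : morphism (vkind k) C C') (Θ' : morphism (vkind k) D D')
      (π : cell Φ Ψ Σ Θ) (π' : cell Ψ Ψ' Σ' Θ'),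
     exists (Σ2 : morphism (vkind k) A C') (Θ2 : morphism (vkind k) B D')
            (r : cell Φ Ψ' Σ2 Θ2),
       is_vpasting Σ Θ' π π' r /\ comp c (DCell π') (DCell π) = Some (DCell r)).

Record ICat_operations (T : strict_triple_category ICat_graph) : Prop :=
  ICatOperations {
  icat_T : mor_operations (c_T T);
  icat_H : mor_operations (c_H T);
  icat_V : mor_operations (c_V T);
  icat_HT_h : @cell_hoperations LL_CL (c_HT_h T);
  icat_HT_t : @cell_voperations LL_CL (c_HT_t T);
  icat_TV_t : @cell_hoperations CL_CC (c_TV_t T);
  icat_TV_v : @cell_voperations CL_CC (c_TV_v T);
  icat_HV_h : @cell_hoperations LL_CC (c_HV_h T);
  icat_HV_v : @cell_voperations LL_CC (c_HV_v T) }.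

(* Main.v *)
(** Lax (and colax) functors between pseudocategories compose because their
    comparisons are natural, and the compatibilities of a composite morphism of
    intercategories are pasted from those of its factors along the naturality
    of the outer comparisons.  In the same way the conditions on a pasting of
    cells follow from those on the two cells, one naturality square of a cell
    and one of a comparison.  Interchange of four cells is naturality of
    one of them.  A commuting cube is determined by its six faces, so that all the laws
    for cubes reduce to the laws for their faces; only the commutativity of
    pasted cubes has to be checked.

    Composition in a strict category is a partial operation on the type of all
    arrows; it is obtained by choice from its graph, which avoids transporting
    morphisms and cells along equations between intercategories. *)

From mathcomp Require Import ssreflect ssrfun ssrbool.
From Stdlib Require Import FunctionalExtensionality ProofIrrelevance ClassicalEpsilon.
Require Import Defs.

Set Implicit Arguments.
Unset Strict Implicit.
Unset Printing Implicit Defensive.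

(** Two things threaten to swamp the argument: definedness conditions and the number of variants.
    Against the first, composition of partial arrows is associative without hypotheses, an undefined
    composite being [None] in either bracketing; equations are chased by plain rewriting, and
    definedness is checked apart, one adjacent pair at a time. Against the second, the laxity is a
    parameter: [sel], [comp_by] and [nat_square] turn comparisons and their naturality squares
    around, while [compat_eq] and [sq_eq] hold the three shapes of the conditions. Rows and columns
    then share all their lemmas, and all kinds of morphisms and of cells are treated together.
    Equality is as delicate as the algebra. Types of comparisons do not mention the functors, nor
    types of components the boundary morphisms, so that composites agreeing only propositionally can
    be compared as they stand. For cubes, a single statement about triple cells with three pairs of
    faces yields, its directions permuted, the three double categories over the edges. *)

Section PartialTerms.
Variables (A B R : Type).

Lemma isSomeP (x : option A) : reflect (defined x) (isSome x).
Proof. by case: x => [a|]; constructor; [exists a|case]. Qed.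

Lemma peqI (x y : option A) : isSome x -> x = y -> x ≐ y.
Proof. by case: x => // a _ <-; exists a. Qed.

Lemma peqE (x y : option A) : x ≐ y -> x = y.
Proof. by case=> a [-> ->]. Qed.

Lemma peq_def (x y : option A) : x ≐ y -> isSome x.
Proof. by case=> a [-> _]. Qed.

Lemma peq_defr (x y : option A) : x ≐ y -> isSome y.
Proof. by case=> a [_ ->]. Qed.

Lemma peq_sym (x y : option A) : x ≐ y -> y ≐ x.
Proof. by case=> a [-> ->]; exists a. Qed.

Lemma peq_via (z x y : option A) : isSome z -> x = z -> y = z -> x ≐ y.
Proof. by case: z => // a _ -> ->; exists a. Qed.

Lemma def_omap (f : A -> R) x : isSome (omap f x) = isSome x.
Proof. by case: x. Qed.

Lemma def_lift2 (f : A -> B -> option R) x y :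
  isSome (lift2 f x y) -> isSome x /\ isSome y.
Proof. by case: x y => [x|] [y|]. Qed.

End PartialTerms.

(** * Categories, functors and natural transformations in partial terms *)

Definition osrc {C : category} : option (arr C) -> option (ob C) := omap src.
Definition otgt {C : category} : option (arr C) -> option (ob C) := omap tgt.

Section Categories.
Variable C : category.
Implicit Types (f g h : option (arr C)) (x : option (ob C)).

Lemma after_def (g f : arr C) : isSome (after g f) <-> src g = tgt f.
Proof.
rewrite -(comp_defined (cat_str C) g f).
by split=> [/isSomeP|/isSomeP].
Qed.

Lemma src_id1 (x : ob C) : src (id1 x) = x. Proof. exact: dom_idm. Qed.
Lemma tgt_id1 (x : ob C) : tgt (id1 x) = x. Proof. exact: cod_idm. Qed.

Lemma src_after (g f h : arr C) : after g f = Some h -> src h = src f.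
Proof. exact: dom_comp. Qed.
Lemma tgt_after (g f h : arr C) : after g f = Some h -> tgt h = tgt g.
Proof. exact: cod_comp. Qed.

Lemma afterE (g f : arr C) : ↑g ∘ ↑f = after g f. Proof. by []. Qed.

Lemma def_after g f : isSome (g ∘ f) <-> isSome g /\ osrc g = otgt f.
Proof.
case: g f => [g|] [f|] /=; [|by split=> // -[]..].
by rewrite after_def; split=> [->|[_ []]].
Qed.

Lemma osrc_after g f : isSome (g ∘ f) -> osrc (g ∘ f) = osrc f.
Proof.
case: g f => [g|] [f|] //; rewrite afterE.
by case E: (after g f) => [h|] //= _; rewrite (src_after E).
Qed.

Lemma otgt_after g f : isSome (g ∘ f) -> otgt (g ∘ f) = otgt g.
Proof.
case: g f => [g|] [f|] //; rewrite afterE.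
by case E: (after g f) => [h|] //= _; rewrite (tgt_after E).
Qed.

(** Composability concerns adjacent factors only, since the source of [h ∘ g] is that of [g].
    Iterated, this cuts the definedness of a long composite into conditions on pairs. *)
Lemma def_after3 h g f :
  isSome (h ∘ g ∘ f) = isSome (h ∘ g) && isSome (g ∘ f).
Proof.
apply/idP/andP => [|[hg gf]].
- move=> d; have [hg e] := (def_after _ _).1 d.
  have [_ e'] := (def_after _ _).1 hg.
  split=> //; apply/def_after; split; last by rewrite -e osrc_after.
  by case: (g) e' hg => //; case: (h).
- apply/def_after; split=> //; rewrite osrc_after //.
  by have [] := (def_after _ _).1 gf.
Qed.

Lemma oafterA h g f : h ∘ (g ∘ f) = h ∘ g ∘ f.
Proof.
have [/andP[hg gf]|nd] := boolP (isSome (h ∘ g) && isSome (g ∘ f)).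
- case: h g f hg gf => [h|] [g|] [f|] //; rewrite !afterE.
  move=> /after_def hg /after_def gf.
  exact: peqE (comp_assoc (cat_str C) hg gf).
- have: ~~ isSome (h ∘ g ∘ f) by rewrite def_after3.
  have: ~~ isSome (h ∘ (g ∘ f)).
    apply: contra nd => d; have [dh e] := (def_after _ _).1 d.
    have gf: isSome (g ∘ f) by have [] := def_lift2 d.
    rewrite gf andbT; apply/def_after; split=> //.
    by rewrite e otgt_after.
  by case: (h ∘ (g ∘ f)) => //; case: (h ∘ g ∘ f).
Qed.

Lemma oid_left f : oid (otgt f) ∘ f = f.
Proof. by case: f => // f; exact: comp_idl. Qed.

Lemma oid_right f : f ∘ oid (osrc f) = f.
Proof. by case: f => // f; exact: comp_idr. Qed.

Lemma osrc_oid x : osrc (oid x) = x.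
Proof. by case: x => //= x; rewrite src_id1. Qed.
Lemma otgt_oid x : otgt (oid x) = x.
Proof. by case: x => //= x; rewrite tgt_id1. Qed.

Lemma def_oid x : isSome (oid x) = isSome x. Proof. exact: def_omap. Qed.

Lemma oid_left' x f : isSome (oid x ∘ f) -> oid x ∘ f = f.
Proof.
by move=> /def_after[_]; rewrite osrc_oid => ->; exact: oid_left.
Qed.
Lemma oid_idem x : oid x ∘ oid x = oid x.
Proof. by rewrite -{1}[x]otgt_oid oid_left. Qed.

Lemma def_osrc f : isSome (osrc f) = isSome f. Proof. exact: def_omap. Qed.
Lemma def_after_l g f : isSome (g ∘ f) -> isSome g.
Proof. by move=> /def_lift2[]. Qed.
Lemma def_after_r g f : isSome (g ∘ f) -> isSome f.
Proof. by move=> /def_lift2[]. Qed.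

Lemma is_identity_oid (f : arr C) : is_identity f -> ↑f = oid ↑(src f).
Proof. by case=> x ->; rewrite /= src_id1. Qed.

End Categories.

Section Functors.
Variables (C D : category) (F : functor C D).
Implicit Types (f g : option (arr C)) (x : option (ob C)).

Lemma fmap_after g f : isSome (g ∘ f) -> F <a> (g ∘ f) = (F <a> g) ∘ (F <a> f).
Proof.
case: g f => [g|] [f|] //; rewrite !afterE.
by case E: (after g f) => [h|] //= _; rewrite /oafter /= (farr_after F E).
Qed.

Lemma fmap_def g f : isSome (g ∘ f) -> isSome ((F <a> g) ∘ (F <a> f)).
Proof. by move=> d; rewrite -fmap_after // def_omap. Qed.

Lemma osrc_fmap f : osrc (F <a> f) = F <o> osrc f.
Proof. by case: f => //= f; rewrite farr_src. Qed.
Lemma otgt_fmap f : otgt (F <a> f) = F <o> otgt f.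
Proof. by case: f => //= f; rewrite farr_tgt. Qed.

Lemma fmap_oid x : F <a> oid x = oid (F <o> x).
Proof. by case: x => //= x; rewrite farr_id. Qed.

(** Commutation of functors is stated with equality of the records, which calls for function
    extensionality on the two maps and proof irrelevance on the laws. *)
Lemma functor_eq (G : functor C D) :
  (forall a, F a = G a) -> (forall a, farr F a = farr G a) -> F = G.
Proof.
case: F G => [Fo Fa a1 a2 a3 a4] [Go Ga b1 b2 b3 b4] /= eo ea.
have {}eo : Fo = Go by apply: functional_extensionality.
have {}ea : Fa = Ga by apply: functional_extensionality.
subst Go Ga; f_equal; exact: proof_irrelevance.
Qed.

End Functors.

Section FunctorEquations.
Variables (C D E : category).

Lemma fcomp_omap (G : functor D E) (F : functor C D) x :
  (fcomp G F) <o> x = G <o> F <o> x.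
Proof. by case: x. Qed.
Lemma fcomp_amap (G : functor D E) (F : functor C D) f :
  (fcomp G F) <a> f = G <a> F <a> f.
Proof. by case: f. Qed.

Lemma fcompA (K : category) (H : functor E K) (G : functor D E) (F : functor C D) :
  fcomp H (fcomp G F) = fcomp (fcomp H G) F.
Proof. exact: functor_eq. Qed.

Lemma fcomp_idl (F : functor C D) : fcomp (fid D) F = F.
Proof. exact: functor_eq. Qed.
Lemma fcomp_idr (F : functor C D) : fcomp F (fid C) = F.
Proof. exact: functor_eq. Qed.

Lemma fid_omap (x : option (ob C)) : fid C <o> x = x. Proof. by case: x. Qed.
Lemma fid_amap (f : option (arr C)) : fid C <a> f = f. Proof. by case: f. Qed.

End FunctorEquations.

Section NaturalTransformations.
Variables (C D : category) (F G : functor C D) (t : ob C -> arr D).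
Hypothesis nt : natural F G t.

Lemma natE (f : option (arr C)) : isSome f ->
  (G <a> f) ∘ omap t (osrc f) ≐ omap t (otgt f) ∘ (F <a> f).
Proof. by case: f => // f _; exact: (nat_sq nt). Qed.

Lemma osrc_nat x : osrc (omap t x) = F <o> x.
Proof. by case: x => //= x; rewrite (nat_src nt). Qed.
Lemma otgt_nat x : otgt (omap t x) = G <o> x.
Proof. by case: x => //= x; rewrite (nat_tgt nt). Qed.

End NaturalTransformations.

(** * Pseudocategories in partial terms *)

Section PseudocatTheory.
Variables (Y0 Y1 : category) (P : pseudocat Y0 Y1).
Implicit Types (f g : option (arr Y1)) (x y : option (ob Y1)).
Let ax := pseudocat_ax P.

Lemma def_pob x y : isSome (x ⋆[P] y) <->
  isSome x /\ pd1 P <o> x = pd0 P <o> y.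
Proof.
case: x y => [x|] [y|] /=; [|by split=> // -[]..].
split=> [/isSomeP/(pob_defined ax) ->//|[_ [e]]].
by apply/isSomeP/(pob_defined ax).
Qed.

Lemma def_composable (x y : ob Y1) : isSome (↑x ⋆[P] ↑y) <-> composable P x y.
Proof. by rewrite -(pob_defined ax) /=; split=> /isSomeP. Qed.

Lemma def_parr f g : isSome (f ⊛[P] g) <->
  isSome f /\ pd1 P <a> f = pd0 P <a> g.
Proof.
case: f g => [x|] [y|] /=; [|by split=> // -[]..].
split=> [/isSomeP/(parr_defined ax) ->//|[_ [e]]].
by apply/isSomeP/(parr_defined ax).
Qed.

Lemma def_composable_arr (x y : arr Y1) :
  isSome (↑x ⊛[P] ↑y) <-> composable_arr P x y.
Proof. by rewrite -(parr_defined ax) /=; split=> /isSomeP. Qed.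

Lemma osrc_parr f g : isSome (f ⊛[P] g) -> osrc (f ⊛[P] g) = osrc f ⋆[P] osrc g.
Proof.
case: f g => [f|] [g|] //=.
by case E: (parr P f g) => [h|] //= _; rewrite (parr_src ax E).
Qed.
Lemma otgt_parr f g : isSome (f ⊛[P] g) -> otgt (f ⊛[P] g) = otgt f ⋆[P] otgt g.
Proof.
case: f g => [f|] [g|] //=.
by case E: (parr P f g) => [h|] //= _; rewrite (parr_tgt ax E).
Qed.

Lemma def_parr_src f g : isSome (f ⊛[P] g) -> isSome (osrc f ⋆[P] osrc g).
Proof. by move=> d; rewrite -osrc_parr // def_osrc. Qed.
(** This holds also off the composable pairs: identities with equal boundaries lie on objects with
    equal boundaries, so both sides are then [None]. *)
Lemma oid_parr x y : oid x ⊛[P] oid y = oid (x ⋆[P] y).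
Proof.
case: x y => [x|] [y|] //.
have [d|nd] := boolP (isSome (↑x ⋆[P] ↑y)).
  by apply: peqE; apply: (parr_id ax); apply/def_composable.
have: ~~ isSome (oid ↑x ⊛[P] oid ↑y).
  apply: contra nd => /def_parr[_]; rewrite !fmap_oid => e.
  apply/def_pob; split=> //.
  by move/(congr1 osrc): e; rewrite !osrc_oid.
by case: (_ ⊛[P] _) => // _; move: nd; case: (_ ⋆[P] _).
Qed.

Lemma interchange f' f g' g :
  isSome (f' ∘ f) -> isSome (g' ∘ g) ->
  isSome (f ⊛[P] g) -> isSome (f' ⊛[P] g') ->
  (f' ∘ f) ⊛[P] (g' ∘ g) ≐ (f' ⊛[P] g') ∘ (f ⊛[P] g).
Proof.
case: f f' g g' => [f|] [f'|] [g|] [g'|] //.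
rewrite !afterE => /after_def e /after_def e' /def_composable_arr c
  /def_composable_arr c'.
exact: (parr_after ax).
Qed.

End PseudocatTheory.

Section GlobularCells.
Variables (Y0 Y1 : category) (P : pseudocat Y0 Y1).

(** Where [globular] asserts that some identity is the boundary, this names it, as the identity of
    the boundary of the source; the result is an equation to rewrite with. *)
Definition oglobular (f : option (arr Y1)) : Prop :=
  pd0 P <a> f = oid (pd0 P <o> osrc f) /\ pd1 P <a> f = oid (pd1 P <o> osrc f).

Lemma globularE (f : arr Y1) : globular P f <-> oglobular ↑f.
Proof.
split=> [[/is_identity_oid a /is_identity_oid b]|[/= [a] [b]]].
  by split; rewrite /= ?a ?b /= farr_src.
by split; [rewrite a|rewrite b]; eexists.
Qed.

End GlobularCells.

(* A composite is defined iff its consecutive factors are pairwise composable: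
   [saturate] extracts these pairs from the hypotheses, [defd] reassembles
   them. *)
Ltac split_hyps := repeat match goal with
  | X : is_true (_ && _) |- _ => case/andP: X => ? ?
  end.
Ltac saturate := repeat match goal with
  | H : peq ?x ?y |- _ =>
      lazymatch goal with
      | _ : x = y |- _ => fail
      | _ => let D := fresh in let D' := fresh in
             have ? := peqE H; have D := peq_def H; have D' := peq_defr H;
             rewrite ?oafterA ?def_after3 in D; rewrite ?oafterA ?def_after3 in D'
      end
  end; split_hyps.
Ltac defd := rewrite ?oafterA ?def_after3; repeat (apply/andP; split);
  try assumption; try (by apply: fmap_def; assumption).

(** * Diagram chases for composites of lax and colax functors *)

Section CompositionChases.
Variables (Z W : category) (G : functor Z W).

(** The common start of the lax unit and associativity conditions. Here [b], [c] come from the inner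
    functor and [B], [C] from the outer one; naturality of the outer comparison moves [G <a> c] next
    to [G <a> b], so that [G] is applied to one side of the inner condition as a whole. *)
Lemma chase_lax_l (a b c : option (arr Z)) (B B' C C' : option (arr W)) :
  isSome (a ∘ b ∘ c) -> (G <a> c) ∘ B ≐ B' ∘ C' -> isSome (B ∘ C) ->
  isSome (C' ∘ C) ->
  (G <a> a) ∘ ((G <a> b) ∘ B') ∘ (C' ∘ C) = (G <a> (a ∘ b ∘ c)) ∘ B ∘ C.
Proof.
move=> d n BC CC'; have [ab bc] : isSome (a ∘ b) /\ isSome (b ∘ c).
  by move: d; rewrite def_after3 => /andP.
rewrite fmap_after // fmap_after //.
have /= E := congr1 (oafter ((G <a> a) ∘ (G <a> b))) (peqE n).
by rewrite !oafterA in E *; rewrite E.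
Qed.

(** For both unit conditions: [l] is the unit isomorphism of the middle pseudocategory and [L] that
    of the last one. *)
Lemma chase_lax_lam (a b c l : option (arr Z)) (B B' C C' L : option (arr W)) :
  a ∘ b ∘ c ≐ l -> (G <a> l) ∘ B ∘ C ≐ L -> (G <a> c) ∘ B ≐ B' ∘ C' ->
  isSome (C' ∘ C) ->
  (G <a> a) ∘ ((G <a> b) ∘ B') ∘ (C' ∘ C) ≐ L.
Proof.
move=> H1 H2 n CC; saturate.
have E : (G <a> a) ∘ ((G <a> b) ∘ B') ∘ (C' ∘ C) = L.
  by rewrite (chase_lax_l (peq_def H1) n) // (peqE H1) (peqE H2).
by apply: (peqI _ E); rewrite E; defd.
Qed.

(** The roles differ from the lax case: [a] is the unit isomorphism of the middle pseudocategory,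
    [l] the image under the inner functor of that of the first one, and [A] belongs to the last. *)
Lemma chase_colax_lam (a b c l : option (arr Z)) (A B B' C C' : option (arr W)) :
  a ∘ c ∘ b ≐ l -> A ∘ C ∘ B ≐ G <a> a -> C' ∘ B' ≐ B ∘ (G <a> c) ->
  A ∘ (C ∘ C') ∘ (B' ∘ (G <a> b)) ≐ G <a> l.
Proof.
move=> H1 H2 n; saturate.
apply: (@peq_via _ ((G <a> a) ∘ (G <a> c) ∘ (G <a> b))); first by defd.
- rewrite -(peqE H2) !oafterA -(oafterA _ C' B') (peqE n).
  by rewrite !oafterA.
- by rewrite -(peqE H1) !fmap_after //; defd.
Qed.

(** Two naturality squares enter, because each side of the associativity condition has a comparison
    composed with an identity, on the right in [c] and on the left in [e]. *)
Lemma chase_lax_kappa (a b c d e k : option (arr Z))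
    (B B' C C' D D' E E' K : option (arr W)) :
  a ∘ b ∘ c ≐ d ∘ e ∘ k -> (G <a> k) ∘ B ∘ C ≐ D ∘ E ∘ K ->
  (G <a> c) ∘ B ≐ B' ∘ C' -> (G <a> e) ∘ D ≐ D' ∘ E' ->
  isSome (C' ∘ C) -> isSome (E' ∘ E) ->
  (G <a> a) ∘ ((G <a> b) ∘ B') ∘ (C' ∘ C)
  ≐ ((G <a> d) ∘ D') ∘ (E' ∘ E) ∘ K.
Proof.
move=> H1 H2 n m CC EE; saturate.
apply: (@peq_via _ ((G <a> d) ∘ (G <a> e) ∘ D ∘ E ∘ K)); first by defd.
- rewrite (chase_lax_l (peq_def H1) n) // (peqE H1) fmap_after; last by defd.
  rewrite fmap_after // -!oafterA; congr (_ ∘ (_ ∘ _)).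
  by rewrite !oafterA; exact: peqE.
- by rewrite !oafterA -(oafterA _ _ E') -(peqE m) !oafterA.
Qed.

Lemma chase_colax_kappa (a b c d e k : option (arr Z))
    (A B B' C C' D D' E E' : option (arr W)) :
  a ∘ c ∘ b ≐ e ∘ d ∘ k -> A ∘ C ∘ B ≐ E ∘ D ∘ (G <a> a) ->
  C' ∘ B' ≐ B ∘ (G <a> c) -> E' ∘ D' ≐ D ∘ (G <a> e) ->
  A ∘ (C ∘ C') ∘ (B' ∘ (G <a> b))
  ≐ (E ∘ E') ∘ (D' ∘ (G <a> d)) ∘ (G <a> k).
Proof.
move=> H1 H2 n m; saturate.
apply: (@peq_via _ (E ∘ D ∘ (G <a> (a ∘ c ∘ b)))); first last.
- rewrite (peqE H1) !fmap_after; try by defd.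
  by rewrite !oafterA -(oafterA _ E' D') (peqE m) !oafterA.
- rewrite !fmap_after; try by defd.
  rewrite !oafterA -(peqE H2) -(oafterA _ C' B') (peqE n).
  by rewrite !oafterA.
- by rewrite !fmap_after; defd.
Qed.

End CompositionChases.

Lemma functor_sq (C D D' E : category) (F : functor C D) (G : functor D E)
    (F' : functor C D') (G' : functor D' E) :
  fcomp G F = fcomp G' F' ->
  (forall x, G <o> F <o> x = G' <o> F' <o> x) /\
  (forall f, G <a> F <a> f = G' <a> F' <a> f).
Proof.
by move=> e; split=> x; [rewrite -!fcomp_omap e|rewrite -!fcomp_amap e].
Qed.

(** * Lax and colax functors in partial terms *)

Section PMapTheory.
Variables (Y0 Y1 Z0 Z1 : category).
Variables (P : pseudocat Y0 Y1) (Q : pseudocat Z0 Z1).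
Variable F : pmap Y0 Y1 Z0 Z1.
Local Notation F0 := (pmap0 F).
Local Notation F1 := (pmap1 F).
Implicit Types (f g : option (arr Y1)) (x y z : option (ob Y1)).

Section Structure.
Hypothesis ax : pmap_axioms P Q F.

Lemma pd0_map x : pd0 Q <o> F1 <o> x = F0 <o> pd0 P <o> x.
Proof. by have [-> _] := functor_sq (pmap_d0 ax). Qed.
Lemma pd1_map x : pd1 Q <o> F1 <o> x = F0 <o> pd1 P <o> x.
Proof. by have [-> _] := functor_sq (pmap_d1 ax). Qed.
Lemma pd0_map_arr f : pd0 Q <a> F1 <a> f = F0 <a> pd0 P <a> f.
Proof. by have [_ ->] := functor_sq (pmap_d0 ax). Qed.
Lemma pd1_map_arr f : pd1 Q <a> F1 <a> f = F0 <a> pd1 P <a> f.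
Proof. by have [_ ->] := functor_sq (pmap_d1 ax). Qed.

Lemma def_map_pob x y :
  isSome (x ⋆[P] y) -> isSome ((F1 <o> x) ⋆[Q] (F1 <o> y)).
Proof.
move=> /def_pob[d e]; apply/def_pob.
by rewrite def_omap pd0_map pd1_map e.
Qed.

Lemma def_map_parr f g :
  isSome (f ⊛[P] g) -> isSome ((F1 <a> f) ⊛[Q] (F1 <a> g)).
Proof.
move=> /def_parr[d e]; apply/def_parr.
by rewrite def_omap pd0_map_arr pd1_map_arr e.
Qed.

Lemma def_ocmul x y : isSome (ocmul F x y) <-> isSome (x ⋆[P] y).
Proof.
case: x y => [x|] [y|] //=; rewrite def_composable -(cmul_defined ax) /ocmul.
by split=> /isSomeP.
Qed.

Lemma ocmul_glob x y : isSome (x ⋆[P] y) -> oglobular Q (ocmul F x y).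
Proof.
move=> /def_ocmul; case: x y => [x|] [y|] //; rewrite /ocmul /=.
by case E: (cmul F x y) => [c|] // _; apply/globularE/(cmul_globular ax E).
Qed.

Lemma ocunit_glob a : oglobular Q (ocunit F ↑a).
Proof. exact/globularE/(cunit_globular ax). Qed.

End Structure.

Section Lax.
Hypothesis F_lax : lax P Q F.
Let ax := lax_pmap F_lax.

Lemma lax_osrc x y : isSome (x ⋆[P] y) ->
  osrc (ocmul F x y) = (F1 <o> x) ⋆[Q] (F1 <o> y).
Proof.
move=> /(def_ocmul ax); case: x y => [x|] [y|] //; rewrite /ocmul /=.
by case E: (cmul F x y) => [c|] //= _; rewrite -(lax_mul_src F_lax E).
Qed.

Lemma lax_otgt x y : isSome (x ⋆[P] y) ->
  otgt (ocmul F x y) = F1 <o> (x ⋆[P] y).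
Proof.
move=> /(def_ocmul ax); case: x y => [x|] [y|] //; rewrite /ocmul /=.
by case E: (cmul F x y) => [c|] //= _; rewrite -(lax_mul_tgt F_lax E).
Qed.

Lemma lax_natE f g : isSome (f ⊛[P] g) ->
  (F1 <a> (f ⊛[P] g)) ∘ ocmul F (osrc f) (osrc g)
  ≐ ocmul F (otgt f) (otgt g) ∘ ((F1 <a> f) ⊛[Q] (F1 <a> g)).
Proof.
case: f g => [f|] [g|] // /def_composable_arr c.
exact: (lax_mul_natural F_lax).
Qed.

Lemma lax_unit_osrc a : osrc (ocunit F a) = punit Q <o> F0 <o> a.
Proof. by rewrite (osrc_nat (lax_unit_natural F_lax)) fcomp_omap. Qed.
Lemma lax_unit_otgt a : otgt (ocunit F a) = F1 <o> punit P <o> a.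
Proof. by rewrite (otgt_nat (lax_unit_natural F_lax)) fcomp_omap. Qed.
Lemma lax_unit_natE (u : option (arr Y0)) : isSome u ->
  (F1 <a> punit P <a> u) ∘ ocunit F (osrc u)
  ≐ ocunit F (otgt u) ∘ (punit Q <a> F0 <a> u).
Proof.
by move=> d; have := natE (lax_unit_natural F_lax) d; rewrite !fcomp_amap.
Qed.

End Lax.

Section Colax.
Hypothesis F_colax : colax P Q F.
Let ax := colax_pmap F_colax.

Lemma colax_otgt x y : isSome (x ⋆[P] y) ->
  otgt (ocmul F x y) = (F1 <o> x) ⋆[Q] (F1 <o> y).
Proof.
move=> /(def_ocmul ax); case: x y => [x|] [y|] //; rewrite /ocmul /=.
by case E: (cmul F x y) => [c|] //= _; rewrite -(colax_mul_tgt F_colax E).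
Qed.

Lemma colax_osrc x y : isSome (x ⋆[P] y) ->
  osrc (ocmul F x y) = F1 <o> (x ⋆[P] y).
Proof.
move=> /(def_ocmul ax); case: x y => [x|] [y|] //; rewrite /ocmul /=.
by case E: (cmul F x y) => [c|] //= _; rewrite -(colax_mul_src F_colax E).
Qed.

Lemma colax_natE f g : isSome (f ⊛[P] g) ->
  ((F1 <a> f) ⊛[Q] (F1 <a> g)) ∘ ocmul F (osrc f) (osrc g)
  ≐ ocmul F (otgt f) (otgt g) ∘ (F1 <a> (f ⊛[P] g)).
Proof.
case: f g => [f|] [g|] // /def_composable_arr c.
exact: (colax_mul_natural F_colax).
Qed.

Lemma colax_unit_otgt a : otgt (ocunit F a) = punit Q <o> F0 <o> a.
Proof. by rewrite (otgt_nat (colax_unit_natural F_colax)) fcomp_omap. Qed.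
Lemma colax_unit_osrc a : osrc (ocunit F a) = F1 <o> punit P <o> a.
Proof. by rewrite (osrc_nat (colax_unit_natural F_colax)) fcomp_omap. Qed.
Lemma colax_unit_natE (u : option (arr Y0)) : isSome u ->
  (punit Q <a> F0 <a> u) ∘ ocunit F (osrc u)
  ≐ ocunit F (otgt u) ∘ (F1 <a> punit P <a> u).
Proof.
by move=> d; have := natE (colax_unit_natural F_colax) d; rewrite !fcomp_amap.
Qed.

End Colax.

Lemma has_laxity_pmap l : has_laxity l P Q F -> pmap_axioms P Q F.
Proof. by case: l => -[]. Qed.

End PMapTheory.

(** In use [g] is the image of the inner comparison under the outer functor and [f] is the outer
    comparison: a lax composite ends with [g], a colax one begins with it. *)
Definition comp_by (l : laxity) {C : category} (g f : option (arr C)) :=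
  match l with IsLax => g ∘ f | IsColax => f ∘ g end.

Section NaturalityChases.
Variables (Z W : category) (G : functor Z W).

(** The image of the first square under [G] is pasted to the second. The same chase and its colax
    companion serve comparisons of composite functors and components of pasted cells. *)
Lemma chase_lax_nat (a a' b b' : option (arr Z)) (a'' c c' : option (arr W)) :
  a ∘ b ≐ b' ∘ a' -> (G <a> a') ∘ c ≐ c' ∘ a'' -> isSome ((G <a> b) ∘ c) ->
  (G <a> a) ∘ ((G <a> b) ∘ c) ≐ ((G <a> b') ∘ c') ∘ a''.
Proof.
move=> H1 H2 d; saturate.
have e : (G <a> a) ∘ (G <a> b) = (G <a> b') ∘ (G <a> a').
  by rewrite -!fmap_after // (peqE H1).
apply: (@peq_via _ ((G <a> a) ∘ (G <a> b) ∘ c)); first by defd.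
- exact: oafterA.
- by rewrite e -!oafterA (peqE H2).
Qed.

Lemma chase_colax_nat (a a' b b' : option (arr Z)) (a'' c c' : option (arr W)) :
  a' ∘ b ≐ b' ∘ a -> a'' ∘ c ≐ c' ∘ (G <a> a') -> isSome (c ∘ (G <a> b)) ->
  a'' ∘ (c ∘ (G <a> b)) ≐ (c' ∘ (G <a> b')) ∘ (G <a> a).
Proof.
move=> H1 H2 d; saturate.
have e : (G <a> a') ∘ (G <a> b) = (G <a> b') ∘ (G <a> a).
  by rewrite -!fmap_after // (peqE H1).
apply: (@peq_via _ (a'' ∘ c ∘ (G <a> b))); first by defd.
- exact: oafterA.
- by rewrite -oafterA -e oafterA (peqE H2).
Qed.

End NaturalityChases.

Section NaturalI.
Variables (C D : category) (F G : functor C D) (t : ob C -> arr D).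

Lemma naturalI :
  (forall c, osrc ↑(t c) = F <o> ↑c) -> (forall c, otgt ↑(t c) = G <o> ↑c) ->
  (forall f : arr C,
     (G <a> ↑f) ∘ omap t (osrc ↑f) ≐ omap t (otgt ↑f) ∘ (F <a> ↑f)) ->
  natural F G t.
Proof.
move=> s d n; split=> [c|c|f]; last exact: n.
- exact: Some_inj (s c).
- exact: Some_inj (d c).
Qed.

End NaturalI.

Section GlobularComposites.
Variables (Y0 Y1 : category) (P : pseudocat Y0 Y1).

Lemma oglobular_after (g f : option (arr Y1)) : isSome (g ∘ f) ->
  oglobular P g -> oglobular P f -> oglobular P (g ∘ f).
Proof.
move=> d [g0 g1] [f0 f1]; rewrite /oglobular osrc_after //.
have d0 := fmap_def (pd0 P) d; have d1 := fmap_def (pd1 P) d.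
rewrite !fmap_after // g0 g1 in d0 d1 *.
by rewrite (oid_left' d0) (oid_left' d1).
Qed.

Lemma oglobular_fmap (Z0 Z1 : category) (Q : pseudocat Z0 Z1)
    (F : pmap Y0 Y1 Z0 Z1) (f : option (arr Y1)) :
  pmap_axioms P Q F -> oglobular P f -> oglobular Q (pmap1 F <a> f).
Proof.
move=> ax [f0 f1]; rewrite /oglobular osrc_fmap.
rewrite (pd0_map_arr ax) (pd1_map_arr ax) f0 f1 !fmap_oid.
by rewrite (pd0_map ax) (pd1_map ax).
Qed.

End GlobularComposites.

(** * Composites of lax and of colax functors *)

Section Composites.
Variables (Y0 Y1 Z0 Z1 W0 W1 : category).
Variables (P : pseudocat Y0 Y1) (Q : pseudocat Z0 Z1) (R : pseudocat W0 W1).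

(** [cunit] is total whereas composition is partial, hence the default value; [def_comp_unit] shows
    that it is never taken when both functors have laxity [l]. *)
Definition comp_cmp l (G : pmap Z0 Z1 W0 W1) (F : pmap Y0 Y1 Z0 Z1) :
    comparison Y0 Y1 W1 := Comparison
  (fun a => odflt (cunit G (pmap0 F a))
     (comp_by l (pmap1 G <a> ocunit F ↑a) (ocunit G ↑(pmap0 F a))))
  (fun x y => comp_by l (pmap1 G <a> ocmul F ↑x ↑y)
     (ocmul G ↑(pmap1 F x) ↑(pmap1 F y))).

Definition pcomp l (G : pmap Z0 Z1 W0 W1) (F : pmap Y0 Y1 Z0 Z1) :=
  PMap (fcomp (pmap0 G) (pmap0 F)) (fcomp (pmap1 G) (pmap1 F)) (comp_cmp l G F).

Variables (G : pmap Z0 Z1 W0 W1) (F : pmap Y0 Y1 Z0 Z1).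
Local Notation F1 := (pmap1 F).
Local Notation G1 := (pmap1 G).

Lemma ocmul_pcomp l x y : ocmul (pcomp l G F) x y =
  comp_by l (G1 <a> ocmul F x y) (ocmul G (F1 <o> x) (F1 <o> y)).
Proof.
by case: x y => [x|] [y|] //; case: l.
Qed.

Section Laxity.
Variable l : laxity.
Hypotheses (hF : has_laxity l P Q F) (hG : has_laxity l Q R G).
Let axF := has_laxity_pmap hF.
Let axG := has_laxity_pmap hG.

Lemma def_comp_mul x y : isSome (x ⋆[P] y) ->
  isSome (comp_by l (G1 <a> ocmul F x y) (ocmul G (F1 <o> x) (F1 <o> y))).
Proof.
move=> d; have d' := def_map_pob axF d.
have dF : isSome (ocmul F x y) by apply/(def_ocmul axF).
have dG : isSome (ocmul G (F1 <o> x) (F1 <o> y)) by apply/(def_ocmul axG).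
case: l hF hG => hF' hG'; apply/def_after; split; rewrite ?def_omap //.
- by rewrite osrc_fmap (lax_osrc hF') // (lax_otgt hG').
- by rewrite otgt_fmap (colax_osrc hG') // (colax_otgt hF').
Qed.

Lemma def_comp_unit a : isSome a ->
  isSome (comp_by l (G1 <a> ocunit F a) (ocunit G (pmap0 F <o> a))).
Proof.
move=> d; case: l hF hG => hF' hG'; apply/def_after.
- by rewrite osrc_fmap (lax_unit_osrc hF') // (lax_unit_otgt hG') !def_omap.
- by rewrite otgt_fmap (colax_unit_osrc hG') // (colax_unit_otgt hF') !def_omap.
Qed.

Lemma ocunit_pcomp a : ocunit (pcomp l G F) a =
  comp_by l (G1 <a> ocunit F a) (ocunit G (pmap0 F <o> a)).
Proof.
case: a => [a|]; last by case: l.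
rewrite {1}/ocunit /=.
by have := @def_comp_unit ↑a isT; case: (comp_by l _ _).
Qed.

Lemma pcomp_axioms : pmap_axioms P R (pcomp l G F).
Proof.
have defm x y : isSome (ocmul (pcomp l G F) x y) <-> isSome (x ⋆[P] y).
  split=> [|d]; last by rewrite ocmul_pcomp; exact: def_comp_mul.
  rewrite ocmul_pcomp => d; apply/(def_ocmul axF).
  have : isSome (G1 <a> ocmul F x y).
    by move: d; case: (l) => /def_lift2[].
  by rewrite def_omap.
split.
- by rewrite -fcompA (pmap_d0 axF) fcompA (pmap_d0 axG) -fcompA.
- by rewrite -fcompA (pmap_d1 axF) fcompA (pmap_d1 axG) -fcompA.
- move=> a; apply/globularE.
  have -> : Some (cunit (pcomp l G F) a) = ocunit (pcomp l G F) ↑a by [].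
  have := def_comp_unit (a := ↑a) isT; rewrite ocunit_pcomp.
  have gF := oglobular_fmap axG (ocunit_glob axF a).
  have gG := ocunit_glob axG (pmap0 F a).
  by case: (l) => d; exact: oglobular_after.
- move=> x y; rewrite -def_composable -defm.
  by rewrite /ocmul /=; split=> /isSomeP.
- move=> x y c e; apply/globularE.
  have e' : Some c = ocmul (pcomp l G F) ↑x ↑y by rewrite -e.
  have d : isSome (↑x ⋆[P] ↑y) by rewrite -defm -e'.
  rewrite e'; have := def_comp_mul d; rewrite ocmul_pcomp.
  have gF := oglobular_fmap axG (ocmul_glob axF d).
  have gG := ocmul_glob axG (def_map_pob axF d).
  by case: (l) => d'; exact: oglobular_after.
Qed.

End Laxity.

Lemma lax_pcomp : lax P Q F -> lax Q R G -> lax P R (pcomp IsLax G F).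
Proof.
move=> hF hG; have axF := lax_pmap hF; have axG := lax_pmap hG.
have ax : pmap_axioms P R (pcomp IsLax G F) := @pcomp_axioms IsLax hF hG.
have u_def := @def_comp_unit IsLax hF hG.
have m_def := @def_comp_mul IsLax hF hG.
have uE := @ocunit_pcomp IsLax hF hG.
have mE := @ocmul_pcomp IsLax.
have uS c : Some (cunit (pcomp IsLax G F) c) = ocunit (pcomp IsLax G F) ↑c.
  by [].
(* This and the next equation match the units in the condition for [G] at [F1 x] with those in the
   image of the condition for [F]. *)
have pd0F (x : ob Y1) : pd0 Q (F1 x) = pmap0 F (pd0 P x).
  by apply: Some_inj; exact: (pd0_map axF ↑x).
have pd1F (x : ob Y1) : pd1 Q (F1 x) = pmap0 F (pd1 P x).
  by apply: Some_inj; exact: (pd1_map axF ↑x).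
split=> //.
- apply: naturalI => [a|a|f].
  + rewrite uS uE (osrc_after (u_def _ _)) //.
    by rewrite (lax_unit_osrc hG).
  + rewrite uS uE (otgt_after (u_def _ _)) //.
    by rewrite otgt_fmap (lax_unit_otgt hF).
  + rewrite -/(ocunit (pcomp IsLax G F)) !uE !fcomp_amap.
    apply: chase_lax_nat (u_def _ _) => //.
      exact: (lax_unit_natE hF (u := ↑f)).
    have := lax_unit_natE hG (u := pmap0 F <a> ↑f) isT.
    by rewrite osrc_fmap otgt_fmap.
- move=> x y c e.
  have e' : Some c = ocmul (pcomp IsLax G F) ↑x ↑y by rewrite -e.
  have d : isSome (↑x ⋆[P] ↑y) by apply/(def_ocmul ax); rewrite -e'.
  rewrite -[Some (src c)]/(osrc ↑c) e' mE (osrc_after (m_def _ _ d)) //.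
  by rewrite (lax_osrc hG) //; exact: (def_map_pob axF d).
- move=> x y c e.
  have e' : Some c = ocmul (pcomp IsLax G F) ↑x ↑y by rewrite -e.
  have d : isSome (↑x ⋆[P] ↑y) by apply/(def_ocmul ax); rewrite -e'.
  rewrite -[Some (tgt c)]/(otgt ↑c) e' mE (otgt_after (m_def _ _ d)) //.
  by rewrite otgt_fmap (lax_otgt hF) // fcomp_omap.
- move=> f g /def_composable_arr d; rewrite fcomp_amap !mE.
  have d' := def_map_parr axF d.
  apply: chase_lax_nat; first exact: (lax_natE hF d).
    by have := lax_natE hG d'; rewrite !osrc_fmap !otgt_fmap.
  by apply: m_def; exact: (def_parr_src d).
- move=> x; rewrite fcomp_amap uE mE /comp_by.
  have HF := lax_lam hF x; have HG := lax_lam hG (F1 x).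
  rewrite pd0F in HG.
  have dF := def_after_r (peq_def HF); have dG := def_after_r (peq_def HG).
  (* Naturality of the outer comparison at the pair formed by the inner unit comparison and an
     identity. *)
  have N := lax_natE hG dF.
  rewrite (lax_unit_osrc hF) (lax_unit_otgt hF) osrc_oid otgt_oid fmap_oid in N.
  have dF' := def_map_parr axG dF; rewrite fmap_oid in dF'.
  (* The identity is written as its own composite, so that interchange can separate the two factors
     of the composite unit comparison. *)
  have dI : isSome (oid ↑(G1 (F1 x)) ∘ oid ↑(G1 (F1 x))) by rewrite oid_idem.
  have I := interchange (u_def ↑(pd0 P x) isT) dI dG dF'; rewrite oid_idem in I.
  rewrite (peqE I).
  apply: chase_lax_lam HF HG N _; exact: peq_defr I.
- move=> x; rewrite fcomp_amap uE mE /comp_by.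
  have HF := lax_rho hF x; have HG := lax_rho hG (F1 x).
  rewrite pd1F in HG.
  have dF := def_after_r (peq_def HF); have dG := def_after_r (peq_def HG).
  have N := lax_natE hG dF.
  rewrite (lax_unit_osrc hF) (lax_unit_otgt hF) osrc_oid otgt_oid fmap_oid in N.
  have dF' := def_map_parr axG dF; rewrite fmap_oid in dF'.
  have dI : isSome (oid ↑(G1 (F1 x)) ∘ oid ↑(G1 (F1 x))) by rewrite oid_idem.
  have I := interchange dI (u_def ↑(pd1 P x) isT) dG dF'; rewrite oid_idem in I.
  rewrite (peqE I).
  apply: chase_lax_lam HF HG N _; exact: peq_defr I.
- move=> x y z cxy cyz; rewrite fcomp_amap !mE /comp_by.
  have HF := lax_kappa hF cxy cyz.
  have xy : isSome (↑x ⋆[P] ↑y) by apply/def_composable.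
  have yz : isSome (↑y ⋆[P] ↑z) by apply/def_composable.
  have fxy := def_map_pob axF xy; have fyz := def_map_pob axF yz.
  have HG : _ := lax_kappa hG ((def_composable Q _ _).1 fxy)
                       ((def_composable Q _ _).1 fyz).
  have dF := def_after_r (peq_def HF); have dG := def_after_r (peq_def HG).
  have N := lax_natE hG dF.
  rewrite (lax_osrc hF) // (lax_otgt hF) // osrc_oid otgt_oid fmap_oid in N.
  have dF' := def_map_parr axG dF; rewrite fmap_oid in dF'.
  have dI : isSome (oid ↑(G1 (F1 x)) ∘ oid ↑(G1 (F1 x))) by rewrite oid_idem.
  have I := interchange dI (m_def _ _ yz) dG dF'; rewrite oid_idem in I.
  rewrite (peqE I).
  (* The other side of the condition pairs the comparison at [x], [y] with the identity of [z],
     which requires an interchange and a naturality square of its own. *)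
  have dF2 := def_after_r (def_after_l (peq_defr HF)).
  have dG2 := def_after_r (def_after_l (peq_defr HG)).
  have N2 := lax_natE hG dF2.
  rewrite (lax_osrc hF) // (lax_otgt hF) // osrc_oid otgt_oid fmap_oid in N2.
  have dF2' := def_map_parr axG dF2; rewrite fmap_oid in dF2'.
  have dI2 : isSome (oid ↑(G1 (F1 z)) ∘ oid ↑(G1 (F1 z))) by rewrite oid_idem.
  have I2 := interchange (m_def _ _ xy) dI2 dG2 dF2'; rewrite oid_idem in I2.
  rewrite (peqE I2).
  apply: chase_lax_kappa HF HG N N2 _ _; [exact: peq_defr I|exact: peq_defr I2].
Qed.


(** A colax composite comparison begins with the image of that of [F], so interchange is applied
    with this image as inner pair, in the opposite order to the lax case. *)
Lemma colax_pcomp : colax P Q F -> colax Q R G -> colax P R (pcomp IsColax G F).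
Proof.
move=> hF hG; have axF := colax_pmap hF; have axG := colax_pmap hG.
have ax : pmap_axioms P R (pcomp IsColax G F) := @pcomp_axioms IsColax hF hG.
have u_def := @def_comp_unit IsColax hF hG.
have m_def := @def_comp_mul IsColax hF hG.
have uE := @ocunit_pcomp IsColax hF hG.
have mE := @ocmul_pcomp IsColax.
have uS c : Some (cunit (pcomp IsColax G F) c) = ocunit (pcomp IsColax G F) ↑c.
  by [].
have pd0F (x : ob Y1) : pd0 Q (F1 x) = pmap0 F (pd0 P x).
  by apply: Some_inj; exact: (pd0_map axF ↑x).
have pd1F (x : ob Y1) : pd1 Q (F1 x) = pmap0 F (pd1 P x).
  by apply: Some_inj; exact: (pd1_map axF ↑x).
split=> //.
- apply: naturalI => [a|a|f].
  + rewrite uS uE (osrc_after (u_def _ _)) //.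
    by rewrite osrc_fmap (colax_unit_osrc hF).
  + rewrite uS uE (otgt_after (u_def _ _)) //.
    by rewrite (colax_unit_otgt hG).
  + rewrite -/(ocunit (pcomp IsColax G F)) !uE !fcomp_amap.
    apply: chase_colax_nat (u_def _ _) => //.
      exact: (colax_unit_natE hF (u := ↑f)).
    have := colax_unit_natE hG (u := pmap0 F <a> ↑f) isT.
    by rewrite osrc_fmap otgt_fmap.
- move=> x y c e.
  have e' : Some c = ocmul (pcomp IsColax G F) ↑x ↑y by rewrite -e.
  have d : isSome (↑x ⋆[P] ↑y) by apply/(def_ocmul ax); rewrite -e'.
  rewrite -[Some (src c)]/(osrc ↑c) e' mE (osrc_after (m_def _ _ d)) //.
  by rewrite osrc_fmap (colax_osrc hF) // fcomp_omap.
- move=> x y c e.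
  have e' : Some c = ocmul (pcomp IsColax G F) ↑x ↑y by rewrite -e.
  have d : isSome (↑x ⋆[P] ↑y) by apply/(def_ocmul ax); rewrite -e'.
  rewrite -[Some (tgt c)]/(otgt ↑c) e' mE (otgt_after (m_def _ _ d)) //.
  by rewrite (colax_otgt hG) //; exact: (def_map_pob axF d).
- move=> f g /def_composable_arr d; rewrite fcomp_amap !mE.
  have d' := def_map_parr axF d.
  apply: chase_colax_nat; first exact: (colax_natE hF d).
    by have := colax_natE hG d'; rewrite !osrc_fmap !otgt_fmap.
  by apply: m_def; exact: (def_parr_src d).
- move=> x; rewrite fcomp_amap uE mE /comp_by.
  have HF := colax_lam hF x; have HG := colax_lam hG (F1 x).
  rewrite pd0F in HG.
  have dF := def_after_r (def_after_l (peq_def HF)).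
  have dG := def_after_r (def_after_l (peq_def HG)).
  have N := colax_natE hG dF.
  rewrite (colax_unit_osrc hF) (colax_unit_otgt hF) osrc_oid otgt_oid in N.
  have dF' := def_map_parr axG dF; rewrite fmap_oid in dF' N.
  have dI : isSome (oid ↑(G1 (F1 x)) ∘ oid ↑(G1 (F1 x))) by rewrite oid_idem.
  have I := interchange (u_def ↑(pd0 P x) isT) dI dF' dG; rewrite oid_idem in I.
  rewrite (peqE I).
  exact: chase_colax_lam HF HG N.
- move=> x; rewrite fcomp_amap uE mE /comp_by.
  have HF := colax_rho hF x; have HG := colax_rho hG (F1 x).
  rewrite pd1F in HG.
  have dF := def_after_r (def_after_l (peq_def HF)).
  have dG := def_after_r (def_after_l (peq_def HG)).
  have N := colax_natE hG dF.
  rewrite (colax_unit_osrc hF) (colax_unit_otgt hF) osrc_oid otgt_oid in N.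
  have dF' := def_map_parr axG dF; rewrite fmap_oid in dF' N.
  have dI : isSome (oid ↑(G1 (F1 x)) ∘ oid ↑(G1 (F1 x))) by rewrite oid_idem.
  have I := interchange dI (u_def ↑(pd1 P x) isT) dF' dG; rewrite oid_idem in I.
  rewrite (peqE I).
  exact: chase_colax_lam HF HG N.
- move=> x y z cxy cyz; rewrite fcomp_amap !mE /comp_by.
  have HF := colax_kappa hF cxy cyz.
  have xy : isSome (↑x ⋆[P] ↑y) by apply/def_composable.
  have yz : isSome (↑y ⋆[P] ↑z) by apply/def_composable.
  have fxy := def_map_pob axF xy; have fyz := def_map_pob axF yz.
  have HG : _ := colax_kappa hG ((def_composable Q _ _).1 fxy)
                         ((def_composable Q _ _).1 fyz).
  have dF := def_after_r (def_after_l (peq_def HF)).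
  have dG := def_after_r (def_after_l (peq_def HG)).
  have N := colax_natE hG dF.
  rewrite (colax_osrc hF) // (colax_otgt hF) // osrc_oid otgt_oid in N.
  have dF' := def_map_parr axG dF; rewrite fmap_oid in dF' N.
  have dI : isSome (oid ↑(G1 (F1 x)) ∘ oid ↑(G1 (F1 x))) by rewrite oid_idem.
  have I := interchange dI (m_def _ _ yz) dF' dG; rewrite oid_idem in I.
  rewrite (peqE I).
  have dF2 := def_after_l (def_after_l (peq_defr HF)).
  have dG2 := def_after_l (def_after_l (peq_defr HG)).
  have N2 := colax_natE hG dF2.
  rewrite (colax_osrc hF) // (colax_otgt hF) // osrc_oid otgt_oid in N2.
  have dF2' := def_map_parr axG dF2; rewrite fmap_oid in dF2' N2.
  have dI2 : isSome (oid ↑(G1 (F1 z)) ∘ oid ↑(G1 (F1 z))) by rewrite oid_idem.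
  have I2 := interchange (m_def _ _ xy) dI2 dF2' dG2; rewrite oid_idem in I2.
  rewrite (peqE I2).
  exact: chase_colax_kappa HF HG N N2.
Qed.

End Composites.

Lemma pcomp_laxity l (Y0 Y1 Z0 Z1 W0 W1 : category)
    (P : pseudocat Y0 Y1) (Q : pseudocat Z0 Z1) (R : pseudocat W0 W1)
    (G : pmap Z0 Z1 W0 W1) (F : pmap Y0 Y1 Z0 Z1) :
  has_laxity l P Q F -> has_laxity l Q R G -> has_laxity l P R (pcomp l G F).
Proof. by case: l; [exact: lax_pcomp|exact: colax_pcomp]. Qed.

(** * Tools uniform in the laxity *)

Lemma comp_by_def l (C : category) (g f : option (arr C)) :
  isSome (comp_by l g f) -> isSome g /\ isSome f.
Proof. by case: l => /= d; split; move: (def_after_l d) (def_after_r d). Qed.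

Lemma comp_by_fmap l (C D : category) (F : functor C D) (g f : option (arr C)) :
  isSome (comp_by l g f) ->
  F <a> comp_by l g f = comp_by l (F <a> g) (F <a> f).
Proof. by case: l; exact: fmap_after. Qed.

Lemma comp_by_parr l (Y0 Y1 : category) (P : pseudocat Y0 Y1)
    (g f g' f' : option (arr Y1)) :
  isSome (comp_by l g f) -> isSome (comp_by l g' f') ->
  isSome (g ⊛[P] g') -> isSome (f ⊛[P] f') ->
  comp_by l g f ⊛[P] comp_by l g' f' ≐ comp_by l (g ⊛[P] g') (f ⊛[P] f').
Proof. by case: l => a b c d; exact: interchange. Qed.

(** Changing the laxity exchanges source and target of a comparison; [sel] records this, so that a
    single statement covers both cases. *)
Definition sel {T : Type} (l : laxity) (x y : T) : T :=
  match l with IsLax => x | IsColax => y end.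

Section NaturalitySquares.
Variables (C D : category) (G : functor C D).

(** For a comparison, [f] is a composite or unit formed before applying [G], [f'] the one formed
    afterwards, and [s], [t] are its values at the two ends. *)
Definition nat_square l (f : option (arr C)) (f' s t : option (arr D)) : Prop :=
  match l with
  | IsLax => (G <a> f) ∘ s ≐ t ∘ f'
  | IsColax => f' ∘ s ≐ t ∘ (G <a> f)
  end.

Lemma compat_def k (a1 a2 a3 b1 b2 b3 : option (arr C)) :
  compat_eq k a1 a2 a3 b1 b2 b3 ->
  [/\ isSome a2, isSome a3, isSome b1 & isSome b2].
Proof.
have part (x y z : option (arr C)) :
    isSome (x ∘ y ∘ z) -> [/\ isSome x, isSome y & isSome z].
  by move=> d; have /def_lift2[] := def_after_l d; have := def_after_r d.
by case: k => H; have /part[? ? ?] := peq_def H; have /part[? ? ?] := peq_defr H.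
Qed.

(* [a3] is a comparison of horizontal, [b2] one of vertical nature; [A2'] and
   [B1'] are obtained from [A2] and [B1] by transport along them. *)
Lemma compat_chase k (a1 a2 a3 b1 b2 b3 : option (arr C))
    (A2 A3 B1 B2 B3 A2' B1' a3' b2' : option (arr D)) :
  compat_eq k a1 a2 a3 b1 b2 b3 ->
  compat_eq k (G <a> b3) A2 A3 B1 B2 B3 ->
  nat_square (vlaxity k) a3 a3' (sel (hlaxity k) A2 A2') (sel (hlaxity k) A2' A2) ->
  nat_square (hlaxity k) b2 b2' (sel (vlaxity k) B1 B1') (sel (vlaxity k) B1' B1) ->
  isSome (comp_by (hlaxity k) a3' A3) -> isSome (comp_by (vlaxity k) b2' B2) ->
  compat_eq k (G <a> a1) (comp_by (vlaxity k) (G <a> a2) A2')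
    (comp_by (hlaxity k) a3' A3) (comp_by (hlaxity k) (G <a> b1) B1')
    (comp_by (vlaxity k) b2' B2) B3.
Proof.
case: k => /= H K n m d e.
(* With both directions lax the condition has the shape of the associativity condition for
   composites, and dually with both colax; only the mixed kind needs a chase of its own. *)
- exact: chase_lax_kappa H K n m d e.
- saturate.
  apply: (@peq_via _ (b2' ∘ B2 ∘ B3 ∘ A3 ∘ a3')); first by defd.
  + transitivity (B1' ∘ (G <a> (b1 ∘ a1 ∘ a2)) ∘ A2').
      by rewrite !fmap_after; defd.
    rewrite (peqE H) !fmap_after; try by defd.
    rewrite !oafterA -(peqE m) -!oafterA (peqE n); congr (b2' ∘ _).
    by rewrite !oafterA (peqE K).
  + by rewrite !oafterA.
- exact: chase_colax_kappa H K n m.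
Qed.

End NaturalitySquares.

Section ComparisonNaturality.
Variables (Y0 Y1 Z0 Z1 : category) (P : pseudocat Y0 Y1) (Q : pseudocat Z0 Z1).
Variables (F : pmap Y0 Y1 Z0 Z1) (l : laxity).
Hypothesis hF : has_laxity l P Q F.

Lemma osrc_ocmul x y : isSome (x ⋆[P] y) -> osrc (ocmul F x y)
  = sel l ((pmap1 F <o> x) ⋆[Q] (pmap1 F <o> y)) (pmap1 F <o> (x ⋆[P] y)).
Proof. by case: l hF => hl; [exact: (lax_osrc hl)|exact: (colax_osrc hl)]. Qed.

Lemma otgt_ocmul x y : isSome (x ⋆[P] y) -> otgt (ocmul F x y)
  = sel l (pmap1 F <o> (x ⋆[P] y)) ((pmap1 F <o> x) ⋆[Q] (pmap1 F <o> y)).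
Proof. by case: l hF => hl; [exact: (lax_otgt hl)|exact: (colax_otgt hl)]. Qed.

Lemma osrc_ocunit a : osrc (ocunit F a)
  = sel l (punit Q <o> pmap0 F <o> a) (pmap1 F <o> punit P <o> a).
Proof. by case: l hF => hl; [exact: (lax_unit_osrc hl)|exact: (colax_unit_osrc hl)]. Qed.

Lemma otgt_ocunit a : otgt (ocunit F a)
  = sel l (pmap1 F <o> punit P <o> a) (punit Q <o> pmap0 F <o> a).
Proof. by case: l hF => hl; [exact: (lax_unit_otgt hl)|exact: (colax_unit_otgt hl)]. Qed.

Lemma ocmul_nat f g : isSome (f ⊛[P] g) ->
  nat_square (pmap1 F) l (f ⊛[P] g) ((pmap1 F <a> f) ⊛[Q] (pmap1 F <a> g))
    (ocmul F (osrc f) (osrc g)) (ocmul F (otgt f) (otgt g)).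
Proof. by case: l hF => hl; [exact: (lax_natE hl)|exact: (colax_natE hl)]. Qed.

Lemma ocunit_nat u : isSome u ->
  nat_square (pmap1 F) l (punit P <a> u) (punit Q <a> pmap0 F <a> u)
    (ocunit F (osrc u)) (ocunit F (otgt u)).
Proof. by case: l hF => hl; [exact: (lax_unit_natE hl)|exact: (colax_unit_natE hl)]. Qed.

Lemma ocmul_sel l' x y x' y' :
  ocmul F (sel l' x x') (sel l' y y') = sel l' (ocmul F x y) (ocmul F x' y').
Proof. by case: l'. Qed.

Lemma ocunit_sel l' x x' :
  ocunit F (sel l' x x') = sel l' (ocunit F x) (ocunit F x').
Proof. by case: l'. Qed.

End ComparisonNaturality.

Section CompatibleComposites.
Variables (U0 U1 V0 V1 U0' U1' V0' V1' U0'' U1'' V0'' V1'' : category).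
Variables (P : pseudocat U0 U1) (Q : pseudocat V0 V1).
Variables (P' : pseudocat U0' U1') (Q' : pseudocat V0' V1').
Variables (P'' : pseudocat U0'' U1'') (Q'' : pseudocat V0'' V1'').
Variables (E0 : functor U0 V0) (E1 : functor U1 V1).
Variables (E0' : functor U0' V0') (E1' : functor U1' V1').
Variable E1'' : functor U1'' V1''.
Variables (F : pmap U0 U1 U0' U1') (G : pmap U0' U1' U0'' U1'').
Variables (H : pmap V0 V1 V0' V1') (K : pmap V0' V1' V0'' V1'').
Variable l : laxity.
Hypotheses (hF : has_laxity l P P' F) (hG : has_laxity l P' P'' G).
Hypotheses (hH : has_laxity l Q Q' H) (hK : has_laxity l Q' Q'' K).
Hypothesis F0H0 : fcomp E0' (pmap0 F) = fcomp (pmap0 H) E0.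
Hypothesis F1H1 : fcomp E1' (pmap1 F) = fcomp (pmap1 H) E1.
Hypothesis G1K1 : fcomp E1'' (pmap1 G) = fcomp (pmap1 K) E1'.
Hypothesis FH : cmp_compatible E0 E1 E1' F H.
Hypothesis GK : cmp_compatible E0' E1' E1'' G K.

Lemma ocunit_compat (Y0 Y1 Y0' Y1' X0 X1 X0' X1' : category)
    (e0 : functor Y0 X0) (e1 : functor Y1 X1) (e1' : functor Y1' X1')
    (f : pmap Y0 Y1 Y0' Y1') (h : pmap X0 X1 X0' X1') a :
  cmp_compatible e0 e1 e1' f h ->
  e1' <a> ocunit f a = ocunit h (e0 <o> a).
Proof. by case: a => // a [/= -> _]. Qed.

Lemma ocmul_compat (Y0 Y1 Y0' Y1' X0 X1 X0' X1' : category)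
    (e0 : functor Y0 X0) (e1 : functor Y1 X1) (e1' : functor Y1' X1')
    (f : pmap Y0 Y1 Y0' Y1') (h : pmap X0 X1 X0' X1') x y :
  cmp_compatible e0 e1 e1' f h -> isSome (ocmul f x y) ->
  e1' <a> ocmul f x y = ocmul h (e1 <o> x) (e1 <o> y).
Proof.
case: x y => [x|] [y|] // [_ fh]; rewrite /ocmul /=.
by case E: (cmul f x y) => [c|] // _; rewrite /= (fh _ _ _ E).
Qed.

(** A functor preserves composites in either order, and the order depends only on the common laxity;
    so the claim reduces to the two factors, where it is assumed. *)
Lemma pcomp_compatible : cmp_compatible E0 E1 E1'' (pcomp l G F) (pcomp l K H).
Proof.
have [e0 _] := functor_sq F0H0; have [e1 _] := functor_sq F1H1.
have [_ e2] := functor_sq G1K1.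
split=> [a|x y c e].
  apply: Some_inj.
  have dF := def_comp_unit hF hG (a := ↑a) isT.
  have -> : ↑(farr E1'' (cunit (pcomp l G F) a))
            = E1'' <a> ocunit (pcomp l G F) ↑a by [].
  rewrite (ocunit_pcomp hF hG) comp_by_fmap // e2 (ocunit_compat _ FH).
  rewrite (ocunit_compat _ GK) e0.
  by rewrite -[RHS]/(ocunit (pcomp l K H) ↑(E0 a)) (ocunit_pcomp hH hK).
have e' : Some c = ocmul (pcomp l G F) ↑x ↑y by rewrite -e.
have -> : Some (farr E1'' c) = E1'' <a> ocmul (pcomp l G F) ↑x ↑y.
  by rewrite -e'.
have d : isSome (comp_by l (pmap1 G <a> ocmul F ↑x ↑y)
    (ocmul G (pmap1 F <o> ↑x) (pmap1 F <o> ↑y))).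
  by rewrite -ocmul_pcomp -e'.
have [] := comp_by_def d; rewrite def_omap => dF dG.
rewrite ocmul_pcomp comp_by_fmap // e2 (ocmul_compat FH) // (ocmul_compat GK) //.
by rewrite !e1 -ocmul_pcomp.
Qed.

End CompatibleComposites.

(** * Composition of morphisms of intercategories *)

Section CompositeMorphisms.
Variables (k : kind) (X Y Z : intercat).
Variables (Ψ : morphism k Y Z) (Φ : morphism k X Y).

Definition mcomp_map : inter_map X Z := InterMap
  (fcomp (onA0 Ψ) (onA0 Φ)) (fcomp (onA1 Ψ) (onA1 Φ))
  (fcomp (onB0 Ψ) (onB0 Φ)) (fcomp (onB1 Ψ) (onB1 Φ))
  (comp_cmp (hlaxity k) (map_row0 Ψ) (map_row0 Φ))
  (comp_cmp (hlaxity k) (map_row1 Ψ) (map_row1 Φ))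
  (comp_cmp (vlaxity k) (map_colA Ψ) (map_colA Φ))
  (comp_cmp (vlaxity k) (map_colB Ψ) (map_colB Φ)).

Let axΨ := mor_ax Ψ.
Let axΦ := mor_ax Φ.

Let r0E : map_row0 mcomp_map
  = pcomp (hlaxity k) (map_row0 Ψ) (map_row0 Φ) := erefl.
Let r1E : map_row1 mcomp_map
  = pcomp (hlaxity k) (map_row1 Ψ) (map_row1 Φ) := erefl.
Let cAE : map_colA mcomp_map
  = pcomp (vlaxity k) (map_colA Ψ) (map_colA Φ) := erefl.
Let cBE : map_colB mcomp_map
  = pcomp (vlaxity k) (map_colB Ψ) (map_colB Φ) := erefl.

(** The condition for [Ψ] is taken at the image under [Φ]. It is pasted to the image of the
    condition for [Φ] by two squares: naturality of the vertical comparison of [Ψ] at a horizontal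
    one of [Φ], and naturality of the horizontal comparison of [Ψ] at a vertical one of [Φ]. The
    other three interchangers follow the same pattern. *)
Lemma mcomp_tau A : compat_eq k
  (onB1 mcomp_map <a> otau ↑A)
  (ocunit (map_colB mcomp_map) ↑(punit (row0 X) A))
  (punit (colB Z) <a> ocunit (map_row0 mcomp_map) ↑A)
  (ocunit (map_row1 mcomp_map) ↑(punit (colA X) A))
  (punit (row1 Z) <a> ocunit (map_colA mcomp_map) ↑A)
  (otau ↑(onA0 mcomp_map A)).
Proof.
have HF := mor_tau axΦ A; have HG := mor_tau axΨ (onA0 Φ A).
rewrite fcomp_amap.
rewrite (ocunit_pcomp (mor_colB axΦ) (mor_colB axΨ)).
rewrite (ocunit_pcomp (mor_row0 axΦ) (mor_row0 axΨ)).
rewrite (ocunit_pcomp (mor_row1 axΦ) (mor_row1 axΨ)).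
rewrite (ocunit_pcomp (mor_colA axΦ) (mor_colA axΨ)).
have u0 := def_comp_unit (mor_row0 axΦ) (mor_row0 axΨ) (a := ↑A) isT.
have uA := def_comp_unit (mor_colA axΦ) (mor_colA axΨ) (a := ↑A) isT.
rewrite (comp_by_fmap _ u0) (comp_by_fmap _ uA).
apply: (compat_chase HF HG).
- have := ocunit_nat (mor_colB axΨ) (u := ocunit (map_row0 Φ) ↑A) isT.
  by rewrite (osrc_ocunit (mor_row0 axΦ)) (otgt_ocunit (mor_row0 axΦ)) !ocunit_sel.
- have := ocunit_nat (mor_row1 axΨ) (u := ocunit (map_colA Φ) ↑A) isT.
  by rewrite (osrc_ocunit (mor_colA axΦ)) (otgt_ocunit (mor_colA axΦ)) !ocunit_sel.
- by rewrite -comp_by_fmap // def_omap.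
- by rewrite -comp_by_fmap // def_omap.
Qed.

Lemma mcomp_mu v v' : composable (colA X) v v' -> compat_eq k
  (onB1 mcomp_map <a> omu ↑v ↑v')
  (ocmul (map_colB mcomp_map) ↑(punit (row1 X) v) ↑(punit (row1 X) v'))
  (ocunit (map_row1 mcomp_map) ↑v ⊛[colB Z] ocunit (map_row1 mcomp_map) ↑v')
  (ocunit (map_row1 mcomp_map) (↑v ⋆[colA X] ↑v'))
  (punit (row1 Z) <a> ocmul (map_colA mcomp_map) ↑v ↑v')
  (omu ↑(onA1 mcomp_map v) ↑(onA1 mcomp_map v')).
Proof.
move=> c; have d : isSome (↑v ⋆[colA X] ↑v') by apply/def_composable.
have axv := has_laxity_pmap (mor_colA axΦ).
have HF := mor_mu axΦ c.
have HG : _ := mor_mu axΨ ((def_composable _ _ _).1 (def_map_pob axv d)).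
(* That both conditions are defined already supplies the composable pairs needed for interchange,
   without computing any boundary. *)
have [F2 F3 _ FB] := compat_def HF; have [G2 G3 _ GB] := compat_def HG.
rewrite fcomp_amap ?r0E ?r1E ?cAE ?cBE !ocmul_pcomp !(ocunit_pcomp (mor_row1 axΦ) (mor_row1 axΨ)).
have u := def_comp_unit (mor_row1 axΦ) (mor_row1 axΨ) (a := ↑v) isT.
have u' := def_comp_unit (mor_row1 axΦ) (mor_row1 axΨ) (a := ↑v') isT.
have m := def_comp_mul (mor_colA axΦ) (mor_colA axΨ) d.
have F3' := def_map_parr (has_laxity_pmap (mor_colB axΨ)) F3.
have I : _ ≐ _ := comp_by_parr u u' F3' G3.
rewrite (peqE I) (comp_by_fmap _ m).
apply: (compat_chase HF HG).
- have := ocmul_nat (mor_colB axΨ) F3.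
  by rewrite !(osrc_ocunit (mor_row1 axΦ)) !(otgt_ocunit (mor_row1 axΦ)) !ocmul_sel.
- rewrite def_omap in FB.
  have := ocunit_nat (mor_row1 axΨ) FB.
  by rewrite (osrc_ocmul (mor_colA axΦ)) // (otgt_ocmul (mor_colA axΦ)) // !ocunit_sel.
- exact: peq_defr I.
- by rewrite -comp_by_fmap // def_omap.
Qed.

Lemma mcomp_delta h h' : composable (row0 X) h h' -> compat_eq k
  (onB1 mcomp_map <a> odelta ↑h ↑h')
  (ocunit (map_colB mcomp_map) (↑h ⋆[row0 X] ↑h'))
  (punit (colB Z) <a> ocmul (map_row0 mcomp_map) ↑h ↑h')
  (ocmul (map_row1 mcomp_map) ↑(punit (colB X) h) ↑(punit (colB X) h'))
  (ocunit (map_colB mcomp_map) ↑h ⊛[row1 Z] ocunit (map_colB mcomp_map) ↑h')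
  (odelta ↑(onB0 mcomp_map h) ↑(onB0 mcomp_map h')).
Proof.
move=> c; have d : isSome (↑h ⋆[row0 X] ↑h') by apply/def_composable.
have axv := has_laxity_pmap (mor_row0 axΦ).
have HF := mor_delta axΦ c.
have HG : _ := mor_delta axΨ ((def_composable _ _ _).1 (def_map_pob axv d)).
have [F2 F3 _ FB] := compat_def HF; have [G2 G3 _ GB] := compat_def HG.
rewrite fcomp_amap ?r0E ?r1E ?cAE ?cBE !ocmul_pcomp !(ocunit_pcomp (mor_colB axΦ) (mor_colB axΨ)).
have u := def_comp_unit (mor_colB axΦ) (mor_colB axΨ) (a := ↑h) isT.
have u' := def_comp_unit (mor_colB axΦ) (mor_colB axΨ) (a := ↑h') isT.
have m := def_comp_mul (mor_row0 axΦ) (mor_row0 axΨ) d.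
have FB' := def_map_parr (has_laxity_pmap (mor_row1 axΨ)) FB.
have I : _ ≐ _ := comp_by_parr u u' FB' GB.
rewrite (peqE I) (comp_by_fmap _ m).
apply: (compat_chase HF HG).
- rewrite def_omap in F3.
  have := ocunit_nat (mor_colB axΨ) F3.
  by rewrite (osrc_ocmul (mor_row0 axΦ)) // (otgt_ocmul (mor_row0 axΦ)) // !ocunit_sel.
- have := ocmul_nat (mor_row1 axΨ) FB.
  by rewrite !(osrc_ocunit (mor_colB axΦ)) !(otgt_ocunit (mor_colB axΦ)) !ocmul_sel.
- by rewrite -comp_by_fmap // def_omap.
- exact: peq_defr I.
Qed.

Lemma mcomp_chi a b a' b' : composable4 a b a' b' -> compat_eq k
  (onB1 mcomp_map <a> ochi ↑a ↑b ↑a' ↑b')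
  (ocmul (map_colB mcomp_map) (↑a ⋆[row1 X] ↑b) (↑a' ⋆[row1 X] ↑b'))
  (ocmul (map_row1 mcomp_map) ↑a ↑b
    ⊛[colB Z] ocmul (map_row1 mcomp_map) ↑a' ↑b')
  (ocmul (map_row1 mcomp_map) (↑a ⋆[colB X] ↑a') (↑b ⋆[colB X] ↑b'))
  (ocmul (map_colB mcomp_map) ↑a ↑a'
    ⊛[row1 Z] ocmul (map_colB mcomp_map) ↑b ↑b')
  (ochi ↑(onB1 mcomp_map a) ↑(onB1 mcomp_map b)
    ↑(onB1 mcomp_map a') ↑(onB1 mcomp_map b')).
Proof.
move=> c; have [/def_composable ab /def_composable ab'
  /def_composable aa /def_composable bb] := c.
have axr := has_laxity_pmap (mor_row1 axΦ).
have axc := has_laxity_pmap (mor_colB axΦ).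
have c' : composable4 (onB1 Φ a) (onB1 Φ b) (onB1 Φ a') (onB1 Φ b').
  split.
  - exact: (def_composable _ _ _).1 (def_map_pob axr ab).
  - exact: (def_composable _ _ _).1 (def_map_pob axr ab').
  - exact: (def_composable _ _ _).1 (def_map_pob axc aa).
  - exact: (def_composable _ _ _).1 (def_map_pob axc bb).
have HF := mor_chi axΦ c; have HG : _ := mor_chi axΨ c'.
have [F2 F3 _ FB] := compat_def HF; have [G2 G3 _ GB] := compat_def HG.
rewrite fcomp_amap ?r0E ?r1E ?cAE ?cBE !ocmul_pcomp.
have m1 := def_comp_mul (mor_row1 axΦ) (mor_row1 axΨ) ab.
have m2 := def_comp_mul (mor_row1 axΦ) (mor_row1 axΨ) ab'.
have m3 := def_comp_mul (mor_colB axΦ) (mor_colB axΨ) aa.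
have m4 := def_comp_mul (mor_colB axΦ) (mor_colB axΨ) bb.
have F3' := def_map_parr (has_laxity_pmap (mor_colB axΨ)) F3.
have FB' := def_map_parr (has_laxity_pmap (mor_row1 axΨ)) FB.
(* For [chi] both the horizontal and the vertical comparisons occur in pairs, hence an interchange
   in a column and another in a row. *)
have I : _ ≐ _ := comp_by_parr m1 m2 F3' G3.
have J : _ ≐ _ := comp_by_parr m3 m4 FB' GB.
rewrite (peqE I) (peqE J).
apply: (compat_chase HF HG).
- have := ocmul_nat (mor_colB axΨ) F3.
  by rewrite !(osrc_ocmul (mor_row1 axΦ)) // !(otgt_ocmul (mor_row1 axΦ)) // !ocmul_sel.
- have := ocmul_nat (mor_row1 axΨ) FB.
  by rewrite !(osrc_ocmul (mor_colB axΦ)) // !(otgt_ocmul (mor_colB axΦ)) // !ocmul_sel.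
- exact: peq_defr I.
- exact: peq_defr J.
Qed.

Lemma mcomp_axioms : morphism_axioms mcomp_map k.
Proof.
split.
- exact: pcomp_laxity (mor_row0 axΦ) (mor_row0 axΨ).
- exact: pcomp_laxity (mor_row1 axΦ) (mor_row1 axΨ).
- exact: pcomp_laxity (mor_colA axΦ) (mor_colA axΨ).
- exact: pcomp_laxity (mor_colB axΦ) (mor_colB axΨ).
- exact: (pcomp_compatible (mor_colB axΦ) (mor_colB axΨ) (mor_colA axΦ)
    (mor_colA axΨ) (esym (pmap_d0 (has_laxity_pmap (mor_row0 axΦ))))
    (esym (pmap_d0 (has_laxity_pmap (mor_row1 axΦ))))
    (esym (pmap_d0 (has_laxity_pmap (mor_row1 axΨ))))
    (mor_d0 axΦ) (mor_d0 axΨ)).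
- exact: (pcomp_compatible (mor_colB axΦ) (mor_colB axΨ) (mor_colA axΦ)
    (mor_colA axΨ) (esym (pmap_d1 (has_laxity_pmap (mor_row0 axΦ))))
    (esym (pmap_d1 (has_laxity_pmap (mor_row1 axΦ))))
    (esym (pmap_d1 (has_laxity_pmap (mor_row1 axΨ))))
    (mor_d1 axΦ) (mor_d1 axΨ)).
- exact: (pcomp_compatible (mor_row1 axΦ) (mor_row1 axΨ) (mor_row0 axΦ)
    (mor_row0 axΨ) (esym (pmap_d0 (has_laxity_pmap (mor_colA axΦ))))
    (esym (pmap_d0 (has_laxity_pmap (mor_colB axΦ))))
    (esym (pmap_d0 (has_laxity_pmap (mor_colB axΨ))))
    (mor_D0 axΦ) (mor_D0 axΨ)).
- exact: (pcomp_compatible (mor_row1 axΦ) (mor_row1 axΨ) (mor_row0 axΦ)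
    (mor_row0 axΨ) (esym (pmap_d1 (has_laxity_pmap (mor_colA axΦ))))
    (esym (pmap_d1 (has_laxity_pmap (mor_colB axΦ))))
    (esym (pmap_d1 (has_laxity_pmap (mor_colB axΨ))))
    (mor_D1 axΦ) (mor_D1 axΨ)).
- exact: mcomp_tau.
- exact: mcomp_mu.
- exact: mcomp_delta.
- exact: mcomp_chi.
Qed.

Definition mcomp : morphism k X Z := Morphism mcomp_axioms.

End CompositeMorphisms.

(** * Identity morphisms *)

Lemma oid_left_eq (C : category) (f : option (arr C)) x :
  otgt f = x -> oid x ∘ f = f.
Proof. by move=> <-; exact: oid_left. Qed.
Lemma oid_right_eq (C : category) (f : option (arr C)) x :
  osrc f = x -> f ∘ oid x = f.
Proof. by move=> <-; exact: oid_right. Qed.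

Lemma globular_id1 (Y0 Y1 : category) (P : pseudocat Y0 Y1) (y : ob Y1) :
  globular P (id1 y).
Proof. by split; rewrite farr_id; eexists. Qed.

Section IdentityMaps.
Variables (Y0 Y1 : category) (P : pseudocat Y0 Y1).

Definition ident_cmp : comparison Y0 Y1 Y1 := Comparison
  (fun a => id1 (punit P a)) (fun x y => oid (↑x ⋆[P] ↑y)).

Definition pident := PMap (fid Y0) (fid Y1) ident_cmp.

Lemma ocunit_pident a : ocunit pident a = oid (punit P <o> a).
Proof. by case: a. Qed.

Lemma ocmul_pident x y : ocmul pident x y = oid (x ⋆[P] y).
Proof. by case: x y => [x|] [y|]. Qed.

Let ax := pseudocat_ax P.

Lemma pident_axioms : pmap_axioms P P pident.
Proof.
split=> [||a|x y|x y c]; rewrite ?fcomp_idl ?fcomp_idr //.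
- exact: globular_id1.
- rewrite -def_composable /=; split.
    by move=> /isSomeP; rewrite def_oid.
  by move=> d; apply/isSomeP; rewrite def_oid.
- rewrite /=; case: (pob P x y) => [z|] //= [<-]; exact: globular_id1.
Qed.

Lemma osrc_lam x : osrc (lam P ↑x) = ↑(punit P (pd0 P x)) ⋆[P] ↑x.
Proof. by rewrite (plam_src ax). Qed.
Lemma osrc_rho x : osrc (rho P ↑x) = ↑x ⋆[P] ↑(punit P (pd1 P x)).
Proof. by rewrite (prho_src ax). Qed.

Lemma def_kappa x y z : composable P x y -> composable P y z ->
  isSome (kappa P ↑x ↑y ↑z).
Proof. by move=> c d; apply/isSomeP/(passoc_defined ax). Qed.

Lemma osrc_kappa x y z : composable P x y -> composable P y z ->
  osrc (kappa P ↑x ↑y ↑z) = ↑x ⋆[P] (↑y ⋆[P] ↑z).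
Proof.
move=> c d; have := def_kappa c d; rewrite -[kappa P ↑x ↑y ↑z]/(passoc P x y z).
by case E: (passoc P x y z) => [u|] // _; rewrite (passoc_src ax E).
Qed.
Lemma otgt_kappa x y z : composable P x y -> composable P y z ->
  otgt (kappa P ↑x ↑y ↑z) = (↑x ⋆[P] ↑y) ⋆[P] ↑z.
Proof.
move=> c d; have := def_kappa c d; rewrite -[kappa P ↑x ↑y ↑z]/(passoc P x y z).
by case E: (passoc P x y z) => [u|] // _; rewrite (passoc_tgt ax E).
Qed.

Lemma pident_unit_natural : natural (punit P) (punit P) (cunit pident).
Proof.
split=> [a|a|f]; [exact: src_id1|exact: tgt_id1|].
apply: (@peq_via _ ↑(farr (punit P) f)) => //.
- by apply: (oid_right_eq (x := ↑(punit P (src f)))); rewrite /= farr_src.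
- by apply: (oid_left_eq (x := ↑(punit P (tgt f)))); rewrite /= farr_tgt.
Qed.

(** All comparisons are identities, so that each condition equates an arrow with itself padded by
    identities at its ends. The facts collected at the start serve both laxities. *)
Lemma pident_laxity l : has_laxity l P P pident.
Proof.
have natm f g : composable_arr P f g ->
    (↑f ⊛[P] ↑g) ∘ oid (↑(src f) ⋆[P] ↑(src g))
    ≐ oid (↑(tgt f) ⋆[P] ↑(tgt g)) ∘ (↑f ⊛[P] ↑g).
  move=> /def_composable_arr d; apply: (@peq_via _ (↑f ⊛[P] ↑g)) => //.
  + by apply: oid_right_eq; rewrite osrc_parr.
  + by apply: oid_left_eq; rewrite otgt_parr.
have mE x y c : cmul pident x y = Some c ->
    ↑x ⋆[P] ↑y = Some (src c) /\ ↑x ⋆[P] ↑y = Some (tgt c).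
  move=> e; have e' : oid (↑x ⋆[P] ↑y) = ↑c := e.
  by rewrite -{1}[_ ⋆[P] _]osrc_oid -[X in _ /\ X = _]otgt_oid e'.
have lamE x : lam P ↑x ∘ oid (osrc (lam P ↑x)) ∘ oid (osrc (lam P ↑x))
    ≐ lam P ↑x by rewrite !oid_right; exists (plam P x).
have rhoE x : rho P ↑x ∘ oid (osrc (rho P ↑x)) ∘ oid (osrc (rho P ↑x))
    ≐ rho P ↑x by rewrite !oid_right; exists (prho P x).
have kapE x y z : composable P x y -> composable P y z ->
  kappa P ↑x ↑y ↑z ∘ oid (↑x ⋆[P] (↑y ⋆[P] ↑z)) ∘ oid (↑x ⋆[P] (↑y ⋆[P] ↑z))
  ≐ oid ((↑x ⋆[P] ↑y) ⋆[P] ↑z) ∘ oid ((↑x ⋆[P] ↑y) ⋆[P] ↑z) ∘ kappa P ↑x ↑y ↑z.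
  move=> c d; apply: (@peq_via _ (kappa P ↑x ↑y ↑z)); first exact: def_kappa.
  + by rewrite !oid_right_eq // osrc_kappa.
  + by rewrite oid_idem oid_left_eq // otgt_kappa.
case: l; split.
- exact: pident_axioms.
- by rewrite fcomp_idr fcomp_idl; exact: pident_unit_natural.
- by move=> x y c /mE[].
- by move=> x y c /mE[_ <-]; rewrite fid_omap.
- by move=> f g c; rewrite !ocmul_pident !fid_amap; exact: natm.
- by move=> x; rewrite ocunit_pident ocmul_pident fid_amap oid_parr -osrc_lam.
- by move=> x; rewrite ocunit_pident ocmul_pident fid_amap oid_parr -osrc_rho.
- move=> x y z c d; rewrite !ocmul_pident fid_amap !oid_parr; exact: kapE.
- exact: pident_axioms.
- by rewrite fcomp_idr fcomp_idl; exact: pident_unit_natural.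
- by move=> x y c /mE[<- _]; rewrite fid_omap.
- by move=> x y c /mE[].
- by move=> f g c; rewrite !ocmul_pident !fid_amap; exact: natm.
- by move=> x; rewrite ocunit_pident ocmul_pident fid_amap oid_parr -osrc_lam.
- by move=> x; rewrite ocunit_pident ocmul_pident fid_amap oid_parr -osrc_rho.
- move=> x y z c d; rewrite !ocmul_pident fid_amap !oid_parr; exact: kapE.
Qed.

End IdentityMaps.

Lemma pident_compatible (Y0 Y1 Z0 Z1 : category)
    (P : pseudocat Y0 Y1) (Q : pseudocat Z0 Z1)
    (F0 : functor Y0 Z0) (F1 : functor Y1 Z1) :
  strict_pseudofunctor P Q F0 F1 ->
  cmp_compatible F0 F1 F1 (ident_cmp P) (ident_cmp Q).
Proof.
move=> s; split=> [a|x y c] /=.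
  rewrite farr_id; congr id1.
  exact: (congr1 (fun K => fob K a) (strict_unit s)).
case E: (pob P x y) => [z|] //= [<-].
by rewrite (strict_pob s E) /= farr_id.
Qed.

(** Applied to each interchanger [c]: with identity comparisons the three shapes of compatibility
    all reduce to [c] padded by identities at its source and target. *)
Lemma compat_id k (C : category) (c : option (arr C)) : isSome c ->
  compat_eq k c (oid (osrc c)) (oid (osrc c)) (oid (otgt c)) (oid (otgt c)) c.
Proof.
move=> d; have e : oid (otgt c) ∘ oid (otgt c) ∘ c = c.
  by rewrite oid_idem oid_left.
by case: k; apply: (@peq_via _ c) => //=; rewrite ?oid_left ?oid_right //
  ?oid_left ?oid_right // oid_left.
Qed.

Section IdentityMorphism.
Variables (k : kind) (X : intercat).

Definition mident_map : inter_map X X := InterMap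
  (fid (A0 X)) (fid (A1 X)) (fid (B0 X)) (fid (B1 X))
  (ident_cmp (row0 X)) (ident_cmp (row1 X))
  (ident_cmp (colA X)) (ident_cmp (colB X)).

Let ax := intercat_ax X.

Lemma mident_axioms : morphism_axioms mident_map k.
Proof.
(* [map_row0 mident_map] is [pident (row0 X)] by conversion only; these equations are restated in
   the form displayed by the goals, so that rewriting finds them. *)
have ur0 := @ocunit_pident _ _ (row0 X) : forall a,
  ocunit (map_row0 mident_map) a = _.
have ur1 := @ocunit_pident _ _ (row1 X) : forall a,
  ocunit (map_row1 mident_map) a = _.
have ucA := @ocunit_pident _ _ (colA X) : forall a,
  ocunit (map_colA mident_map) a = _.
have ucB := @ocunit_pident _ _ (colB X) : forall a,
  ocunit (map_colB mident_map) a = _.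
have mr0 := @ocmul_pident _ _ (row0 X) : forall a b,
  ocmul (map_row0 mident_map) a b = _.
have mr1 := @ocmul_pident _ _ (row1 X) : forall a b,
  ocmul (map_row1 mident_map) a b = _.
have mcA := @ocmul_pident _ _ (colA X) : forall a b,
  ocmul (map_colA mident_map) a b = _.
have mcB := @ocmul_pident _ _ (colB X) : forall a b,
  ocmul (map_colB mident_map) a b = _.
split.
- exact: pident_laxity.
- exact: pident_laxity.
- exact: pident_laxity.
- exact: pident_laxity.
- exact: (pident_compatible (d0_strict ax)).
- exact: (pident_compatible (d1_strict ax)).
- exact: (pident_compatible (D0_strict ax)).
- exact: (pident_compatible (D1_strict ax)).
- move=> A; rewrite fid_amap ur0 ur1 ucA ucB !fmap_oid.
  have := compat_id k (c := otau (X := X) ↑A) isT.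
  by rewrite (osrc_nat (tau_natural ax)) (otgt_nat (tau_natural ax)).
- move=> v v' c; rewrite fid_amap !ur1 mcA mcB !fmap_oid oid_parr.
  have /isSomeP := (mu_defined ax v v').2 c; rewrite -[omu ↑v ↑v']/(mu v v').
  case E: (mu v v') => [m|] // d; have := compat_id k (c := ↑m) isT.
  by rewrite -[osrc _](mu_src ax E) -[otgt _](mu_tgt ax E).
- move=> v v' c; rewrite fid_amap !ucB mr0 mr1 !fmap_oid oid_parr.
  have /isSomeP := (delta_defined ax v v').2 c; rewrite -[odelta ↑v ↑v']/(delta v v').
  case E: (delta v v') => [m|] // d; have := compat_id k (c := ↑m) isT.
  by rewrite -[osrc _](delta_src ax E) -[otgt _](delta_tgt ax E).
- move=> a b a' b' c; rewrite fid_amap !mr1 !mcB !oid_parr.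
  have /isSomeP := (chi_defined ax a b a' b').2 c; rewrite -[ochi ↑a ↑b ↑a' ↑b']/(chi a b a' b').
  case E: (chi a b a' b') => [m|] // d; have := compat_id k (c := ↑m) isT.
  by rewrite -[osrc _](chi_src ax E) -[otgt _](chi_tgt ax E).
Qed.

Definition mident : morphism k X X := Morphism mident_axioms.

End IdentityMorphism.

(** Over an arbitrary index type this is uniqueness of identity proofs, which proof irrelevance
    provides. The indices will be pairs of intercategories. *)
Lemma existT_inj (I : Type) (T : I -> Type) (i : I) (x y : T i) :
  existT T i x = existT T i y -> x = y.
Proof. exact: ProofIrrelevanceTheory.EqdepTheory.inj_pair2. Qed.

(** * Categories presented by a functional relation *)

Section RelationalCategories.
Variables (O M : Type) (G : graph O M) (i : O -> M) (R : M -> M -> M -> Prop).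

(** Associativity only asks for some system of composites; by [rel_functional] they are the
    composites. For the inductive relations below such a system can be written down. *)
Record category_laws : Prop := CategoryLaws {
  rel_dom_id : forall x, dom G (i x) = x;
  rel_cod_id : forall x, cod G (i x) = x;
  rel_composable : forall g f h, R g f h -> dom G g = cod G f;
  rel_total : forall g f, dom G g = cod G f -> exists h, R g f h;
  rel_functional : forall g f h h', R g f h -> R g f h' -> h = h';
  rel_dom : forall g f h, R g f h -> dom G h = dom G f;
  rel_cod : forall g f h, R g f h -> cod G h = cod G g;
  rel_idl : forall f, R (i (cod G f)) f f;
  rel_idr : forall f, R f (i (dom G f)) f;
  rel_assoc : forall h g f, dom G h = cod G g -> dom G g = cod G f ->
    exists gf hg r, [/\ R g f gf, R h g hg, R h gf r & R hg f r] }.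

Definition rel_comp (g f : M) : option M :=
  match excluded_middle_informative (exists h, R g f h) with
  | left e => Some (proj1_sig (constructive_indefinite_description _ e))
  | right _ => None
  end.

Hypothesis L : category_laws.

Lemma rel_compE g f h : rel_comp g f = Some h <-> R g f h.
Proof.
rewrite /rel_comp; case: excluded_middle_informative => [e|ne].
  case: constructive_indefinite_description => h' r /=; split=> [[<-]//|r'].
  by rewrite (rel_functional L r r').
by split=> // r; case: ne; exists h.
Qed.

Definition rel_category : category_on G.
Proof.
exists i rel_comp.
- exact: rel_dom_id.
- exact: rel_cod_id.
- move=> g f; split=> [[h /rel_compE]|e]; first exact: rel_composable.
  by have [h r] := rel_total L e; exists h; apply/rel_compE.
- by move=> g f h /rel_compE; exact: rel_dom.
- by move=> g f h /rel_compE; exact: rel_cod.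
- by move=> f; apply/rel_compE; exact: rel_idl.
- by move=> f; apply/rel_compE; exact: rel_idr.
- move=> h g f e e'; have [gf [hg [r [r1 r2 r3 r4]]]] := rel_assoc L e e'.
  exists r; rewrite ((rel_compE _ _ _).2 r1) ((rel_compE _ _ _).2 r2) /=.
  by split; apply/rel_compE.
Defined.

End RelationalCategories.

(** * The categories of intercategories *)

Lemma comparison_eq (Y0 Y1 Z1 : category) (c d : comparison Y0 Y1 Z1) :
  (forall a, cunit c a = cunit d a) ->
  (forall x y, cmul c x y = cmul d x y) -> c = d.
Proof.
case: c d => [u m] [u' m'] /= eu em; congr Comparison.
- exact: functional_extensionality.
- by apply: functional_extensionality => x; apply: functional_extensionality.
Qed.

Lemma comp_by_None l (C : category) (f : option (arr C)) :
  comp_by l None f = None.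
Proof. by case: l f => -[]. Qed.

(** The two composite functors agree only propositionally, but [comparison Y0 Y1 V1] does not
    mention them, so the equation is well typed as it stands. *)
Lemma pcompA l (Y0 Y1 Z0 Z1 W0 W1 V0 V1 : category)
    (P : pseudocat Y0 Y1) (Q : pseudocat Z0 Z1) (R : pseudocat W0 W1)
    (S : pseudocat V0 V1)
    (H : pmap W0 W1 V0 V1) (G : pmap Z0 Z1 W0 W1) (F : pmap Y0 Y1 Z0 Z1) :
  has_laxity l P Q F -> has_laxity l Q R G -> has_laxity l R S H ->
  comp_cmp l H (pcomp l G F) = comp_cmp l (pcomp l H G) F.
Proof.
move=> hF hG hH; have hGF := pcomp_laxity hF hG; have hHG := pcomp_laxity hG hH.
have byA (C D : category) (K : functor C D) (a b : option (arr C)) c :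
    isSome (comp_by l a b) ->
    comp_by l (K <a> comp_by l a b) c
    = comp_by l (K <a> a) (comp_by l (K <a> b) c).
  case: (l) => d /=; rewrite fmap_after // ?oafterA //.
apply: comparison_eq => [a|x y].
- apply: Some_inj.
  rewrite -[LHS]/(ocunit (pcomp l H (pcomp l G F)) ↑a).
  rewrite -[RHS]/(ocunit (pcomp l (pcomp l H G) F) ↑a).
  rewrite (ocunit_pcomp hGF hH) (ocunit_pcomp hF hHG).
  rewrite (ocunit_pcomp hF hG) (ocunit_pcomp hG hH) byA ?fcomp_amap //.
  exact: (def_comp_unit hF hG (a := ↑a) isT).
- rewrite -[LHS]/(ocmul (pcomp l H (pcomp l G F)) ↑x ↑y).
  rewrite -[RHS]/(ocmul (pcomp l (pcomp l H G) F) ↑x ↑y).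
  rewrite !ocmul_pcomp.
  have [d|nd] := boolP (isSome (↑x ⋆[P] ↑y)).
    rewrite byA ?fcomp_amap //; exact: (def_comp_mul hF hG d).
  (* Functors preserve composites only where these are defined, so the other pairs are treated
     apart: there the comparison of [F] is undefined, and with it both sides. *)
  have -> : ocmul F ↑x ↑y = None.
    have := def_ocmul (has_laxity_pmap hF) ↑x ↑y.
    by move: nd; case: (ocmul F ↑x ↑y) => // c /negP nd [h _]; case: nd; exact: h.
  rewrite -![_ <a> None]/(None) comp_by_None -![_ <a> None]/(None).
  by rewrite !comp_by_None.
Qed.

Lemma pcomp_idl l (Y0 Y1 Z0 Z1 : category)
    (P : pseudocat Y0 Y1) (Q : pseudocat Z0 Z1) (F : pmap Y0 Y1 Z0 Z1) :
  has_laxity l P Q F -> comp_cmp l (pident Q) F = F.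
Proof.
move=> hF; have hI := pident_laxity Q l.
apply: comparison_eq => [a|x y].
- apply: Some_inj; rewrite -[LHS]/(ocunit (pcomp l (pident Q) F) ↑a).
  rewrite (ocunit_pcomp hF hI) ocunit_pident fid_amap -[RHS]/(ocunit F ↑a).
  case: l hF {hI} => hF; rewrite /comp_by.
  + by apply: oid_right_eq; rewrite (lax_unit_osrc hF).
  + by apply: oid_left_eq; rewrite (colax_unit_otgt hF).
- rewrite -[LHS]/(ocmul (pcomp l (pident Q) F) ↑x ↑y) ocmul_pcomp ocmul_pident.
  rewrite fid_amap -[RHS]/(ocmul F ↑x ↑y).
  case E: (ocmul F ↑x ↑y) => [c|]; last by case: (l) => //=; case: (oid _).
  have d : isSome (↑x ⋆[P] ↑y).
    by apply/(def_ocmul (has_laxity_pmap hF)); rewrite E.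
  rewrite -E; case: l hF {hI} => hF; rewrite /comp_by.
  + by apply: oid_right_eq; rewrite (lax_osrc hF).
  + by apply: oid_left_eq; rewrite (colax_otgt hF).
Qed.

Lemma pcomp_idr l (Y0 Y1 Z0 Z1 : category)
    (P : pseudocat Y0 Y1) (Q : pseudocat Z0 Z1) (F : pmap Y0 Y1 Z0 Z1) :
  has_laxity l P Q F -> comp_cmp l F (pident P) = F.
Proof.
move=> hF; have hI := pident_laxity P l.
apply: comparison_eq => [a|x y].
- apply: Some_inj; rewrite -[LHS]/(ocunit (pcomp l F (pident P)) ↑a).
  rewrite (ocunit_pcomp hI hF) ocunit_pident fid_omap -[RHS]/(ocunit F ↑a).
  rewrite fmap_oid; case: l hF {hI} => hF; rewrite /comp_by.
  + by apply: oid_left_eq; rewrite (lax_unit_otgt hF).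
  + by apply: oid_right_eq; rewrite (colax_unit_osrc hF).
- rewrite -[LHS]/(ocmul (pcomp l F (pident P)) ↑x ↑y) ocmul_pcomp ocmul_pident.
  rewrite !fid_omap fmap_oid -[RHS]/(ocmul F ↑x ↑y).
  case E: (ocmul F ↑x ↑y) => [c|]; last by case: (l) => //=; case: (oid _).
  have d : isSome (↑x ⋆[P] ↑y).
    by apply/(def_ocmul (has_laxity_pmap hF)); rewrite E.
  rewrite -E; case: l hF {hI} => hF; rewrite /comp_by.
  + by apply: oid_left_eq; rewrite (lax_otgt hF).
  + by apply: oid_right_eq; rewrite (colax_osrc hF).
Qed.

Lemma morphism_eq k (X Y : intercat) (Φ Ψ : morphism k X Y) :
  mor_map Φ = mor_map Ψ -> Φ = Ψ.
Proof.
case: Φ Ψ => [f a] [g b] /= e; subst g; congr Morphism; exact: proof_irrelevance.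
Qed.

Section MorphismLaws.
Variables (k : kind) (X Y Z W : intercat).
Variables (Θ : morphism k Z W) (Ψ : morphism k Y Z) (Φ : morphism k X Y).

Lemma mcompA : mcomp Θ (mcomp Ψ Φ) = mcomp (mcomp Θ Ψ) Φ.
Proof.
have aΘ := mor_ax Θ; have aΨ := mor_ax Ψ; have aΦ := mor_ax Φ.
apply: morphism_eq; rewrite /= /mcomp_map /= !fcompA; congr InterMap.
- exact: pcompA (mor_row0 aΦ) (mor_row0 aΨ) (mor_row0 aΘ).
- exact: pcompA (mor_row1 aΦ) (mor_row1 aΨ) (mor_row1 aΘ).
- exact: pcompA (mor_colA aΦ) (mor_colA aΨ) (mor_colA aΘ).
- exact: pcompA (mor_colB aΦ) (mor_colB aΨ) (mor_colB aΘ).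
Qed.

Lemma mcomp_idl : mcomp (mident k Y) Φ = Φ.
Proof.
have aΦ := mor_ax Φ; apply: morphism_eq; rewrite /= /mcomp_map /= !fcomp_idl.
rewrite (pcomp_idl (mor_row0 aΦ)) (pcomp_idl (mor_row1 aΦ)).
rewrite (pcomp_idl (mor_colA aΦ)) (pcomp_idl (mor_colB aΦ)).
by case: (mor_map Φ).
Qed.

Lemma mcomp_idr : mcomp Φ (mident k X) = Φ.
Proof.
have aΦ := mor_ax Φ; apply: morphism_eq; rewrite /= /mcomp_map /= !fcomp_idr.
rewrite (pcomp_idr (mor_row0 aΦ)) (pcomp_idr (mor_row1 aΦ)).
rewrite (pcomp_idr (mor_colA aΦ)) (pcomp_idr (mor_colB aΦ)).
by case: (mor_map Φ).
Qed.

End MorphismLaws.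

(** A packed morphism is sent to a dependent pair over the pair of its two ends, so that one use of
    [existT_inj] disposes of both equations of objects. *)
Lemma mor_inj k (X Y : intercat) (Φ Ψ : morphism k X Y) :
  Mor Φ = Mor Ψ -> Φ = Ψ.
Proof.
pose pack (m : mor k) : {XY : intercat * intercat & morphism k XY.1 XY.2} :=
  existT _ (mor_dom m, mor_cod m) (mor_mor m).
move=> e; exact: (existT_inj (congr1 pack e)).
Qed.

Section MorphismCategory.
Variable k : kind.

(** Composability is expressed by sharing [Y] in the constructor, so that [mcomp] is applied without
    any equation between objects. *)
Inductive mor_comp : mor k -> mor k -> mor k -> Prop :=
  MorComp (X Y Z : intercat) (Ψ : morphism k Y Z) (Φ : morphism k X Y) :
    mor_comp (Mor Ψ) (Mor Φ) (Mor (mcomp Ψ Φ)).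

Lemma mor_compE (X Y Z : intercat) (Ψ : morphism k Y Z) (Φ : morphism k X Y) h :
  mor_comp (Mor Ψ) (Mor Φ) h -> h = Mor (mcomp Ψ Φ).
Proof.
(* Inversion by hand: the indices are generalized but remembered by equations, which yield the
   equations of objects; once these are substituted, [mor_inj] applies. *)
move: (erefl (Mor Ψ)) (erefl (Mor Φ)).
move: {1 3}(Mor Ψ) {1 3}(Mor Φ) => g f eg ef r.
case: r eg ef => X' Y' Z' Ψ' Φ' eg ef.
have eZ : Z' = Z := congr1 (@mor_cod k) eg.
have eY : Y' = Y := congr1 (@mor_cod k) ef.
have eX : X' = X := congr1 (@mor_dom k) ef.
by subst X' Y' Z'; rewrite (mor_inj eg) (mor_inj ef).
Qed.

Lemma mor_laws : category_laws (mor_graph k) (fun X => Mor (mident k X)) mor_comp.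
Proof.
split=> //.
- by move=> g f h [].
- move=> [Y' Z Ψ] [X Y Φ] /= e; subst Y'; eexists; exact: MorComp.
- move=> g f h h' r; case: r h' => X Y Z Ψ Φ h'.
  by move=> /mor_compE ->.
- by move=> g f h [].
- by move=> g f h [].
- by move=> [X Y Φ] /=; rewrite -{2}[Φ]mcomp_idl; exact: MorComp.
- by move=> [X Y Φ] /=; rewrite -{2}[Φ]mcomp_idr; exact: MorComp.
- move=> [Z' W Θ] [Y' Z Ψ] [X Y Φ] /= e e'; subst Z' Y'.
  exists (Mor (mcomp Ψ Φ)), (Mor (mcomp Θ Ψ)), (Mor (mcomp Θ (mcomp Ψ Φ))).
  by split; try exact: MorComp; rewrite mcompA; exact: MorComp.
Qed.


End MorphismCategory.

(** * Pasting of squares *)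

(* The laxities of [φ, ψ] and of [σ, θ]. *)
Definition sq_h (s : square_kind) : laxity :=
  match s with AllLax | LaxColax => IsLax | AllColax => IsColax end.
Definition sq_v (s : square_kind) : laxity :=
  match s with AllLax => IsLax | LaxColax | AllColax => IsColax end.

(* The common shape of the two halves of [square_eq]: [p], [q] are the
   components of the cell at the composite and at the pair, [f] and [s] the
   images of the comparisons of [φ] and [σ], [t] and [u] those of [θ], [ψ]. *)
Definition sq_eq (k : square_kind) (C : category)
    (p q f s t u : option (arr C)) : Prop :=
  match k with
  | AllLax => p ∘ f ∘ t ≐ s ∘ u ∘ q
  | LaxColax => s ∘ p ∘ f ≐ u ∘ q ∘ t
  | AllColax => u ∘ s ∘ p ≐ q ∘ t ∘ f
  end.

Section Whiskering.
Variable D : category.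

Lemma whisker2 (a b a' b' : option (arr D)) : a ∘ b ≐ a' ∘ b' ->
  forall z, z ∘ a ∘ b = z ∘ a' ∘ b'.
Proof. by move=> e z; rewrite -!oafterA (peqE e). Qed.

Lemma whisker3 (a b c a' b' c' : option (arr D)) : a ∘ b ∘ c ≐ a' ∘ b' ∘ c' ->
  forall z, z ∘ a ∘ b ∘ c = z ∘ a' ∘ b' ∘ c'.
Proof. by move=> e z; have := congr1 (oafter z) (peqE e); rewrite !oafterA. Qed.

End Whiskering.

(** In a composite bracketed to the left, the side to be replaced is either an initial segment or
    preceded by a prefix [z]; the whiskered forms match the second case. *)
Ltac rwl H := rewrite ?oafterA;
  first [rewrite (whisker3 H) | rewrite (whisker2 H) | rewrite (peqE H)].
Ltac rwr H := rewrite ?oafterA;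
  first [rewrite -(whisker3 H) | rewrite -(whisker2 H) | rewrite -(peqE H)].

Section SquareChases.
Variables (C D : category) (G : functor C D).

Lemma sq_eq_def k (E : category) (p q f s t u : option (arr E)) :
  sq_eq k p q f s t u -> isSome p /\ isSome q.
Proof.
have part (x y z : option (arr E)) :
    isSome (x ∘ y ∘ z) -> [/\ isSome x, isSome y & isSome z].
  by move=> d; have /def_lift2[] := def_after_l d; have := def_after_r d.
by case: k => H; have /part[? ? ?] := peq_def H; have /part[? ? ?] := peq_defr H.
Qed.

Lemma fmap_peq3 (a b c a' b' c' : option (arr C)) : a ∘ b ∘ c ≐ a' ∘ b' ∘ c' ->
  (G <a> a) ∘ (G <a> b) ∘ (G <a> c) ≐ (G <a> a') ∘ (G <a> b') ∘ (G <a> c').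
Proof.
move=> H; saturate; apply: (@peq_via _ (G <a> (a ∘ b ∘ c))).
- by rewrite def_omap; defd.
- by rewrite !fmap_after; defd.
- by rewrite (peqE H) !fmap_after; defd.
Qed.

(** The comparison of the shared edge links the conditions: [t] of the first cell reappears as
    [G <a> t] in the place of [s] in the second. The third hypothesis is naturality of the second
    cell at the comparison of [φ], the fourth is naturality of the comparison of [ψ'] at the
    components of the first cell. *)
Lemma sq_eq_hpaste k (p q f s t u : option (arr C))
    (p' p'' q' q'' e f' t' u' u'' : option (arr D)) :
  sq_eq k p q f s t u -> sq_eq k p' q' f' (G <a> t) t' u' ->
  (G <a> f) ∘ sel (sq_h k) p' p'' ≐ sel (sq_h k) p'' p' ∘ e ->
  nat_square G (sq_h k) q q'' u' u'' ->
  sq_eq k ((G <a> p) ∘ p'') (q'' ∘ q') (comp_by (sq_h k) e f')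
    (G <a> s) t' (comp_by (sq_h k) (G <a> u) u'').
Proof.
case: k => /= H K n m; have {}H := fmap_peq3 H; saturate.
- apply: (@peq_via _ ((G <a> s) ∘ (G <a> u) ∘ (G <a> q) ∘ u' ∘ q')).
  + by defd.
  + by rwr n; rwl K; rwl H.
  + by rwr m.
- apply: (@peq_via _ ((G <a> u) ∘ (G <a> q) ∘ (G <a> t) ∘ p' ∘ f')).
  + by defd.
  + by rwr n; rwl H.
  + by rwr m; rwr K.
- apply: (@peq_via _ (u'' ∘ (G <a> q) ∘ (G <a> t) ∘ (G <a> f) ∘ p'')).
  + by defd.
  + by rwl H.
  + by rwr K; rwl m; rwl n.
Qed.

(** Now the shared edge is [ψ]: its comparison is [u] for the first cell and gives [G <a> u], in the
    place of [f], for the second. The squares are naturality of the second cell at the comparison of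
    [σ] and of the comparison of [θ'] at the first cell. *)
Lemma sq_eq_vpaste k (p q f s t u : option (arr C))
    (p' p'' q' q'' e s' t' t'' u' : option (arr D)) :
  sq_eq k p q f s t u -> sq_eq k p' q' (G <a> u) s' t' u' ->
  e ∘ sel (sq_v k) p' p'' ≐ sel (sq_v k) p'' p' ∘ (G <a> s) ->
  nat_square G (sq_v k) q q'' t'' t' ->
  sq_eq k (p'' ∘ (G <a> p)) (q' ∘ q'') (G <a> f) (comp_by (sq_v k) e s')
    (comp_by (sq_v k) (G <a> t) t'') u'.
Proof.
case: k => /= H K n m; have {}H := fmap_peq3 H; saturate.
- apply: (@peq_via _ (p'' ∘ (G <a> s) ∘ (G <a> u) ∘ (G <a> q) ∘ t'')).
  + by defd.
  + by rwl H.
  + by rwr n; rwl m; rwl K.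
- apply: (@peq_via _ (s' ∘ p' ∘ (G <a> u) ∘ (G <a> q) ∘ (G <a> t))).
  + by defd.
  + by rwl n; rwl H.
  + by rwl m; rwr K.
- apply: (@peq_via _ (q' ∘ t' ∘ (G <a> q) ∘ (G <a> t) ∘ (G <a> f))).
  + by defd.
  + by rwl n; rwl K; rwl H.
  + by rwl m.
Qed.

End SquareChases.

(** Components of cells are total functions, so a composite of components needs a default; [tcompE]
    removes it for composable arrows. *)
Definition tcomp {C : category} (g f : arr C) : arr C := odflt f (after g f).

Lemma tcompE (C : category) (g f : arr C) :
  src g = tgt f -> ↑(tcomp g f) = ↑g ∘ ↑f.
Proof. by move=> /after_def; rewrite /tcomp afterE; case: (after g f). Qed.

Lemma square_eqE (s : square_kind) (Y0 Y1 Z0 Z1 W0 W1 V0 V1 : category)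
    (P : pseudocat Y0 Y1) (S : pseudocat V0 V1)
    (φ : pmap Y0 Y1 Z0 Z1) (ψ : pmap W0 W1 V0 V1)
    (σ : pmap Y0 Y1 W0 W1) (θ : pmap Z0 Z1 V0 V1)
    (t0 : ob Y0 -> arr V0) (t1 : ob Y1 -> arr V1) :
  square_eq s P S φ ψ σ θ t0 t1 <->
  (forall x y, composable P x y ->
     sq_eq s (omap t1 (↑x ⋆[P] ↑y)) (↑(t1 x) ⊛[S] ↑(t1 y))
       (pmap1 θ <a> ocmul φ ↑x ↑y) (pmap1 ψ <a> ocmul σ ↑x ↑y)
       (ocmul θ ↑(pmap1 φ x) ↑(pmap1 φ y))
       (ocmul ψ ↑(pmap1 σ x) ↑(pmap1 σ y))) /\
  (forall a,
     sq_eq s ↑(t1 (punit P a)) ↑(farr (punit S) (t0 a))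
       (pmap1 θ <a> ocunit φ ↑a) (pmap1 ψ <a> ocunit σ ↑a)
       (ocunit θ ↑(pmap0 φ a)) (ocunit ψ ↑(pmap0 σ a))).
Proof. by case: s. Qed.

Section CellComponents.
Variables (Y Z W V Z' V' : category).
Variables (F : functor Y Z) (G : functor W V) (S : functor Y W) (T : functor Z V).
Variable t : ob Y -> arr V.
Hypothesis nt : natural (fcomp T F) (fcomp G S) t.

Section Horizontal.
Variables (F' : functor Z Z') (G' : functor V V') (T' : functor Z' V').
Variable t' : ob Z -> arr V'.
Hypothesis nt' : natural (fcomp T' F') (fcomp G' T) t'.

Definition hpaste_at (x : ob Y) : arr V' := tcomp (farr G' (t x)) (t' (F x)).

Lemma hpaste_atE x : omap hpaste_at x = (G' <a> omap t x) ∘ omap t' (F <o> x).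
Proof.
case: x => // x; apply: tcompE.
by rewrite farr_src (nat_src nt) (nat_tgt nt').
Qed.

Lemma hpaste_at_natural :
  natural (fcomp T' (fcomp F' F)) (fcomp (fcomp G' G) S) hpaste_at.
Proof.
have E c : ↑(hpaste_at c) = (G' <a> ↑(t c)) ∘ ↑(t' (F c)) := hpaste_atE ↑c.
have d c : isSome ((G' <a> ↑(t c)) ∘ ↑(t' (F c))) by rewrite -E.
apply: naturalI => [c|c|f].
- by rewrite E (osrc_after (d c)) /= (nat_src nt').
- by rewrite E (otgt_after (d c)) /= farr_tgt (nat_tgt nt).
- rewrite !hpaste_atE.
  have H := natE nt (f := ↑f) isT; have K := natE nt' (f := F <a> ↑f) isT.
  rewrite osrc_fmap otgt_fmap !fcomp_amap in H K *.
  apply: (chase_lax_nat H K); exact: d.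
Qed.

End Horizontal.

Section Vertical.
Variables (W' : category).
Variables (G' : functor W' V') (S' : functor W W') (T' : functor V V').
Variable t' : ob W -> arr V'.
Hypothesis nt' : natural (fcomp T' G) (fcomp G' S') t'.

Definition vpaste_at (x : ob Y) : arr V' := tcomp (t' (S x)) (farr T' (t x)).

Lemma vpaste_atE x : omap vpaste_at x = omap t' (S <o> x) ∘ (T' <a> omap t x).
Proof.
case: x => // x; apply: tcompE.
by rewrite farr_tgt (nat_src nt') (nat_tgt nt).
Qed.

Lemma vpaste_at_natural :
  natural (fcomp (fcomp T' T) F) (fcomp G' (fcomp S' S)) vpaste_at.
Proof.
have E c : ↑(vpaste_at c) = ↑(t' (S c)) ∘ (T' <a> ↑(t c)) := vpaste_atE ↑c.
have d c : isSome (↑(t' (S c)) ∘ (T' <a> ↑(t c))) by rewrite -E.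
apply: naturalI => [c|c|f].
- by rewrite E (osrc_after (d c)) /= farr_src (nat_src nt).
- by rewrite E (otgt_after (d c)) /= (nat_tgt nt').
- rewrite !vpaste_atE.
  have H := natE nt (f := ↑f) isT; have K := natE nt' (f := S <a> ↑f) isT.
  rewrite osrc_fmap otgt_fmap !fcomp_amap in H K *.
  apply: (chase_colax_nat H K); exact: d.
Qed.

End Vertical.
End CellComponents.

Section SquarePasting.
Variables (s : square_kind) (l m : laxity).
Hypotheses (el : sq_h s = l) (em : sq_v s = m).
Variables (Y0 Y1 Z0 Z1 W0 W1 V0 V1 : category).
Variables (P : pseudocat Y0 Y1) (Q : pseudocat Z0 Z1).
Variables (R : pseudocat W0 W1) (S : pseudocat V0 V1).
Variables (φ : pmap Y0 Y1 Z0 Z1) (ψ : pmap W0 W1 V0 V1).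
Variables (σ : pmap Y0 Y1 W0 W1) (θ : pmap Z0 Z1 V0 V1).
Hypotheses (hφ : has_laxity l P Q φ) (hψ : has_laxity l R S ψ).
Hypotheses (hσ : has_laxity m P R σ) (hθ : has_laxity m Q S θ).
Variables (t0 : ob Y0 -> arr V0) (t1 : ob Y1 -> arr V1).
Hypothesis nt0 : natural (fcomp (pmap0 θ) (pmap0 φ)) (fcomp (pmap0 ψ) (pmap0 σ)) t0.
Hypothesis nt1 : natural (fcomp (pmap1 θ) (pmap1 φ)) (fcomp (pmap1 ψ) (pmap1 σ)) t1.
Hypothesis sq : square_eq s P S φ ψ σ θ t0 t1.

Section Horizontal.
Variables (Z0' Z1' V0' V1' : category).
Variables (Q' : pseudocat Z0' Z1') (S' : pseudocat V0' V1').
Variables (φ' : pmap Z0 Z1 Z0' Z1') (ψ' : pmap V0 V1 V0' V1').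
Variable (θ' : pmap Z0' Z1' V0' V1').
Hypotheses (hφ' : has_laxity l Q Q' φ') (hψ' : has_laxity l S S' ψ').
Variables (t0' : ob Z0 -> arr V0') (t1' : ob Z1 -> arr V1').
Hypothesis nt0' :
  natural (fcomp (pmap0 θ') (pmap0 φ')) (fcomp (pmap0 ψ') (pmap0 θ)) t0'.
Hypothesis nt1' :
  natural (fcomp (pmap1 θ') (pmap1 φ')) (fcomp (pmap1 ψ') (pmap1 θ)) t1'.
Hypothesis sq' : square_eq s Q S' φ' ψ' θ θ' t0' t1'.

(** The laxities [l] and [m] are tied to [s] by equations because, for a cell kind [c],
    [sq_h (hsquare c)] and [hlaxity (hkind c)] agree only after a case distinction on [c]. *)
Lemma square_eq_hpaste :
  square_eq s P S' (pcomp l φ' φ) (pcomp l ψ' ψ) σ θ'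
    (hpaste_at (pmap0 φ) t0 (pmap0 ψ') t0') (hpaste_at (pmap1 φ) t1 (pmap1 ψ') t1').
Proof.
have rE1 x := hpaste_atE nt1 nt1' x; have rE0 x := hpaste_atE nt0 nt0' x.
have [sqm squ] := (square_eqE _ _ _ _ _ _ _ _ _).1 sq.
have [sqm' squ'] := (square_eqE _ _ _ _ _ _ _ _ _).1 sq'.
apply/square_eqE; split=> [x y c|a].
- have d : isSome (↑x ⋆[P] ↑y) by apply/def_composable.
  have dφ := def_map_pob (has_laxity_pmap hφ) d.
  have H := sqm _ _ c; have K : _ := sqm' _ _ ((def_composable _ _ _).1 dφ).
  have [dp dq] := sq_eq_def H; have [dp' dq'] := sq_eq_def K.
  rewrite rE1 !ocmul_pcomp fcomp_amap.
  rewrite (comp_by_fmap _ (def_comp_mul hφ hφ' d)).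
  have -> : ↑(hpaste_at (pmap1 φ) t1 (pmap1 ψ') t1' x)
    = (pmap1 ψ' <a> ↑(t1 x)) ∘ ↑(t1' (pmap1 φ x)) := rE1 ↑x.
  have -> : ↑(hpaste_at (pmap1 φ) t1 (pmap1 ψ') t1' y)
    = (pmap1 ψ' <a> ↑(t1 y)) ∘ ↑(t1' (pmap1 φ y)) := rE1 ↑y.
  have dx : isSome ((pmap1 ψ' <a> ↑(t1 x)) ∘ ↑(t1' (pmap1 φ x))).
    by rewrite -(rE1 ↑x).
  have dy : isSome ((pmap1 ψ' <a> ↑(t1 y)) ∘ ↑(t1' (pmap1 φ y))).
    by rewrite -(rE1 ↑y).
  (* The pair of pasted components becomes a composite of two pairs, as the pasting lemma for
     conditions expects. *)
  have I := interchange dx dy dq' (def_map_parr (has_laxity_pmap hψ') dq).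
  rewrite (peqE I) -el; apply: (sq_eq_hpaste H K); rewrite el.
  + have dφ2 : isSome (ocmul φ ↑x ↑y) by apply/(def_ocmul (has_laxity_pmap hφ)).
    have := natE nt1' dφ2; rewrite !fcomp_amap.
    rewrite (osrc_ocmul hφ) // (otgt_ocmul hφ) //.
    by case: (l).
  + have := ocmul_nat hψ' dq.
    by rewrite /= !(nat_src nt1) !(nat_tgt nt1).
- have H := squ a; have K := squ' (pmap0 φ a).
  rewrite (ocunit_pcomp hφ hφ') (ocunit_pcomp hψ hψ') fcomp_amap.
  rewrite (comp_by_fmap _ (def_comp_unit hφ hφ' (a := ↑a) isT)).
  have -> : ↑(hpaste_at (pmap1 φ) t1 (pmap1 ψ') t1' (punit P a))
    = (pmap1 ψ' <a> ↑(t1 (punit P a))) ∘ ↑(t1' (pmap1 φ (punit P a))).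
    exact: (rE1 ↑(punit P a)).
  have -> : ↑(farr (punit S') (hpaste_at (pmap0 φ) t0 (pmap0 ψ') t0' a))
    = (punit S' <a> pmap0 ψ' <a> ↑(t0 a))
      ∘ (punit S' <a> ↑(t0' (pmap0 φ a))).
    rewrite -fmap_after -?(rE0 ↑a) //.
  rewrite -el; apply: (sq_eq_hpaste H K); rewrite el.
  + have := natE nt1' (f := ocunit φ ↑a) isT; rewrite !fcomp_amap.
    rewrite (osrc_ocunit hφ) // (otgt_ocunit hφ) //.
    by case: (l).
  + have := ocunit_nat hψ' (u := ↑(t0 a)) isT.
    by rewrite /= !(nat_src nt0) !(nat_tgt nt0).
Qed.

End Horizontal.

Section Vertical.
Variables (W0' W1' V0' V1' : category).
Variables (R' : pseudocat W0' W1') (S' : pseudocat V0' V1').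
Variables (σ' : pmap W0 W1 W0' W1') (ψ' : pmap W0' W1' V0' V1').
Variable (θ' : pmap V0 V1 V0' V1').
Hypotheses (hσ' : has_laxity m R R' σ') (hθ' : has_laxity m S S' θ').
Variables (t0' : ob W0 -> arr V0') (t1' : ob W1 -> arr V1').
Hypothesis nt0' :
  natural (fcomp (pmap0 θ') (pmap0 ψ)) (fcomp (pmap0 ψ') (pmap0 σ')) t0'.
Hypothesis nt1' :
  natural (fcomp (pmap1 θ') (pmap1 ψ)) (fcomp (pmap1 ψ') (pmap1 σ')) t1'.
Hypothesis sq' : square_eq s R S' ψ ψ' σ' θ' t0' t1'.

Lemma square_eq_vpaste :
  square_eq s P S' φ ψ' (pcomp m σ' σ) (pcomp m θ' θ)
    (vpaste_at (pmap0 σ) t0 (pmap0 θ') t0') (vpaste_at (pmap1 σ) t1 (pmap1 θ') t1').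
Proof.
have rE1 x := vpaste_atE nt1 nt1' x; have rE0 x := vpaste_atE nt0 nt0' x.
have [sqm squ] := (square_eqE _ _ _ _ _ _ _ _ _).1 sq.
have [sqm' squ'] := (square_eqE _ _ _ _ _ _ _ _ _).1 sq'.
apply/square_eqE; split=> [x y c|a].
- have d : isSome (↑x ⋆[P] ↑y) by apply/def_composable.
  have dσ := def_map_pob (has_laxity_pmap hσ) d.
  have H := sqm _ _ c; have K : _ := sqm' _ _ ((def_composable _ _ _).1 dσ).
  have [dp dq] := sq_eq_def H; have [dp' dq'] := sq_eq_def K.
  rewrite rE1 !ocmul_pcomp fcomp_amap.
  rewrite (comp_by_fmap _ (def_comp_mul hσ hσ' d)).
  have -> : ↑(vpaste_at (pmap1 σ) t1 (pmap1 θ') t1' x)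
    = ↑(t1' (pmap1 σ x)) ∘ (pmap1 θ' <a> ↑(t1 x)) := rE1 ↑x.
  have -> : ↑(vpaste_at (pmap1 σ) t1 (pmap1 θ') t1' y)
    = ↑(t1' (pmap1 σ y)) ∘ (pmap1 θ' <a> ↑(t1 y)) := rE1 ↑y.
  have dx : isSome (↑(t1' (pmap1 σ x)) ∘ (pmap1 θ' <a> ↑(t1 x))).
    by rewrite -(rE1 ↑x).
  have dy : isSome (↑(t1' (pmap1 σ y)) ∘ (pmap1 θ' <a> ↑(t1 y))).
    by rewrite -(rE1 ↑y).
  have I := interchange dx dy (def_map_parr (has_laxity_pmap hθ') dq) dq'.
  rewrite (peqE I) -em; apply: (sq_eq_vpaste H K); rewrite em.
  + have dσ2 : isSome (ocmul σ ↑x ↑y) by apply/(def_ocmul (has_laxity_pmap hσ)).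
    have := natE nt1' dσ2; rewrite !fcomp_amap.
    rewrite (osrc_ocmul hσ) // (otgt_ocmul hσ) //.
    by case: (m).
  + have := ocmul_nat hθ' dq.
    by rewrite /= !(nat_src nt1) !(nat_tgt nt1).
- have H := squ a; have K := squ' (pmap0 σ a).
  rewrite (ocunit_pcomp hσ hσ') (ocunit_pcomp hθ hθ') fcomp_amap.
  rewrite (comp_by_fmap _ (def_comp_unit hσ hσ' (a := ↑a) isT)).
  have -> : ↑(vpaste_at (pmap1 σ) t1 (pmap1 θ') t1' (punit P a))
    = ↑(t1' (pmap1 σ (punit P a))) ∘ (pmap1 θ' <a> ↑(t1 (punit P a))).
    exact: (rE1 ↑(punit P a)).
  have -> : ↑(farr (punit S') (vpaste_at (pmap0 σ) t0 (pmap0 θ') t0' a))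
    = (punit S' <a> ↑(t0' (pmap0 σ a)))
      ∘ (punit S' <a> pmap0 θ' <a> ↑(t0 a)).
    rewrite -fmap_after -?(rE0 ↑a) //.
  rewrite -em; apply: (sq_eq_vpaste H K); rewrite em.
  + have := natE nt1' (f := ocunit σ ↑a) isT; rewrite !fcomp_amap.
    rewrite (osrc_ocunit hσ) // (otgt_ocunit hσ) //.
    by case: (m).
  + have := ocunit_nat hθ' (u := ↑(t0 a)) isT.
    by rewrite /= !(nat_src nt0) !(nat_tgt nt0).
Qed.

End Vertical.
End SquarePasting.

Section IdentitySquares.
Variable s : square_kind.
Variables (Y0 Y1 Z0 Z1 : category) (P : pseudocat Y0 Y1) (Q : pseudocat Z0 Z1).
Variable F : pmap Y0 Y1 Z0 Z1.

(** The comparison [f] occurs once on each side of the condition; everything else is an identity at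
    one of its ends, and the laxity decides which end. *)
Lemma sq_eq_hid (C : category) (f : option (arr C)) : isSome f ->
  sq_eq s (oid (sel (sq_v s) (otgt f) (osrc f))) (oid (sel (sq_v s) (osrc f) (otgt f)))
    (oid (sel (sq_v s) (otgt f) (osrc f))) f f (oid (sel (sq_v s) (osrc f) (otgt f))).
Proof.
by case: s => d /=; apply: (@peq_via _ f) => //;
  rewrite ?oid_idem ?oid_left ?oid_right // -oafterA oid_idem ?oid_left ?oid_right.
Qed.

Lemma sq_eq_vid (C : category) (f : option (arr C)) : isSome f ->
  sq_eq s (oid (sel (sq_h s) (otgt f) (osrc f))) (oid (sel (sq_h s) (osrc f) (otgt f)))
    f (oid (sel (sq_h s) (otgt f) (osrc f))) (oid (sel (sq_h s) (osrc f) (otgt f))) f.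
Proof.
by case: s => d /=; apply: (@peq_via _ f) => //;
  rewrite ?oid_idem ?oid_left ?oid_right // -oafterA oid_idem ?oid_left ?oid_right.
Qed.

Lemma square_eq_hid : has_laxity (sq_v s) P Q F ->
  square_eq s P Q (pident P) (pident Q) F F
    (fun x => id1 (pmap0 F x)) (fun x => id1 (pmap1 F x)).
Proof.
move=> hF; have oE x : omap (fun x => id1 (pmap1 F x)) x = oid (pmap1 F <o> x).
  by case: x.
apply/square_eqE; split=> [x y c|a].
- have d : isSome (↑x ⋆[P] ↑y) by apply/def_composable.
  rewrite !ocmul_pident fid_amap fmap_oid oE
    (oid_parr Q ↑(pmap1 F x) ↑(pmap1 F y) : ↑(id1 _) ⊛[Q] ↑(id1 _) = _).
  have dF : isSome (ocmul F ↑x ↑y) by apply/(def_ocmul (has_laxity_pmap hF)).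
  have := sq_eq_hid dF; rewrite (osrc_ocmul hF) // (otgt_ocmul hF) //.
  by case: (sq_v s).
- rewrite !ocunit_pident fid_amap fmap_oid -/(oid _).
  have := sq_eq_hid (f := ocunit F ↑a) isT.
  rewrite (osrc_ocunit hF) // (otgt_ocunit hF) // farr_id.
  by case: (sq_v s).
Qed.

Lemma square_eq_vid : has_laxity (sq_h s) P Q F ->
  square_eq s P Q F F (pident P) (pident Q)
    (fun x => id1 (pmap0 F x)) (fun x => id1 (pmap1 F x)).
Proof.
move=> hF; have oE x : omap (fun x => id1 (pmap1 F x)) x = oid (pmap1 F <o> x).
  by case: x.
apply/square_eqE; split=> [x y c|a].
- have d : isSome (↑x ⋆[P] ↑y) by apply/def_composable.
  rewrite !ocmul_pident fid_amap fmap_oid oE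
    (oid_parr Q ↑(pmap1 F x) ↑(pmap1 F y) : ↑(id1 _) ⊛[Q] ↑(id1 _) = _).
  have dF : isSome (ocmul F ↑x ↑y) by apply/(def_ocmul (has_laxity_pmap hF)).
  have := sq_eq_vid dF; rewrite (osrc_ocmul hF) // (otgt_ocmul hF) //.
  by case: (sq_h s).
- rewrite !ocunit_pident fid_amap fmap_oid -/(oid _).
  have := sq_eq_vid (f := ocunit F ↑a) isT.
  rewrite (osrc_ocunit hF) // (otgt_ocunit hF) // farr_id.
  by case: (sq_h s).
Qed.

End IdentitySquares.

(** * Composition of double cells *)

Lemma row_h c : sq_h (hsquare c) = hlaxity (hkind c). Proof. by case: c. Qed.
Lemma row_v c : sq_v (hsquare c) = hlaxity (vkind c). Proof. by case: c. Qed.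
Lemma col_h c : sq_h (vsquare c) = vlaxity (hkind c). Proof. by case: c. Qed.
Lemma col_v c : sq_v (vsquare c) = vlaxity (vkind c). Proof. by case: c. Qed.

Section PastingBoundaries.
Variables (Y0 Y1 V0 V1 : category) (d : functor Y1 Y0) (dV : functor V1 V0).
Variables (t0 : ob Y0 -> arr V0) (t1 : ob Y1 -> arr V1).
Hypothesis dt : forall x, farr dV (t1 x) = t0 (d x).
Variables (V0' V1' : category) (dV' : functor V1' V0').
Variables (G0 : functor V0 V0') (G1 : functor V1 V1').
Hypothesis dG : fcomp G0 dV = fcomp dV' G1.
Variables (Z0 Z1 : category) (dZ : functor Z1 Z0).
Variables (F0 : functor Y0 Z0) (F1 : functor Y1 Z1).
Hypothesis dF : fcomp F0 d = fcomp dZ F1.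
Variables (t0' : ob Z0 -> arr V0') (t1' : ob Z1 -> arr V1').
Hypothesis dt' : forall x, farr dV' (t1' x) = t0' (dZ x).

Lemma hpaste_at_boundary x :
  (forall x, src (farr G1 (t1 x)) = tgt (t1' (F1 x))) ->
  (forall x, src (farr G0 (t0 x)) = tgt (t0' (F0 x))) ->
  farr dV' (hpaste_at F1 t1 G1 t1' x) = hpaste_at F0 t0 G0 t0' (d x).
Proof.
move=> e1 e0; apply: Some_inj.
have E1 : ↑(hpaste_at F1 t1 G1 t1' x) = ↑(farr G1 (t1 x)) ∘ ↑(t1' (F1 x)).
  exact: tcompE.
have -> : ↑(hpaste_at F0 t0 G0 t0' (d x))
    = ↑(farr G0 (t0 (d x))) ∘ ↑(t0' (F0 (d x))) by exact: tcompE.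
have -> : ↑(farr dV' (hpaste_at F1 t1 G1 t1' x))
    = dV' <a> ↑(hpaste_at F1 t1 G1 t1' x) by [].
rewrite E1 fmap_after -?E1 //=; congr (↑_ ∘ ↑_).
- by rewrite -dt; exact: (congr1 (fun K => farr K (t1 x)) (esym dG)).
- by rewrite dt'; congr t0'; exact: (congr1 (fun K => fob K x) (esym dF)).
Qed.

Lemma vpaste_at_boundary x :
  (forall x, src (t1' (F1 x)) = tgt (farr G1 (t1 x))) ->
  (forall x, src (t0' (F0 x)) = tgt (farr G0 (t0 x))) ->
  farr dV' (vpaste_at F1 t1 G1 t1' x) = vpaste_at F0 t0 G0 t0' (d x).
Proof.
move=> e1 e0; apply: Some_inj.
have E1 : ↑(vpaste_at F1 t1 G1 t1' x) = ↑(t1' (F1 x)) ∘ ↑(farr G1 (t1 x)).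
  exact: tcompE.
have -> : ↑(vpaste_at F0 t0 G0 t0' (d x))
    = ↑(t0' (F0 (d x))) ∘ ↑(farr G0 (t0 (d x))) by exact: tcompE.
have -> : ↑(farr dV' (vpaste_at F1 t1 G1 t1' x))
    = dV' <a> ↑(vpaste_at F1 t1 G1 t1' x) by [].
rewrite E1 fmap_after -?E1 //=; congr (↑_ ∘ ↑_).
- by rewrite dt'; congr t0'; exact: (congr1 (fun K => fob K x) (esym dF)).
- by rewrite -dt; exact: (congr1 (fun K => farr K (t1 x)) (esym dG)).
Qed.

End PastingBoundaries.

Definition hpaste_trans (A B D D' : intercat) (Φ : inter_map A B)
    (Ψ' : inter_map D D') (π : inter_trans A D) (π' : inter_trans B D') :=
  InterTrans
    (hpaste_at (onA0 Φ) (tA0 π) (onA0 Ψ') (tA0 π'))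
    (hpaste_at (onA1 Φ) (tA1 π) (onA1 Ψ') (tA1 π'))
    (hpaste_at (onB0 Φ) (tB0 π) (onB0 Ψ') (tB0 π'))
    (hpaste_at (onB1 Φ) (tB1 π) (onB1 Ψ') (tB1 π')).

Definition vpaste_trans (A C D D' : intercat) (Σ : inter_map A C)
    (Θ' : inter_map D D') (π : inter_trans A D) (π' : inter_trans C D') :=
  InterTrans
    (vpaste_at (onA0 Σ) (tA0 π) (onA0 Θ') (tA0 π'))
    (vpaste_at (onA1 Σ) (tA1 π) (onA1 Θ') (tA1 π'))
    (vpaste_at (onB0 Σ) (tB0 π) (onB0 Θ') (tB0 π'))
    (vpaste_at (onB1 Σ) (tB1 π) (onB1 Θ') (tB1 π')).

Definition ident_trans (A C : intercat) (Σ : inter_map A C) :=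
  InterTrans (fun x => id1 (onA0 Σ x)) (fun x => id1 (onA1 Σ x))
    (fun x => id1 (onB0 Σ x)) (fun x => id1 (onB1 Σ x)).

Section CellComposites.
Variables (c : cell_kind) (A B C D : intercat).
Variables (Φ : morphism (hkind c) A B) (Ψ : morphism (hkind c) C D).
Variables (Σ : morphism (vkind c) A C) (Θ : morphism (vkind c) B D).
Variable π : cell Φ Ψ Σ Θ.
Let a := cell_ax π.
Let mΦ := mor_ax Φ.
Let mΨ := mor_ax Ψ.
Let mΣ := mor_ax Σ.
Let mΘ := mor_ax Θ.

Section Horizontal.
Variables (B' D' : intercat).
Variables (Φ' : morphism (hkind c) B B') (Ψ' : morphism (hkind c) D D').
Variable (Θ' : morphism (vkind c) B' D').
Variable π' : cell Φ' Ψ' Θ Θ'.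
Let a' := cell_ax π'.
Let mΦ' := mor_ax Φ'.
Let mΨ' := mor_ax Ψ'.

Lemma hpaste_axioms :
  cell_axioms (mcomp Φ' Φ) (mcomp Ψ' Ψ) Σ Θ' (hpaste_trans Φ Ψ' π π').
Proof.
have eA0 x : src (farr (onA0 Ψ') (tA0 π x)) = tgt (tA0 π' (onA0 Φ x)).
  by rewrite farr_src (nat_src (cell_A0 a)) (nat_tgt (cell_A0 a')).
have eA1 x : src (farr (onA1 Ψ') (tA1 π x)) = tgt (tA1 π' (onA1 Φ x)).
  by rewrite farr_src (nat_src (cell_A1 a)) (nat_tgt (cell_A1 a')).
have eB0 x : src (farr (onB0 Ψ') (tB0 π x)) = tgt (tB0 π' (onB0 Φ x)).
  by rewrite farr_src (nat_src (cell_B0 a)) (nat_tgt (cell_B0 a')).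
have eB1 x : src (farr (onB1 Ψ') (tB1 π x)) = tgt (tB1 π' (onB1 Φ x)).
  by rewrite farr_src (nat_src (cell_B1 a)) (nat_tgt (cell_B1 a')).
split.
- exact: (hpaste_at_natural (cell_A0 a) (cell_A0 a')).
- exact: (hpaste_at_natural (cell_A1 a) (cell_A1 a')).
- exact: (hpaste_at_natural (cell_B0 a) (cell_B0 a')).
- exact: (hpaste_at_natural (cell_B1 a) (cell_B1 a')).
- move=> x; exact: (hpaste_at_boundary (cell_d0 a)
    (pmap_d0 (has_laxity_pmap (mor_row0 mΨ')))
    (pmap_d0 (has_laxity_pmap (mor_row0 mΦ))) (cell_d0 a') x eB0 eA0).
- move=> x; exact: (hpaste_at_boundary (cell_d1 a)
    (pmap_d1 (has_laxity_pmap (mor_row0 mΨ')))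
    (pmap_d1 (has_laxity_pmap (mor_row0 mΦ))) (cell_d1 a') x eB0 eA0).
- move=> x; exact: (hpaste_at_boundary (cell_d0' a)
    (pmap_d0 (has_laxity_pmap (mor_row1 mΨ')))
    (pmap_d0 (has_laxity_pmap (mor_row1 mΦ))) (cell_d0' a') x eB1 eA1).
- move=> x; exact: (hpaste_at_boundary (cell_d1' a)
    (pmap_d1 (has_laxity_pmap (mor_row1 mΨ')))
    (pmap_d1 (has_laxity_pmap (mor_row1 mΦ))) (cell_d1' a') x eB1 eA1).
- move=> x; exact: (hpaste_at_boundary (cell_D0 a)
    (pmap_d0 (has_laxity_pmap (mor_colA mΨ')))
    (pmap_d0 (has_laxity_pmap (mor_colA mΦ))) (cell_D0 a') x eA1 eA0).
- move=> x; exact: (hpaste_at_boundary (cell_D1 a)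
    (pmap_d1 (has_laxity_pmap (mor_colA mΨ')))
    (pmap_d1 (has_laxity_pmap (mor_colA mΦ))) (cell_D1 a') x eA1 eA0).
- move=> x; exact: (hpaste_at_boundary (cell_D0' a)
    (pmap_d0 (has_laxity_pmap (mor_colB mΨ')))
    (pmap_d0 (has_laxity_pmap (mor_colB mΦ))) (cell_D0' a') x eB1 eB0).
- move=> x; exact: (hpaste_at_boundary (cell_D1' a)
    (pmap_d1 (has_laxity_pmap (mor_colB mΨ')))
    (pmap_d1 (has_laxity_pmap (mor_colB mΦ))) (cell_D1' a') x eB1 eB0).
- exact: (square_eq_hpaste (σ := map_row0 Σ) (θ := map_row0 Θ)
    (θ' := map_row0 Θ') (row_h c) (mor_row0 mΦ) (mor_row0 mΨ)
    (cell_A0 a) (cell_B0 a) (cell_row0 a)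
    (mor_row0 mΦ') (mor_row0 mΨ')
    (cell_A0 a') (cell_B0 a') (cell_row0 a')).
- exact: (square_eq_hpaste (σ := map_row1 Σ) (θ := map_row1 Θ)
    (θ' := map_row1 Θ') (row_h c) (mor_row1 mΦ) (mor_row1 mΨ)
    (cell_A1 a) (cell_B1 a) (cell_row1 a)
    (mor_row1 mΦ') (mor_row1 mΨ')
    (cell_A1 a') (cell_B1 a') (cell_row1 a')).
- exact: (square_eq_hpaste (σ := map_colA Σ) (θ := map_colA Θ)
    (θ' := map_colA Θ') (col_h c) (mor_colA mΦ) (mor_colA mΨ)
    (cell_A0 a) (cell_A1 a) (cell_colA a)
    (mor_colA mΦ') (mor_colA mΨ')
    (cell_A0 a') (cell_A1 a') (cell_colA a')).
- exact: (square_eq_hpaste (σ := map_colB Σ) (θ := map_colB Θ)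
    (θ' := map_colB Θ') (col_h c) (mor_colB mΦ) (mor_colB mΨ)
    (cell_B0 a) (cell_B1 a) (cell_colB a)
    (mor_colB mΦ') (mor_colB mΨ')
    (cell_B0 a') (cell_B1 a') (cell_colB a')).
Qed.

Definition hpaste := Cell hpaste_axioms.

End Horizontal.
Section Vertical.
Variables (C' D' : intercat).
Variables (Σ' : morphism (vkind c) C C') (Θ' : morphism (vkind c) D D').
Variable (Ψ' : morphism (hkind c) C' D').
Variable π' : cell Ψ Ψ' Σ' Θ'.
Let a' := cell_ax π'.
Let mΣ' := mor_ax Σ'.
Let mΘ' := mor_ax Θ'.

Lemma vpaste_axioms :
  cell_axioms Φ Ψ' (mcomp Σ' Σ) (mcomp Θ' Θ) (vpaste_trans Σ Θ' π π').
Proof.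
have eA0 x : src (tA0 π' (onA0 Σ x)) = tgt (farr (onA0 Θ') (tA0 π x)).
  by rewrite farr_tgt (nat_src (cell_A0 a')) (nat_tgt (cell_A0 a)).
have eA1 x : src (tA1 π' (onA1 Σ x)) = tgt (farr (onA1 Θ') (tA1 π x)).
  by rewrite farr_tgt (nat_src (cell_A1 a')) (nat_tgt (cell_A1 a)).
have eB0 x : src (tB0 π' (onB0 Σ x)) = tgt (farr (onB0 Θ') (tB0 π x)).
  by rewrite farr_tgt (nat_src (cell_B0 a')) (nat_tgt (cell_B0 a)).
have eB1 x : src (tB1 π' (onB1 Σ x)) = tgt (farr (onB1 Θ') (tB1 π x)).
  by rewrite farr_tgt (nat_src (cell_B1 a')) (nat_tgt (cell_B1 a)).
split.
- exact: (vpaste_at_natural (cell_A0 a) (cell_A0 a')).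
- exact: (vpaste_at_natural (cell_A1 a) (cell_A1 a')).
- exact: (vpaste_at_natural (cell_B0 a) (cell_B0 a')).
- exact: (vpaste_at_natural (cell_B1 a) (cell_B1 a')).
- move=> x; exact: (vpaste_at_boundary (cell_d0 a)
    (pmap_d0 (has_laxity_pmap (mor_row0 mΘ')))
    (pmap_d0 (has_laxity_pmap (mor_row0 mΣ))) (cell_d0 a') x eB0 eA0).
- move=> x; exact: (vpaste_at_boundary (cell_d1 a)
    (pmap_d1 (has_laxity_pmap (mor_row0 mΘ')))
    (pmap_d1 (has_laxity_pmap (mor_row0 mΣ))) (cell_d1 a') x eB0 eA0).
- move=> x; exact: (vpaste_at_boundary (cell_d0' a)
    (pmap_d0 (has_laxity_pmap (mor_row1 mΘ')))
    (pmap_d0 (has_laxity_pmap (mor_row1 mΣ))) (cell_d0' a') x eB1 eA1).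
- move=> x; exact: (vpaste_at_boundary (cell_d1' a)
    (pmap_d1 (has_laxity_pmap (mor_row1 mΘ')))
    (pmap_d1 (has_laxity_pmap (mor_row1 mΣ))) (cell_d1' a') x eB1 eA1).
- move=> x; exact: (vpaste_at_boundary (cell_D0 a)
    (pmap_d0 (has_laxity_pmap (mor_colA mΘ')))
    (pmap_d0 (has_laxity_pmap (mor_colA mΣ))) (cell_D0 a') x eA1 eA0).
- move=> x; exact: (vpaste_at_boundary (cell_D1 a)
    (pmap_d1 (has_laxity_pmap (mor_colA mΘ')))
    (pmap_d1 (has_laxity_pmap (mor_colA mΣ))) (cell_D1 a') x eA1 eA0).
- move=> x; exact: (vpaste_at_boundary (cell_D0' a)
    (pmap_d0 (has_laxity_pmap (mor_colB mΘ')))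
    (pmap_d0 (has_laxity_pmap (mor_colB mΣ))) (cell_D0' a') x eB1 eB0).
- move=> x; exact: (vpaste_at_boundary (cell_D1' a)
    (pmap_d1 (has_laxity_pmap (mor_colB mΘ')))
    (pmap_d1 (has_laxity_pmap (mor_colB mΣ))) (cell_D1' a') x eB1 eB0).
- exact: (square_eq_vpaste (φ := map_row0 Φ) (ψ := map_row0 Ψ)
    (ψ' := map_row0 Ψ') (row_v c) (mor_row0 mΣ) (mor_row0 mΘ)
    (cell_A0 a) (cell_B0 a) (cell_row0 a) (mor_row0 mΣ') (mor_row0 mΘ')
    (cell_A0 a') (cell_B0 a') (cell_row0 a')).
- exact: (square_eq_vpaste (φ := map_row1 Φ) (ψ := map_row1 Ψ)
    (ψ' := map_row1 Ψ') (row_v c) (mor_row1 mΣ) (mor_row1 mΘ)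
    (cell_A1 a) (cell_B1 a) (cell_row1 a) (mor_row1 mΣ') (mor_row1 mΘ')
    (cell_A1 a') (cell_B1 a') (cell_row1 a')).
- exact: (square_eq_vpaste (φ := map_colA Φ) (ψ := map_colA Ψ)
    (ψ' := map_colA Ψ') (col_v c) (mor_colA mΣ) (mor_colA mΘ)
    (cell_A0 a) (cell_A1 a) (cell_colA a) (mor_colA mΣ') (mor_colA mΘ')
    (cell_A0 a') (cell_A1 a') (cell_colA a')).
- exact: (square_eq_vpaste (φ := map_colB Φ) (ψ := map_colB Ψ)
    (ψ' := map_colB Ψ') (col_v c) (mor_colB mΣ) (mor_colB mΘ)
    (cell_B0 a) (cell_B1 a) (cell_colB a) (mor_colB mΣ') (mor_colB mΘ')
    (cell_B0 a') (cell_B1 a') (cell_colB a')).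
Qed.

Definition vpaste := Cell vpaste_axioms.

End Vertical.
End CellComposites.

(** The equation [F = G] is left open because composing with an identity functor before or after
    gives functors that are equal but not convertible. *)
Lemma ident_natural (Y V : category) (F G : functor Y V) :
  F = G -> natural F G (fun x => id1 (F x)).
Proof.
move=> <-; apply: naturalI => [x|x|f].
- exact: (osrc_oid ↑(F x)).
- exact: (otgt_oid ↑(F x)).
- have e x : omap (fun x => id1 (F x)) x = oid (F <o> x) by case: x.
  apply: (@peq_via _ (F <a> ↑f)) => //; rewrite e.
  + by apply: oid_right_eq; rewrite osrc_fmap.
  + by apply: oid_left_eq; rewrite otgt_fmap.
Qed.

Lemma ident_boundary (Y0 Y1 V0 V1 : category) (d : functor Y1 Y0)
    (dV : functor V1 V0) (F0 : functor Y0 V0) (F1 : functor Y1 V1) x :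
  fcomp F0 d = fcomp dV F1 -> farr dV (id1 (F1 x)) = id1 (F0 (d x)).
Proof.
by move=> e; rewrite farr_id; congr id1; rewrite -[LHS]/(fcomp dV F1 x) -e.
Qed.

Section IdentityCells.
Variables (c : cell_kind) (A C : intercat).

Section Horizontal.
Variable Σ : morphism (vkind c) A C.
Let mΣ := mor_ax Σ.

Lemma hident_axioms :
  cell_axioms (mident (hkind c) A) (mident (hkind c) C) Σ Σ (ident_trans Σ).
Proof.
split; try (by apply: (@ident_natural _ _ (fcomp _ _)); rewrite fcomp_idr fcomp_idl).
- move=> x.
  exact: (ident_boundary x (pmap_d0 (has_laxity_pmap (mor_row0 mΣ)))).
- move=> x.
  exact: (ident_boundary x (pmap_d1 (has_laxity_pmap (mor_row0 mΣ)))).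
- move=> x.
  exact: (ident_boundary x (pmap_d0 (has_laxity_pmap (mor_row1 mΣ)))).
- move=> x.
  exact: (ident_boundary x (pmap_d1 (has_laxity_pmap (mor_row1 mΣ)))).
- move=> x.
  exact: (ident_boundary x (pmap_d0 (has_laxity_pmap (mor_colA mΣ)))).
- move=> x.
  exact: (ident_boundary x (pmap_d1 (has_laxity_pmap (mor_colA mΣ)))).
- move=> x.
  exact: (ident_boundary x (pmap_d0 (has_laxity_pmap (mor_colB mΣ)))).
- move=> x.
  exact: (ident_boundary x (pmap_d1 (has_laxity_pmap (mor_colB mΣ)))).
- by have := mor_row0 mΣ; rewrite -row_v => h; exact: (square_eq_hid h).
- by have := mor_row1 mΣ; rewrite -row_v => h; exact: (square_eq_hid h).
- by have := mor_colA mΣ; rewrite -col_v => h; exact: (square_eq_hid h).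
- by have := mor_colB mΣ; rewrite -col_v => h; exact: (square_eq_hid h).
Qed.

Definition hident := Cell hident_axioms.

End Horizontal.

Section Vertical.
Variable Φ : morphism (hkind c) A C.
Let mΦ := mor_ax Φ.

Lemma vident_axioms :
  cell_axioms Φ Φ (mident (vkind c) A) (mident (vkind c) C) (ident_trans Φ).
Proof.
split; try (by apply: (@ident_natural _ _ (fcomp _ _)); rewrite fcomp_idr fcomp_idl).
- move=> x.
  exact: (ident_boundary x (pmap_d0 (has_laxity_pmap (mor_row0 mΦ)))).
- move=> x.
  exact: (ident_boundary x (pmap_d1 (has_laxity_pmap (mor_row0 mΦ)))).
- move=> x.
  exact: (ident_boundary x (pmap_d0 (has_laxity_pmap (mor_row1 mΦ)))).
- move=> x.
  exact: (ident_boundary x (pmap_d1 (has_laxity_pmap (mor_row1 mΦ)))).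
- move=> x.
  exact: (ident_boundary x (pmap_d0 (has_laxity_pmap (mor_colA mΦ)))).
- move=> x.
  exact: (ident_boundary x (pmap_d1 (has_laxity_pmap (mor_colA mΦ)))).
- move=> x.
  exact: (ident_boundary x (pmap_d0 (has_laxity_pmap (mor_colB mΦ)))).
- move=> x.
  exact: (ident_boundary x (pmap_d1 (has_laxity_pmap (mor_colB mΦ)))).
- by have := mor_row0 mΦ; rewrite -row_h => h; exact: (square_eq_vid h).
- by have := mor_row1 mΦ; rewrite -row_h => h; exact: (square_eq_vid h).
- by have := mor_colA mΦ; rewrite -col_h => h; exact: (square_eq_vid h).
- by have := mor_colB mΦ; rewrite -col_h => h; exact: (square_eq_vid h).
Qed.

Definition vident := Cell vident_axioms.

End Vertical.
End IdentityCells.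

(** * Unit, associativity and interchange laws for components *)

Section PastingLaws.
Variables (Y Z W V : category).
Variables (F : functor Y Z) (G : functor W V) (S : functor Y W) (T : functor Z V).
Variable t : ob Y -> arr V.
Hypothesis nt : natural (fcomp T F) (fcomp G S) t.

Lemma hpaste_at_idl : hpaste_at (fid Y) (fun x => id1 (S x)) G t = t.
Proof.
apply: functional_extensionality => x; apply: Some_inj.
rewrite tcompE; last by rewrite /= farr_id src_id1 (nat_tgt nt).
rewrite farr_id; apply: (oid_left_eq (x := ↑(G (S x)))).
by rewrite /= (nat_tgt nt).
Qed.

Lemma hpaste_at_idr : hpaste_at F t (fid V) (fun x => id1 (T x)) = t.
Proof.
apply: functional_extensionality => x; apply: Some_inj.
rewrite tcompE; last by rewrite /= tgt_id1 (nat_src nt).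
apply: (oid_right_eq (x := ↑(T (F x)))).
by rewrite /= (nat_src nt).
Qed.

Lemma vpaste_at_idl : vpaste_at (fid Y) (fun x => id1 (F x)) T t = t.
Proof.
apply: functional_extensionality => x; apply: Some_inj.
rewrite tcompE; last by rewrite /= farr_id tgt_id1 (nat_src nt).
rewrite farr_id; apply: (oid_right_eq (x := ↑(T (F x)))).
by rewrite /= (nat_src nt).
Qed.

Lemma vpaste_at_idr : vpaste_at S t (fid V) (fun x => id1 (G x)) = t.
Proof.
apply: functional_extensionality => x; apply: Some_inj.
rewrite tcompE; last by rewrite /= src_id1 (nat_tgt nt).
apply: (oid_left_eq (x := ↑(G (S x)))).
by rewrite /= (nat_tgt nt).
Qed.

Section Horizontal.
Variables (Z' V' : category).
Variables (F' : functor Z Z') (G' : functor V V') (T' : functor Z' V').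
Variable t' : ob Z -> arr V'.
Hypothesis nt' : natural (fcomp T' F') (fcomp G' T) t'.

Lemma hpaste_atA (Z'' V'' : category) (F'' : functor Z' Z'')
    (G'' : functor V' V'') (T'' : functor Z'' V'') (t'' : ob Z' -> arr V'') :
  natural (fcomp T'' F'') (fcomp G'' T') t'' ->
  hpaste_at (fcomp F' F) (hpaste_at F t G' t') G'' t''
  = hpaste_at F t (fcomp G'' G') (hpaste_at F' t' G'' t'').
Proof.
move=> nt''; have n1 := hpaste_at_natural nt nt'.
have n2 := hpaste_at_natural nt' nt''.
apply: functional_extensionality => x; apply: Some_inj.
rewrite -[LHS]/(omap _ ↑x) -[RHS]/(omap _ ↑x).
rewrite (hpaste_atE n1 nt'') (hpaste_atE nt n2) (hpaste_atE nt nt').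
rewrite fmap_after; last by rewrite -(hpaste_atE nt nt').
by rewrite (hpaste_atE nt' nt'') oafterA fcomp_amap fcomp_omap.
Qed.

Section Interchange.
Variables (W1 V1 V1' : category).
Variables (S1 : functor W W1) (G1 : functor W1 V1) (T1 : functor V V1).
Variables (T1' : functor V' V1') (G1' : functor V1 V1').
Variables (t1 : ob W -> arr V1) (t1' : ob V -> arr V1').
Hypothesis nt1 : natural (fcomp T1 G) (fcomp G1 S1) t1.
Hypothesis nt1' : natural (fcomp T1' G') (fcomp G1' T1) t1'.

Lemma paste_at_interchange :
  vpaste_at S (hpaste_at F t G' t') T1' (hpaste_at G t1 G1' t1')
  = hpaste_at F (vpaste_at S t T1 t1) G1' (vpaste_at T t' T1' t1').
Proof.
apply: functional_extensionality => x; apply: Some_inj.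
rewrite -[LHS]/(omap _ ↑x) -[RHS]/(omap _ ↑x).
have n1 := hpaste_at_natural nt nt'; have n2 := hpaste_at_natural nt1 nt1'.
have m1 := vpaste_at_natural nt nt1; have m2 := vpaste_at_natural nt' nt1'.
rewrite (vpaste_atE n1 n2) (hpaste_atE m1 m2).
rewrite (hpaste_atE nt nt') (hpaste_atE nt1 nt1').
rewrite (vpaste_atE nt nt1) (vpaste_atE nt' nt1').
rewrite fmap_after; last by rewrite -(hpaste_atE nt nt').
rewrite fmap_after; last by rewrite -(vpaste_atE nt nt1).
(* Both pastings contain the same four factors except for the order of two; naturality of the last
   cell [t1'] at the component of the first cell [t] exchanges them. *)
have N := natE nt1' (f := omap t ↑x) isT.
rewrite (osrc_nat nt) (otgt_nat nt) !fcomp_amap !fcomp_omap in N.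
by rwl N.
Qed.


End Interchange.
End Horizontal.

Section Vertical.
Variables (W' V' : category).
Variables (S' : functor W W') (G' : functor W' V') (T' : functor V V').
Variable t' : ob W -> arr V'.
Hypothesis nt' : natural (fcomp T' G) (fcomp G' S') t'.

Lemma vpaste_atA (W'' V'' : category) (S'' : functor W' W'')
    (G'' : functor W'' V'') (T'' : functor V' V'') (t'' : ob W' -> arr V'') :
  natural (fcomp T'' G') (fcomp G'' S'') t'' ->
  vpaste_at (fcomp S' S) (vpaste_at S t T' t') T'' t''
  = vpaste_at S t (fcomp T'' T') (vpaste_at S' t' T'' t'').
Proof.
move=> nt''; have n1 := vpaste_at_natural nt nt'.
have n2 := vpaste_at_natural nt' nt''.
apply: functional_extensionality => x; apply: Some_inj.
rewrite -[LHS]/(omap _ ↑x) -[RHS]/(omap _ ↑x).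
rewrite (vpaste_atE n1 nt'') (vpaste_atE nt n2) (vpaste_atE nt nt').
rewrite fmap_after; last by rewrite -(vpaste_atE nt nt').
by rewrite (vpaste_atE nt' nt'') oafterA fcomp_amap fcomp_omap.
Qed.

End Vertical.
End PastingLaws.

(** * The double categories of cells *)

Section DCellEquality.
Variables (c : cell_kind) (A B C D : intercat).
Variables (Φ1 Φ2 : morphism (hkind c) A B) (Ψ1 Ψ2 : morphism (hkind c) C D).
Variables (Σ1 Σ2 : morphism (vkind c) A C) (Θ1 Θ2 : morphism (vkind c) B D).
Variables (π1 : cell Φ1 Ψ1 Σ1 Θ1) (π2 : cell Φ2 Ψ2 Σ2 Θ2).

(** The type of [cell_trans] mentions only the corners [A] and [D], so components can be compared
    before the boundary morphisms have been identified. *)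
Lemma dcell_eq : Φ1 = Φ2 -> Ψ1 = Ψ2 -> Σ1 = Σ2 -> Θ1 = Θ2 ->
  cell_trans π1 = cell_trans π2 -> DCell π1 = DCell π2.
Proof.
move=> eΦ eΨ eΣ eΘ; subst Φ2 Ψ2 Σ2 Θ2.
case: π1 π2 => [t a] [t' a'] /= e; subst t'.
by rewrite (proof_irrelevance _ a a').
Qed.

Lemma dcell_inj : DCell π1 = DCell π2 ->
  [/\ Φ1 = Φ2, Ψ1 = Ψ2, Σ1 = Σ2, Θ1 = Θ2 & cell_trans π1 = cell_trans π2].
Proof.
pose pack (x : dcell c) :
    {AD : intercat * intercat & inter_trans AD.1 AD.2} :=
  existT _ (dcell_A x, dcell_D x) (cell_trans (dcell_cell x)).
move=> e; split.
- exact: mor_inj (congr1 (dom (dcell_vgraph c)) e).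
- exact: mor_inj (congr1 (cod (dcell_vgraph c)) e).
- exact: mor_inj (congr1 (dom (dcell_hgraph c)) e).
- exact: mor_inj (congr1 (cod (dcell_hgraph c)) e).
- exact: (existT_inj (congr1 pack e)).
Qed.

End DCellEquality.

Lemma cell_eq c (A B C D : intercat)
    (Φ : morphism (hkind c) A B) (Ψ : morphism (hkind c) C D)
    (Σ : morphism (vkind c) A C) (Θ : morphism (vkind c) B D)
    (π1 π2 : cell Φ Ψ Σ Θ) : cell_trans π1 = cell_trans π2 -> π1 = π2.
Proof.
case: π1 π2 => [t a] [t' a'] /= e; subst t'.
by rewrite (proof_irrelevance _ a a').
Qed.

Ltac mor_subst e :=
  let d := fresh in let r := fresh in
  have d := congr1 (@mor_dom _) e; have r := congr1 (@mor_cod _) e;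
  simpl in d, r; subst; move/mor_inj: e => e; subst.

Section DCellCategories.
Variable c : cell_kind.

Inductive hcomp : dcell c -> dcell c -> dcell c -> Prop :=
  HComp (A B C D B' D' : intercat)
    (Φ : morphism (hkind c) A B) (Ψ : morphism (hkind c) C D)
    (Φ' : morphism (hkind c) B B') (Ψ' : morphism (hkind c) D D')
    (Σ : morphism (vkind c) A C) (Θ : morphism (vkind c) B D)
    (Θ' : morphism (vkind c) B' D')
    (π : cell Φ Ψ Σ Θ) (π' : cell Φ' Ψ' Θ Θ') :
    hcomp (DCell π') (DCell π) (DCell (hpaste π π')).

Inductive vcomp : dcell c -> dcell c -> dcell c -> Prop :=
  VComp (A B C D C' D' : intercat)
    (Φ : morphism (hkind c) A B) (Ψ : morphism (hkind c) C D)
    (Ψ' : morphism (hkind c) C' D')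
    (Σ : morphism (vkind c) A C) (Θ : morphism (vkind c) B D)
    (Σ' : morphism (vkind c) C C') (Θ' : morphism (vkind c) D D')
    (π : cell Φ Ψ Σ Θ) (π' : cell Ψ Ψ' Σ' Θ') :
    vcomp (DCell π') (DCell π) (DCell (vpaste π π')).

Definition hid (m : mor (vkind c)) : dcell c := DCell (hident (mor_mor m)).
Definition vid (m : mor (hkind c)) : dcell c := DCell (vident (mor_mor m)).

Lemma hcomp_functional y x z z' : hcomp y x z -> hcomp y x z' -> z = z'.
Proof.
case=> A B C D B' D' Φ Ψ Φ' Ψ' Σ Θ Θ' π π' r.
move: (erefl (DCell π')) (erefl (DCell π)) r.
move: {1 3}(DCell π') {1 3}(DCell π) => g f eg ef r.
case: r eg ef => A1 B1 C1 D1 B1' D1' Φ1 Ψ1 Φ1' Ψ1' Σ1 Θ1 Θ1' π1 π1' eg ef.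
have eA := congr1 (@dcell_A c) ef; have eB := congr1 (@dcell_B c) ef.
have eC := congr1 (@dcell_C c) ef; have eD := congr1 (@dcell_D c) ef.
have eB' := congr1 (@dcell_B c) eg; have eD' := congr1 (@dcell_D c) eg.
simpl in *; subst A1 B1 C1 D1 B1' D1'.
have [? ? ? ? e] := dcell_inj eg; have [? ? ? ? e'] := dcell_inj ef.
subst; apply: dcell_eq => //=.
by rewrite e e'.
Qed.

Lemma hcomp_laws : category_laws (dcell_hgraph c) hid hcomp.
Proof.
split.
- by case.
- by case.
- by move=> g f h [].
- move=> [B1 B' D1 D' Φ' Ψ' Θ1 Θ' π'] [A B C D Φ Ψ Σ Θ π] /= e.
  mor_subst e; eexists; exact: HComp.
- exact: hcomp_functional.
- by move=> g f h [].
- by move=> g f h [].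
(* The constructor gives some composite with the identity cell; it remains to recognise this
   composite as [π], among packed cells, where its boundary may be rewritten. *)
- move=> [A B C D Φ Ψ Σ Θ π] /=; have := HComp π (hident Θ).
  congr hcomp; apply: dcell_eq; rewrite ?mcomp_idl //.
  have a := cell_ax π; rewrite /= /hpaste_trans.
  rewrite (hpaste_at_idr (cell_A0 a)) (hpaste_at_idr (cell_A1 a)).
  rewrite (hpaste_at_idr (cell_B0 a)) (hpaste_at_idr (cell_B1 a)).
  by case: (cell_trans π).
- move=> [A B C D Φ Ψ Σ Θ π] /=; have := HComp (hident Σ) π.
  congr hcomp; apply: dcell_eq; rewrite ?mcomp_idr //.
  have a := cell_ax π; rewrite /= /hpaste_trans.
  rewrite (hpaste_at_idl (cell_A0 a)) (hpaste_at_idl (cell_A1 a)).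
  rewrite (hpaste_at_idl (cell_B0 a)) (hpaste_at_idl (cell_B1 a)).
  by case: (cell_trans π).
- move=> [B2 B'' D2 D'' Φ'' Ψ'' Θ2 Θ'' π''] [B1 B' D1 D' Φ' Ψ' Θ1 Θ' π'].
  move=> [A B C D Φ Ψ Σ Θ π] /= e e'; mor_subst e; mor_subst e'.
  exists (DCell (hpaste π π')), (DCell (hpaste π' π'')).
  exists (DCell (hpaste (hpaste π π') π'')); split; try exact: HComp.
  have := HComp π (hpaste π' π'').
  congr hcomp; apply: dcell_eq; rewrite ?mcompA //.
  have a := cell_ax π; have a' := cell_ax π'; have a'' := cell_ax π''.
  rewrite /= /hpaste_trans /=; congr InterTrans; symmetry.
  + exact: (hpaste_atA (cell_A0 a) (cell_A0 a') (cell_A0 a'')).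
  + exact: (hpaste_atA (cell_A1 a) (cell_A1 a') (cell_A1 a'')).
  + exact: (hpaste_atA (cell_B0 a) (cell_B0 a') (cell_B0 a'')).
  + exact: (hpaste_atA (cell_B1 a) (cell_B1 a') (cell_B1 a'')).
Qed.

Lemma vcomp_functional y x z z' : vcomp y x z -> vcomp y x z' -> z = z'.
Proof.
case=> A B C D C' D' Φ Ψ Ψ' Σ Θ Σ' Θ' π π' r.
move: (erefl (DCell π')) (erefl (DCell π)) r.
move: {1 3}(DCell π') {1 3}(DCell π) => g f eg ef r.
case: r eg ef => A1 B1 C1 D1 C1' D1' Φ1 Ψ1 Ψ1' Σ1 Θ1 Σ1' Θ1' π1 π1' eg ef.
have eA := congr1 (@dcell_A c) ef; have eB := congr1 (@dcell_B c) ef.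
have eC := congr1 (@dcell_C c) ef; have eD := congr1 (@dcell_D c) ef.
have eC' := congr1 (@dcell_C c) eg; have eD' := congr1 (@dcell_D c) eg.
simpl in *; subst A1 B1 C1 D1 C1' D1'.
have [? ? ? ? e] := dcell_inj eg; have [? ? ? ? e'] := dcell_inj ef.
subst; apply: dcell_eq => //=.
by rewrite e e'.
Qed.

Lemma vcomp_laws : category_laws (dcell_vgraph c) vid vcomp.
Proof.
split.
- by case.
- by case.
- by move=> g f h [].
- move=> [C1 D1 C' D' Ψ1 Ψ' Σ' Θ' π'] [A B C D Φ Ψ Σ Θ π] /= e.
  mor_subst e; eexists; exact: VComp.
- exact: vcomp_functional.
- by move=> g f h [].
- by move=> g f h [].
- move=> [A B C D Φ Ψ Σ Θ π] /=; have := VComp π (vident Ψ).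
  congr vcomp; apply: dcell_eq; rewrite ?mcomp_idl //.
  have a := cell_ax π; rewrite /= /vpaste_trans.
  rewrite (vpaste_at_idr (cell_A0 a)) (vpaste_at_idr (cell_A1 a)).
  rewrite (vpaste_at_idr (cell_B0 a)) (vpaste_at_idr (cell_B1 a)).
  by case: (cell_trans π).
- move=> [A B C D Φ Ψ Σ Θ π] /=; have := VComp (vident Φ) π.
  congr vcomp; apply: dcell_eq; rewrite ?mcomp_idr //.
  have a := cell_ax π; rewrite /= /vpaste_trans.
  rewrite (vpaste_at_idl (cell_A0 a)) (vpaste_at_idl (cell_A1 a)).
  rewrite (vpaste_at_idl (cell_B0 a)) (vpaste_at_idl (cell_B1 a)).
  by case: (cell_trans π).
- move=> [C2 D2 C'' D'' Ψ2 Ψ'' Σ'' Θ'' π''] [C1 D1 C' D' Ψ1 Ψ' Σ' Θ' π'].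
  move=> [A B C D Φ Ψ Σ Θ π] /= e e'; mor_subst e; mor_subst e'.
  exists (DCell (vpaste π π')), (DCell (vpaste π' π'')).
  exists (DCell (vpaste (vpaste π π') π'')); split; try exact: VComp.
  have := VComp π (vpaste π' π'').
  congr vcomp; apply: dcell_eq; rewrite ?mcompA //.
  have a := cell_ax π; have a' := cell_ax π'; have a'' := cell_ax π''.
  rewrite /= /vpaste_trans /=; congr InterTrans; symmetry.
  + exact: (vpaste_atA (cell_A0 a) (cell_A0 a') (cell_A0 a'')).
  + exact: (vpaste_atA (cell_A1 a) (cell_A1 a') (cell_A1 a'')).
  + exact: (vpaste_atA (cell_B0 a) (cell_B0 a') (cell_B0 a'')).
  + exact: (vpaste_atA (cell_B1 a) (cell_B1 a') (cell_B1 a'')).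
Qed.

End DCellCategories.

Definition mor_cat k := rel_category (mor_laws k).
Definition dcell_hcat c := rel_category (hcomp_laws c).
Definition dcell_vcat c := rel_category (vcomp_laws c).

Lemma mor_catE k g f h : comp (mor_cat k) g f = Some h <-> mor_comp g f h.
Proof. exact: rel_compE (mor_laws k) _ _ _. Qed.
Lemma dcell_hcatE c g f h : comp (dcell_hcat c) g f = Some h <-> hcomp g f h.
Proof. exact: rel_compE (hcomp_laws c) _ _ _. Qed.
Lemma dcell_vcatE c g f h : comp (dcell_vcat c) g f = Some h <-> vcomp g f h.
Proof. exact: rel_compE (vcomp_laws c) _ _ _. Qed.

Lemma dcell_double c : strict_double_category
  (mor_cat (hkind c)) (mor_cat (vkind c)) (dcell_hcat c) (dcell_vcat c).
Proof.
split=> //.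
- by move=> y x z /dcell_hcatE[] *; apply/mor_catE; exact: MorComp.
- by move=> y x z /dcell_hcatE[] *; apply/mor_catE; exact: MorComp.
- by move=> y x z /dcell_vcatE[] *; apply/mor_catE; exact: MorComp.
- by move=> y x z /dcell_vcatE[] *; apply/mor_catE; exact: MorComp.
- by move=> X; apply: dcell_eq.
- move=> k h l /mor_catE[X Y Z Ψ Φ]; apply/dcell_hcatE.
  have := HComp (vident Φ) (vident Ψ); congr hcomp; apply: dcell_eq;
    rewrite ?mcomp_idl //.
  by rewrite /= /hpaste_trans /=; congr InterTrans;
    apply: functional_extensionality => x; apply: Some_inj;
    rewrite tcompE /= ?farr_id ?src_id1 ?tgt_id1 //; exact: (oid_idem ↑_).
- move=> k h l /mor_catE[X Y Z Ψ Φ]; apply/dcell_vcatE.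
  have := VComp (hident Φ) (hident Ψ); congr vcomp; apply: dcell_eq;
    rewrite ?mcomp_idl //.
  by rewrite /= /vpaste_trans /=; congr InterTrans;
    apply: functional_extensionality => x; apply: Some_inj;
    rewrite tcompE /= ?farr_id ?src_id1 ?tgt_id1 //; exact: (oid_idem ↑_).
- move=> [A B C D Φ Ψ Σ Θ π] [B1 B' D1 D' Φ' Ψ' Θ1 Θ' π'].
  move=> [C1 D2 E F Ψ1 Ω Σ1 Θ2 ρ] [D3 D'1 F1 F' Ψ1' Ω' Θ3 Θ1' ρ'] e1 e2 e3 e4.
  simpl in e1, e2, e3, e4.
  mor_subst e1; mor_subst e2; mor_subst e3; mor_subst e4.
  rewrite ((dcell_hcatE _ _ _).2 (HComp ρ ρ')) ((dcell_hcatE _ _ _).2 (HComp π π')).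
  rewrite ((dcell_vcatE _ _ _).2 (VComp π ρ)) ((dcell_vcatE _ _ _).2 (VComp π' ρ')).
  (* The vertical composite of the two rows is the common value; interchange of components shows
     that it is also the horizontal composite of the columns. *)
  exists (DCell (vpaste (hpaste π π') (hpaste ρ ρ'))); split.
    by apply/dcell_vcatE; exact: VComp.
  apply/dcell_hcatE; have := HComp (vpaste π ρ) (vpaste π' ρ').
  congr hcomp; apply: dcell_eq => //.
  have a := cell_ax π; have a' := cell_ax π'.
  have b := cell_ax ρ; have b' := cell_ax ρ'.
  rewrite /= /hpaste_trans /vpaste_trans /=; congr InterTrans; symmetry.
  + exact: (paste_at_interchange (cell_A0 a) (cell_A0 a') (cell_A0 b) (cell_A0 b')).
  + exact: (paste_at_interchange (cell_A1 a) (cell_A1 a') (cell_A1 b) (cell_A1 b')).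
  + exact: (paste_at_interchange (cell_B0 a) (cell_B0 a') (cell_B0 b) (cell_B0 b')).
  + exact: (paste_at_interchange (cell_B1 a) (cell_B1 a') (cell_B1 b) (cell_B1 b')).
Qed.

(** Functionality turns associativity for some composites into associativity for any given ones; the
    faces of composite cubes come with composites already fixed. *)
Lemma rel_assoc' (O M : Type) (G : graph O M) i R :
  category_laws G i R -> forall h g f gf hg r : M,
  R g f gf -> R h g hg -> R h gf r -> R hg f r.
Proof.
move=> L h g f gf hg r r1 r2 r3.
have e := rel_composable L r2; have e' := rel_composable L r1.
have [gf' [hg' [r' [s1 s2 s3 s4]]]] := rel_assoc L e e'.
rewrite (rel_functional L r1 s1) in r3; rewrite (rel_functional L r2 s2).
by rewrite (rel_functional L r3 s3).
Qed.

(** * Triple cells determined by their faces *)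

Section FacewiseComposition.
Variables (C F O2 F2 O3 F3 : Type).
Variables (d c : C -> F) (d2 c2 : C -> F2) (d3 c3 : C -> F3).
Variables (G2 : graph O2 F2) (i2 : O2 -> F2) (R2 : F2 -> F2 -> F2 -> Prop).
Variables (G3 : graph O3 F3) (i3 : O3 -> F3) (R3 : F3 -> F3 -> F3 -> Prop).
Hypotheses (L2 : category_laws G2 i2 R2) (L3 : category_laws G3 i3 R3).

(** The faces [d] and [c], orthogonal to the direction of composition, are glued, and the four
    others are composed. *)
Record face_comp (g f h : C) : Prop := FaceComp {
  face_composable : d g = c f;
  face_dom : d h = d f;
  face_cod : c h = c g;
  face_d2 : R2 (d2 g) (d2 f) (d2 h);
  face_c2 : R2 (c2 g) (c2 f) (c2 h);
  face_d3 : R3 (d3 g) (d3 f) (d3 h);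
  face_c3 : R3 (c3 g) (c3 f) (c3 h) }.

Variable i : F -> C.

Record face_identities : Prop := FaceIdentities {
  face_id_d : forall u, d (i u) = u;
  face_id_c : forall u, c (i u) = u;
  face_id_cod : forall x, [/\ d2 (i (c x)) = i2 (cod G2 (d2 x)),
    c2 (i (c x)) = i2 (cod G2 (c2 x)), d3 (i (c x)) = i3 (cod G3 (d3 x))
    & c3 (i (c x)) = i3 (cod G3 (c3 x))];
  face_id_dom : forall x, [/\ d2 (i (d x)) = i2 (dom G2 (d2 x)),
    c2 (i (d x)) = i2 (dom G2 (c2 x)), d3 (i (d x)) = i3 (dom G3 (d3 x))
    & c3 (i (d x)) = i3 (dom G3 (c3 x))] }.

Definition face_ext : Prop := forall x y, d x = d y -> c x = c y ->
  d2 x = d2 y -> c2 x = c2 y -> d3 x = d3 y -> c3 x = c3 y -> x = y.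

Lemma face_laws : face_ext -> face_identities ->
  (forall g f, d g = c f -> exists h, face_comp g f h) ->
  category_laws (Graph d c) i face_comp.
Proof.
move=> ext ids total; split=> //=.
- exact: face_id_d ids.
- exact: face_id_c ids.
- by move=> g f h [].
- move=> g f h h' [_ a b e1 e2 e3 e4] [_ a' b' e1' e2' e3' e4'].
  apply: ext; rewrite ?a ?a' ?b ?b' //.
  + exact: rel_functional L2 _ _ _ _ e1 e1'.
  + exact: rel_functional L2 _ _ _ _ e2 e2'.
  + exact: rel_functional L3 _ _ _ _ e3 e3'.
  + exact: rel_functional L3 _ _ _ _ e4 e4'.
- by move=> g f h [].
- by move=> g f h [].
- move=> f; have [a b e e'] := face_id_cod ids f.
  split; rewrite ?(face_id_d ids) ?(face_id_c ids) // ?a ?b ?e ?e';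
    by [apply: rel_idl L2 _|apply: rel_idl L3 _].
- move=> f; have [a b e e'] := face_id_dom ids f.
  split; rewrite ?(face_id_d ids) ?(face_id_c ids) // ?a ?b ?e ?e';
    by [apply: rel_idr L2 _|apply: rel_idr L3 _].
- move=> h g f e e'; have [gf r1] := total _ _ e'; have [hg r2] := total _ _ e.
  (* One bracketing is composed; that its faces are also composites for the other bracketing is
     associativity of the faces. *)
  have [r r3] : exists r, face_comp h gf r.
    by apply: total; rewrite (face_cod r1).
  exists gf, hg, r; split=> //.
  case: r1 r2 r3 => a1 a2 a3 a4 a5 a6 a7 [b1 b2 b3 b4 b5 b6 b7].
  move=> [g1 g2 g3 g4 g5 g6 g7]; split; rewrite ?b2 ?g2 ?g3 ?b3 //.
  + exact: rel_assoc' L2 _ _ _ _ _ _ a4 b4 g4.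
  + exact: rel_assoc' L2 _ _ _ _ _ _ a5 b5 g5.
  + exact: rel_assoc' L3 _ _ _ _ _ _ a6 b6 g6.
  + exact: rel_assoc' L3 _ _ _ _ _ _ a7 b7 g7.
Qed.

End FacewiseComposition.

(** The order in which the two pairs of composed faces are listed depends on the pair of directions
    considered; this permutes them. *)
Lemma face_comp_swap (C F F2 F3 : Type) (d c : C -> F) (d2 c2 : C -> F2)
    (d3 c3 : C -> F3) (R2 : F2 -> F2 -> F2 -> Prop)
    (R3 : F3 -> F3 -> F3 -> Prop) g f h :
  face_comp d c d2 c2 d3 c3 R2 R3 g f h <-> face_comp d c d3 c3 d2 c2 R3 R2 g f h.
Proof. by split=> -[]. Qed.

Lemma transpose_double (O H V C : Type)
    (gH : graph O H) (gV : graph O V) (gCh : graph V C) (gCv : graph H C)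
    (cH : category_on gH) (cV : category_on gV)
    (cCh : category_on gCh) (cCv : category_on gCv) :
  strict_double_category cH cV cCh cCv -> strict_double_category cV cH cCv cCh.
Proof.
case=> a1 a2 a3 a4 b1 b2 b3 b4 c1 c2 c3 c4 d1 d2 d3 d4.
split=> //; move=> x y x' y' e1 e2 e3 e4; exact/peq_sym/d4.
Qed.

(* The double category over the direction 3 of a triple category whose triple
   cells are determined by their six faces: [d_j], [c_j] are the faces
   orthogonal to direction [j], and [R_ij] is the composition in direction [i]
   of such faces. *)
Section FacewiseDouble.
Variables (O E1 E2 E3 F1 F2 F3 C : Type).
Variables (d1 c1 : C -> F1) (d2 c2 : C -> F2) (d3 c3 : C -> F3).
Variables (G1 : graph O E1) (G2 : graph O E2).
Variables (G12 : graph E3 F2) (G21 : graph E3 F1).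
Variables (G13 : graph E2 F3) (G23 : graph E1 F3).
Variables (i12 : E3 -> F2) (R12 : F2 -> F2 -> F2 -> Prop).
Variables (i21 : E3 -> F1) (R21 : F1 -> F1 -> F1 -> Prop).
Variables (i13 : E2 -> F3) (R13 : F3 -> F3 -> F3 -> Prop).
Variables (i23 : E1 -> F3) (R23 : F3 -> F3 -> F3 -> Prop).
Hypotheses (L12 : category_laws G12 i12 R12) (L21 : category_laws G21 i21 R21).
Hypotheses (L13 : category_laws G13 i13 R13) (L23 : category_laws G23 i23 R23).
Variables (K1 : category_on G1) (K2 : category_on G2).
Hypothesis D3 : strict_double_category K1 K2 (rel_category L13) (rel_category L23).

Let R1 := face_comp d1 c1 d2 c2 d3 c3 R12 R13.
Let R2 := face_comp d2 c2 d1 c1 d3 c3 R21 R23.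
Variables (i1 : F1 -> C) (i2 : F2 -> C).
Variables (Q1 Q2 : C -> C -> C -> Prop).
Hypothesis Q1E : forall g f h, Q1 g f h <-> R1 g f h.
Hypothesis Q2E : forall g f h, Q2 g f h <-> R2 g f h.
Hypothesis M1 : category_laws (Graph d1 c1) i1 Q1.
Hypothesis M2 : category_laws (Graph d2 c2) i2 Q2.
Hypothesis ext : face_ext d1 c1 d2 c2 d3 c3.

(* The edges in directions 1 and 2 of the faces orthogonal to 2 and 1. *)
Variables (s1 t1 : F2 -> E1) (s2 t2 : F1 -> E2).
Hypothesis edges1 : forall k h l, R12 k h l ->
  comp K1 (s1 k) (s1 h) = Some (s1 l) /\ comp K1 (t1 k) (t1 h) = Some (t1 l).
Hypothesis edges2 : forall k h l, R21 k h l ->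
  comp K2 (s2 k) (s2 h) = Some (s2 l) /\ comp K2 (t2 k) (t2 h) = Some (t2 l).
(** The faces [i12 e] and [i21 e] are degenerate on the same edge [e], so their edges are identities
    at the ends of [e]. The ends have no name here and are written as the sources of [s1 (i12 e)]
    and [t1 (i12 e)]. *)
Hypothesis edges1_id : forall e, s1 (i12 e) = idm K1 (dom G1 (s1 (i12 e))) /\
  t1 (i12 e) = idm K1 (dom G1 (t1 (i12 e))).
Hypothesis edges2_id : forall e, s2 (i21 e) = idm K2 (dom G1 (s1 (i12 e))) /\
  t2 (i21 e) = idm K2 (dom G1 (t1 (i12 e))).
Hypothesis corners : forall x,
  [/\ dom G21 (d1 x) = dom G12 (d2 x), dom G21 (c1 x) = cod G12 (d2 x),
      cod G21 (d1 x) = dom G12 (c2 x) & cod G21 (c1 x) = cod G12 (c2 x)].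
Hypothesis i1_faces : forall u,
  [/\ d2 (i1 u) = i12 (dom G21 u), c2 (i1 u) = i12 (cod G21 u),
      d3 (i1 u) = i13 (s2 u) & c3 (i1 u) = i13 (t2 u)].
Hypothesis i2_faces : forall u,
  [/\ d1 (i2 u) = i21 (dom G12 u), c1 (i2 u) = i21 (cod G12 u),
      d3 (i2 u) = i23 (s1 u) & c3 (i2 u) = i23 (t1 u)].

(** Faces orthogonal to direction 3 are the only ones composed in both directions 1 and 2;
    interchange of triple cells thus rests on [D3], used here in relational form. *)
Lemma face_interchange x y x' y' u u' w w' z :
  R13 y x u -> R13 y' x' u' -> R23 x' x w -> R23 y' y w' ->
  R23 u' u z -> R13 w' w z.
Proof.
move=> h h' v v' hz.
have := dc_interchange D3 (esym (rel_composable L13 h)) (esym (rel_composable L13 h'))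
  (esym (rel_composable L23 v)) (esym (rel_composable L23 v')).
rewrite /= ((rel_compE L13 _ _ _).2 h) ((rel_compE L13 _ _ _).2 h').
rewrite ((rel_compE L23 _ _ _).2 v) ((rel_compE L23 _ _ _).2 v') /=.
by rewrite ((rel_compE L23 _ _ _).2 hz) => -[z' [[<-] /(rel_compE L13)]].
Qed.

Lemma face_double : strict_double_category
  (rel_category L12) (rel_category L21) (rel_category M1) (rel_category M2).
Proof.
have dM1 u : d1 (i1 u) = u := rel_dom_id M1 u.
have cM1 u : c1 (i1 u) = u := rel_cod_id M1 u.
have dM2 u : d2 (i2 u) = u := rel_dom_id M2 u.
have cM2 u : c2 (i2 u) = u := rel_cod_id M2 u.
have M1E g f h : rel_comp Q1 g f = Some h <-> R1 g f h.
  by split=> [/(rel_compE M1)/Q1E|/Q1E/(rel_compE M1)].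
have M2E g f h : rel_comp Q2 g f = Some h <-> R2 g f h.
  by split=> [/(rel_compE M2)/Q2E|/Q2E/(rel_compE M2)].
split=> /=.
- by move=> x; have [] := corners x.
- by move=> x; have [] := corners x.
- by move=> x; have [] := corners x.
- by move=> x; have [] := corners x.
- by move=> u; have [] := i1_faces u.
- by move=> u; have [] := i1_faces u.
- by move=> y x z /M1E[*]; apply/(rel_compE L12).
- by move=> y x z /M1E[*]; apply/(rel_compE L12).
- by move=> u; have [] := i2_faces u.
- by move=> u; have [] := i2_faces u.
- by move=> y x z /M2E[*]; apply/(rel_compE L21).
- by move=> y x z /M2E[*]; apply/(rel_compE L21).
- move=> e; have [a1 a2 a3 a4] := i1_faces (i21 e).
  have [b1 b2 b3 b4] := i2_faces (i12 e).
  have [u1 u2] := edges1_id e; have [v1 v2] := edges2_id e.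
  apply: ext.
  + by rewrite b1 dM1 (rel_dom_id L12).
  + by rewrite b2 cM1 (rel_cod_id L12).
  + by rewrite a1 dM2 (rel_dom_id L21).
  + by rewrite a2 cM2 (rel_cod_id L21).
  + by rewrite a3 b3 u1 v1; exact: (dc_id_id D3).
  + by rewrite a4 b4 u2 v2; exact: (dc_id_id D3).
- move=> k h l /(rel_compE L12) r; apply/M1E.
  have [k1 k2 k3 k4] := i2_faces k; have [h1 h2 h3 h4] := i2_faces h.
  have [l1 l2 l3 l4] := i2_faces l; have [r1 r2] := edges1 r.
  split.
  + by rewrite k1 h2 (rel_composable L12 r).
  + by rewrite l1 h1 (rel_dom L12 r).
  + by rewrite l2 k2 (rel_cod L12 r).
  + by rewrite !dM2.
  + by rewrite !cM2.
  + by rewrite k3 h3 l3; apply/(rel_compE L13)/(dc_idv_comph D3).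
  + by rewrite k4 h4 l4; apply/(rel_compE L13)/(dc_idv_comph D3).
- move=> k h l /(rel_compE L21) r; apply/M2E.
  have [k1 k2 k3 k4] := i1_faces k; have [h1 h2 h3 h4] := i1_faces h.
  have [l1 l2 l3 l4] := i1_faces l; have [r1 r2] := edges2 r.
  split.
  + by rewrite k1 h2 (rel_composable L21 r).
  + by rewrite l1 h1 (rel_dom L21 r).
  + by rewrite l2 k2 (rel_cod L21 r).
  + by rewrite !dM1.
  + by rewrite !cM1.
  + by rewrite k3 h3 l3; apply/(rel_compE L23)/(dc_idh_compv D3).
  + by rewrite k4 h4 l4; apply/(rel_compE L23)/(dc_idh_compv D3).
- move=> x y x' y' e1 e2 e3 e4.
  have [u /Q1E r] := rel_total M1 (esym e1).
  have [u' /Q1E r'] := rel_total M1 (esym e2).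
  have [w /Q2E q] := rel_total M2 (esym e3).
  have [w' /Q2E q'] := rel_total M2 (esym e4).
  (* The rows [u] and [u'] can be glued: their facing faces are composites of the same pairs of
     faces, hence equal by functionality. *)
  have [z /Q2E p] : exists z, Q2 u' u z.
    apply: (rel_total M2) => /=.
    apply: (rel_functional L12 (face_d2 r')).
    by have := face_c2 r; rewrite e3 e4.
  rewrite ((M1E _ _ _).2 r) ((M1E _ _ _).2 r').
  rewrite ((M2E _ _ _).2 q) ((M2E _ _ _).2 q').
  exists z; split; first exact/M2E.
  apply/M1E.
  case: r r' q q' p => r1 r2 r3 r4 r5 r6 r7 [r1' r2' r3' r4' r5' r6' r7'].
  move=> [q1 q2 q3 q4 q5 q6 q7] [q1' q2' q3' q4' q5' q6' q7'].
  move=> [p1 p2 p3 p4 p5 p6 p7]; split.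
  + apply: (rel_functional L21 q4').
    by rewrite -r1 -r1' in q5.
  + by apply: (rel_functional L21 p4); rewrite r2 r2'.
  + by apply: (rel_functional L21 p5); rewrite r3 r3'.
  + by rewrite q2 q2' p2.
  + by rewrite q3 q3' p3.
  + exact: face_interchange r6 r6' q6 q6' p6.
  + exact: face_interchange r7 r7' q7 q7' p7.
Qed.

End FacewiseDouble.

(** * Pasting of commuting cubes *)

Section CubeChases.
Variables (C D : category) (G : functor C D).
Variables (l p k κ q m : option (arr C)).
Hypothesis H : l ∘ p ∘ k ≐ κ ∘ q ∘ m.

(** [H] and [K] are the conditions of two cubes sharing the face [m], which appears as [G <a> m] in
    [K]. What separates them in the pasting is undone by naturality of two faces of the second cube
    at components of two faces of the first. For the other directions the shared faces are [κ] and
    [p]. *)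
Lemma cube_chase_h (p2 k2 κ2 q2 m2 k' p2' κ2' q' : option (arr D)) :
  (G <a> m) ∘ p2 ∘ k2 ≐ κ2 ∘ q2 ∘ m2 ->
  (G <a> k) ∘ p2 ≐ p2' ∘ k' -> (G <a> q) ∘ κ2 ≐ κ2' ∘ q' ->
  (G <a> l) ∘ ((G <a> p) ∘ p2') ∘ (k' ∘ k2)
  ≐ ((G <a> κ) ∘ κ2') ∘ (q' ∘ q2) ∘ m2.
Proof.
move=> K N1 N2; have HG := fmap_peq3 G H; saturate.
apply: (@peq_via _ ((G <a> κ) ∘ (G <a> q) ∘ κ2 ∘ q2 ∘ m2)).
- by defd.
- by rwr N1; rwl HG; rwl K.
- by rwr N2.
Qed.

Lemma cube_chase_v (l2 p2 κ2 q2 m2 l' p2' q' m2' : option (arr D)) :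
  l2 ∘ p2 ∘ (G <a> κ) ≐ κ2 ∘ q2 ∘ m2 ->
  l' ∘ p2' ≐ p2 ∘ (G <a> l) -> q' ∘ m2' ≐ m2 ∘ (G <a> q) ->
  (l2 ∘ l') ∘ (p2' ∘ (G <a> p)) ∘ (G <a> k)
  ≐ κ2 ∘ (q2 ∘ q') ∘ (m2' ∘ (G <a> m)).
Proof.
move=> K N1 N2; have HG := fmap_peq3 G H; saturate.
apply: (@peq_via _ (κ2 ∘ q2 ∘ m2 ∘ (G <a> q) ∘ (G <a> m))).
- by defd.
- by rwl N1; rwl HG; rwl K.
- by rwl N2.
Qed.

Lemma cube_chase_t (l2 p2 k2 κ2 m2 l' κ2' k' m2' : option (arr D)) :
  l2 ∘ p2 ∘ k2 ≐ κ2 ∘ (G <a> p) ∘ m2 ->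
  l' ∘ κ2 ≐ κ2' ∘ (G <a> l) -> (G <a> k) ∘ m2' ≐ m2 ∘ k' ->
  (l' ∘ l2) ∘ p2 ∘ (k2 ∘ k')
  ≐ (κ2' ∘ (G <a> κ)) ∘ (G <a> q) ∘ ((G <a> m) ∘ m2').
Proof.
move=> K N1 N2; have HG := fmap_peq3 G H; saturate.
apply: (@peq_via _ (κ2' ∘ (G <a> l) ∘ (G <a> p) ∘ (G <a> k) ∘ m2')).
- by defd.
- by rwl K; rwl N1; rwr N2.
- by rwr HG.
Qed.

End CubeChases.

(** The cube condition at one of the levels [A0], [A1], [B0], [B1]. It involves only functors and
    components, so each pasting is checked once for all four levels. *)
Definition cube_at (A B C A' B' C' D' : category)
    (Φ : functor A B) (Ψ' : functor C' D') (Σ : functor A C)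
    (Θ' : functor B' D') (K : functor A A') (D : category) (L' : functor D D')
    (π : ob A -> arr D) (π' : ob A' -> arr D') (κ : ob A -> arr B')
    (κb : ob C -> arr D') (λ : ob A -> arr C') (λb : ob B -> arr D') : Prop :=
  forall x, ↑(farr Ψ' (λ x)) ∘ ↑(π' (K x)) ∘ ↑(farr Θ' (κ x))
    ≐ ↑(κb (Σ x)) ∘ ↑(farr L' (π x)) ∘ ↑(λb (Φ x)).

Section CubeComposites.
Variables (A B C D A' B' C' D' : category).
Variables (Φ : functor A B) (Ψ : functor C D).
Variables (Φ' : functor A' B') (Ψ' : functor C' D').
Variables (Σ : functor A C) (Θ : functor B D).
Variables (Σ' : functor A' C') (Θ' : functor B' D').
Variables (K : functor A A') (K' : functor B B').
Variables (L : functor C C') (L' : functor D D').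
Variables (π : ob A -> arr D) (π' : ob A' -> arr D') (κ : ob A -> arr B').
Variables (κb : ob C -> arr D') (λ : ob A -> arr C') (λb : ob B -> arr D').
Hypothesis nπ : natural (fcomp Θ Φ) (fcomp Ψ Σ) π.
Hypothesis nπ' : natural (fcomp Θ' Φ') (fcomp Ψ' Σ') π'.
Hypothesis nκ : natural (fcomp K' Φ) (fcomp Φ' K) κ.
Hypothesis nκb : natural (fcomp L' Ψ) (fcomp Ψ' L) κb.
Hypothesis nλ : natural (fcomp Σ' K) (fcomp L Σ) λ.
Hypothesis nλb : natural (fcomp Θ' K') (fcomp L' Θ) λb.
Hypothesis cb : cube_at Φ Ψ' Σ Θ' K L' π π' κ κb λ λb.

(** The ends of [f] are given by equations, since those of a component of a cell are known only
    through its naturality record. *)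
Lemma nat_at (X Y : category) (F G : functor X Y) t (f : arr X) a b :
  natural F G t -> src f = a -> tgt f = b ->
  ↑(farr G f) ∘ ↑(t a) ≐ ↑(t b) ∘ ↑(farr F f).
Proof. by move=> n <- <-; exact: (nat_sq n). Qed.

Section Horizontal.
Variables (E H E' H' : category).
Variables (Φ2 : functor B E) (Ψ2 : functor D H).
Variables (Φ2' : functor B' E') (Ψ2' : functor D' H').
Variables (Ω : functor E H) (Ω' : functor E' H').
Variables (M : functor E E') (M' : functor H H').
Variables (π2 : ob B -> arr H) (π2' : ob B' -> arr H') (κ2 : ob B -> arr E').
Variables (κb2 : ob D -> arr H') (λb2 : ob E -> arr H').
Hypothesis nπ2 : natural (fcomp Ω Φ2) (fcomp Ψ2 Θ) π2.
Hypothesis nπ2' : natural (fcomp Ω' Φ2') (fcomp Ψ2' Θ') π2'.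
Hypothesis nκ2 : natural (fcomp M Φ2) (fcomp Φ2' K') κ2.
Hypothesis nκb2 : natural (fcomp M' Ψ2) (fcomp Ψ2' L') κb2.
Hypothesis cb2 : cube_at Φ2 Ψ2' Θ Ω' K' M' π2 π2' κ2 κb2 λb λb2.

Lemma cube_at_hpaste : cube_at (fcomp Φ2 Φ) (fcomp Ψ2' Ψ') Σ Ω' K M'
  (hpaste_at Φ π Ψ2 π2) (hpaste_at Φ' π' Ψ2' π2') (hpaste_at Φ κ Φ2' κ2)
  (hpaste_at Ψ κb Ψ2' κb2) λ λb2.
Proof.
move=> x.
have eκ := hpaste_atE nκ nκ2 ↑x; have eπ := hpaste_atE nπ nπ2 ↑x.
have -> : ↑(farr Ω' (hpaste_at Φ κ Φ2' κ2 x))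
    = (Ω' <a> Φ2' <a> ↑(κ x)) ∘ (Ω' <a> ↑(κ2 (Φ x))).
  by rewrite -fmap_after -?eκ.
have -> : ↑(farr M' (hpaste_at Φ π Ψ2 π2 x))
    = (M' <a> Ψ2 <a> ↑(π x)) ∘ (M' <a> ↑(π2 (Φ x))).
  by rewrite -fmap_after -?eπ.
rewrite [↑(hpaste_at _ _ _ _ _)](hpaste_atE nπ' nπ2' ↑(K x)).
rewrite [↑(hpaste_at _ _ _ _ _)](hpaste_atE nκb nκb2 ↑(Σ x)).
apply: (cube_chase_h (cb x) (cb2 (Φ x))).
- by apply: (nat_at nπ2'); rewrite ?(nat_src nκ) ?(nat_tgt nκ).
- by apply: (nat_at nκb2); rewrite ?(nat_src nπ) ?(nat_tgt nπ).
Qed.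

End Horizontal.

Section Vertical.
Variables (E H E' H' : category).
Variables (S : functor C E) (T : functor D H).
Variables (S' : functor C' E') (T' : functor D' H').
Variables (Ω : functor E H) (Ω' : functor E' H').
Variables (N : functor E E') (N' : functor H H').
Variables (π2 : ob C -> arr H) (π2' : ob C' -> arr H').
Variables (κb2 : ob E -> arr H') (λ2 : ob C -> arr E') (λb2 : ob D -> arr H').
Hypothesis nπ2 : natural (fcomp T Ψ) (fcomp Ω S) π2.
Hypothesis nπ2' : natural (fcomp T' Ψ') (fcomp Ω' S') π2'.
Hypothesis nλ2 : natural (fcomp S' L) (fcomp N S) λ2.
Hypothesis nλb2 : natural (fcomp T' L') (fcomp N' T) λb2.
Hypothesis cb2 : cube_at Ψ Ω' S T' L N' π2 π2' κb κb2 λ2 λb2.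

Lemma cube_at_vpaste : cube_at Φ Ω' (fcomp S Σ) (fcomp T' Θ') K N'
  (vpaste_at Σ π T π2) (vpaste_at Σ' π' T' π2') κ κb2
  (vpaste_at Σ λ S' λ2) (vpaste_at Θ λb T' λb2).
Proof.
move=> x.
have eλ := vpaste_atE nλ nλ2 ↑x; have eπ := vpaste_atE nπ nπ2 ↑x.
have -> : ↑(farr Ω' (vpaste_at Σ λ S' λ2 x))
    = (Ω' <a> ↑(λ2 (Σ x))) ∘ (Ω' <a> S' <a> ↑(λ x)).
  by rewrite -fmap_after -?eλ.
have -> : ↑(farr N' (vpaste_at Σ π T π2 x))
    = (N' <a> ↑(π2 (Σ x))) ∘ (N' <a> T <a> ↑(π x)).
  by rewrite -fmap_after -?eπ.
rewrite [↑(vpaste_at _ _ _ _ _)](vpaste_atE nπ' nπ2' ↑(K x)).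
rewrite [↑(vpaste_at _ _ _ _ _)](vpaste_atE nλb nλb2 ↑(Φ x)).
apply: (cube_chase_v (cb x) (cb2 (Σ x))).
- by apply: (nat_at nπ2'); rewrite ?(nat_src nλ) ?(nat_tgt nλ).
- by apply: (nat_at nλb2); rewrite ?(nat_src nπ) ?(nat_tgt nπ).
Qed.

End Vertical.

Section Transversal.
Variables (A'' B'' C'' D'' : category).
Variables (Φ'' : functor A'' B'') (Ψ'' : functor C'' D'').
Variables (Σ'' : functor A'' C'') (Θ'' : functor B'' D'').
Variables (K2 : functor A' A'') (K2' : functor B' B'').
Variables (L2 : functor C' C'') (L2' : functor D' D'').
Variables (π'' : ob A'' -> arr D'') (κ2 : ob A' -> arr B'').
Variables (κb2 : ob C' -> arr D'') (λ2 : ob A' -> arr C'') (λb2 : ob B' -> arr D'').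
Hypothesis nκ2 : natural (fcomp K2' Φ') (fcomp Φ'' K2) κ2.
Hypothesis nκb2 : natural (fcomp L2' Ψ') (fcomp Ψ'' L2) κb2.
Hypothesis nλ2 : natural (fcomp Σ'' K2) (fcomp L2 Σ') λ2.
Hypothesis nλb2 : natural (fcomp Θ'' K2') (fcomp L2' Θ') λb2.
Hypothesis cb2 : cube_at Φ' Ψ'' Σ' Θ'' K2 L2' π' π'' κ2 κb2 λ2 λb2.

Lemma cube_at_tpaste : cube_at Φ Ψ'' Σ Θ'' (fcomp K2 K) (fcomp L2' L')
  π π'' (vpaste_at K κ K2' κ2) (vpaste_at L κb L2' κb2)
  (hpaste_at K λ L2 λ2) (hpaste_at K' λb L2' λb2).
Proof.
move=> x.
have eλ := hpaste_atE nλ nλ2 ↑x; have eκ := vpaste_atE nκ nκ2 ↑x.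
have -> : ↑(farr Ψ'' (hpaste_at K λ L2 λ2 x))
    = (Ψ'' <a> L2 <a> ↑(λ x)) ∘ (Ψ'' <a> ↑(λ2 (K x))).
  by rewrite -fmap_after -?eλ.
have -> : ↑(farr Θ'' (vpaste_at K κ K2' κ2 x))
    = (Θ'' <a> ↑(κ2 (K x))) ∘ (Θ'' <a> K2' <a> ↑(κ x)).
  by rewrite -fmap_after -?eκ.
rewrite [↑(vpaste_at _ _ _ _ _)](vpaste_atE nκb nκb2 ↑(Σ x)).
rewrite [↑(hpaste_at _ _ _ _ _)](hpaste_atE nλb nλb2 ↑(Φ x)).
apply: (cube_chase_t (cb x) (cb2 (K x))).
- by apply: (nat_at nκb2); rewrite ?(nat_src nλ) ?(nat_tgt nλ).
- by apply: (nat_at nλb2); rewrite ?(nat_src nκ) ?(nat_tgt nκ).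
Qed.

End Transversal.
End CubeComposites.

Definition face_λ (x : cube) : dcell CL_CC := DCell (cb_λ x).
Definition face_λb (x : cube) : dcell CL_CC := DCell (cb_λb x).
Definition face_π (x : cube) : dcell LL_CC := DCell (cb_π x).
Definition face_π' (x : cube) : dcell LL_CC := DCell (cb_π' x).
Definition face_κ (x : cube) : dcell LL_CL := DCell (cb_κ x).
Definition face_κb (x : cube) : dcell LL_CL := DCell (cb_κb x).

(** The faces [π] and [π'] determine the eight corners and eight of the edges, [κ] and [κb] the four
    transversal edges; commutativity is proof-irrelevant. *)
Lemma cube_eq x y : face_π x = face_π y -> face_π' x = face_π' y ->
  face_κ x = face_κ y -> face_κb x = face_κb y ->
  face_λ x = face_λ y -> face_λb x = face_λb y -> x = y.
Proof.
case: x => A B C D A' B' C' D' Φ Ψ Φ' Ψ' Σ Θ Σ' Θ' K K' L L' π π' κ κb λ λb H.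
case: y => A1 B1 C1 D1 A1' B1' C1' D1' Φ1 Ψ1 Φ1' Ψ1' Σ1 Θ1 Σ1' Θ1'.
move=> K1 K1' L1 L1' π1 π1' κ1 κb1 λ1 λb1 H1.
rewrite /face_π /face_π' /face_κ /face_κb /face_λ /face_λb /=.
move=> eπ eπ' eκ eκb eλ eλb.
have eA := congr1 (@dcell_A _) eπ; have eB := congr1 (@dcell_B _) eπ.
have eC := congr1 (@dcell_C _) eπ; have eD := congr1 (@dcell_D _) eπ.
have eA' := congr1 (@dcell_A _) eπ'; have eB' := congr1 (@dcell_B _) eπ'.
have eC' := congr1 (@dcell_C _) eπ'; have eD' := congr1 (@dcell_D _) eπ'.
simpl in eA, eB, eC, eD, eA', eB', eC', eD'.
subst A1 B1 C1 D1 A1' B1' C1' D1'.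
have [a1 a2 a3 a4 a5] := dcell_inj eπ.
have [b1 b2 b3 b4 b5] := dcell_inj eπ'.
have [_ _ c3 c4 c5] := dcell_inj eκ.
have [_ _ d3 d4 d5] := dcell_inj eκb.
have [_ _ _ _ e5] := dcell_inj eλ.
have [_ _ _ _ f5] := dcell_inj eλb.
subst Φ1 Ψ1 Σ1 Θ1 Φ1' Ψ1' Σ1' Θ1' K1 K1' L1 L1'.
have a6 := cell_eq a5; have b6 := cell_eq b5; have c6 := cell_eq c5.
have d6 := cell_eq d5; have e6 := cell_eq e5; have f6 := cell_eq f5.
subst π1 π1' κ1 κb1 λ1 λb1.
by rewrite (proof_irrelevance _ H H1).
Qed.

Definition hcube := face_comp face_λ face_λb face_κ face_κb face_π face_π'
  (@hcomp LL_CL) (@hcomp LL_CC).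
Definition vcube := face_comp face_κ face_κb face_λ face_λb face_π face_π'
  (@vcomp CL_CC) (@vcomp LL_CC).
(** Transversal edges are the colax-lax ones: they are vertical in an [LL_CL] cell and horizontal in
    a [CL_CC] cell, which explains the two compositions. *)
Definition tcube := face_comp face_π face_π' face_κ face_κb face_λ face_λb
  (@vcomp LL_CL) (@hcomp CL_CC).

Ltac dcell_subst e :=
  let a := fresh in let b := fresh in let c := fresh in let d := fresh in
  have a := congr1 (@dcell_A _) e; have b := congr1 (@dcell_B _) e;
  have c := congr1 (@dcell_C _) e; have d := congr1 (@dcell_D _) e;
  simpl in a, b, c, d; subst;
  case: (dcell_inj e) => {e} a b c d e; subst; move/cell_eq: e => e; subst.

Lemma hcube_total g f : face_λ g = face_λb f -> exists h, hcube g f h.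
Proof.
case: f => A B C D A' B' C' D' Φ Ψ Φ' Ψ' Σ Θ Σ' Θ' K K' L L' π π' κ κb λ λb H.
case: g => A1 E C1 F A1' E' C1' F' Φ1 Ψ1 Φ1' Ψ1' Σ1 Ω Σ1' Ω'.
move=> K1 M L1 M' π1 π1' κ1 κb1 λ1 λb1 H1.
rewrite /face_λ /face_λb /= => e; dcell_subst e.
have cc : cube_commutes (hpaste π π1) (hpaste π' π1') (hpaste κ κ1) (hpaste κb κb1)
    λ λb1.
  split.
  - exact: (cube_at_hpaste (cell_A0 (cell_ax π)) (cell_A0 (cell_ax π'))
      (cell_A0 (cell_ax κ)) (cell_A0 (cell_ax κb)) (cube_A0 H)
      (cell_A0 (cell_ax π1)) (cell_A0 (cell_ax π1'))
      (cell_A0 (cell_ax κ1)) (cell_A0 (cell_ax κb1)) (cube_A0 H1)).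
  - exact: (cube_at_hpaste (cell_A1 (cell_ax π)) (cell_A1 (cell_ax π'))
      (cell_A1 (cell_ax κ)) (cell_A1 (cell_ax κb)) (cube_A1 H)
      (cell_A1 (cell_ax π1)) (cell_A1 (cell_ax π1'))
      (cell_A1 (cell_ax κ1)) (cell_A1 (cell_ax κb1)) (cube_A1 H1)).
  - exact: (cube_at_hpaste (cell_B0 (cell_ax π)) (cell_B0 (cell_ax π'))
      (cell_B0 (cell_ax κ)) (cell_B0 (cell_ax κb)) (cube_B0 H)
      (cell_B0 (cell_ax π1)) (cell_B0 (cell_ax π1'))
      (cell_B0 (cell_ax κ1)) (cell_B0 (cell_ax κb1)) (cube_B0 H1)).
  - exact: (cube_at_hpaste (cell_B1 (cell_ax π)) (cell_B1 (cell_ax π'))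
      (cell_B1 (cell_ax κ)) (cell_B1 (cell_ax κb)) (cube_B1 H)
      (cell_B1 (cell_ax π1)) (cell_B1 (cell_ax π1'))
      (cell_B1 (cell_ax κ1)) (cell_B1 (cell_ax κb1)) (cube_B1 H1)).
by exists (Cube cc); split=> //=; exact: HComp.
Qed.

Lemma vcube_total g f : face_κ g = face_κb f -> exists h, vcube g f h.
Proof.
case: f => A B C D A' B' C' D' Φ Ψ Φ' Ψ' Σ Θ Σ' Θ' K K' L L' π π' κ κb λ λb H.
case: g => C1 D1 E F C1' D1' E' F' Ψ1 Ω Ψ1' Ω' S T S' T'.
move=> L1 L1' N N' π1 π1' κ1 κb1 λ1 λb1 H1.
rewrite /face_κ /face_κb /= => e; dcell_subst e.
have cc : cube_commutes (vpaste π π1) (vpaste π' π1') κ κb1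
    (vpaste λ λ1) (vpaste λb λb1).
  split.
  - exact: (cube_at_vpaste (cell_A0 (cell_ax π)) (cell_A0 (cell_ax π'))
      (cell_A0 (cell_ax λ)) (cell_A0 (cell_ax λb)) (cube_A0 H)
      (cell_A0 (cell_ax π1)) (cell_A0 (cell_ax π1'))
      (cell_A0 (cell_ax λ1)) (cell_A0 (cell_ax λb1)) (cube_A0 H1)).
  - exact: (cube_at_vpaste (cell_A1 (cell_ax π)) (cell_A1 (cell_ax π'))
      (cell_A1 (cell_ax λ)) (cell_A1 (cell_ax λb)) (cube_A1 H)
      (cell_A1 (cell_ax π1)) (cell_A1 (cell_ax π1'))
      (cell_A1 (cell_ax λ1)) (cell_A1 (cell_ax λb1)) (cube_A1 H1)).
  - exact: (cube_at_vpaste (cell_B0 (cell_ax π)) (cell_B0 (cell_ax π'))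
      (cell_B0 (cell_ax λ)) (cell_B0 (cell_ax λb)) (cube_B0 H)
      (cell_B0 (cell_ax π1)) (cell_B0 (cell_ax π1'))
      (cell_B0 (cell_ax λ1)) (cell_B0 (cell_ax λb1)) (cube_B0 H1)).
  - exact: (cube_at_vpaste (cell_B1 (cell_ax π)) (cell_B1 (cell_ax π'))
      (cell_B1 (cell_ax λ)) (cell_B1 (cell_ax λb)) (cube_B1 H)
      (cell_B1 (cell_ax π1)) (cell_B1 (cell_ax π1'))
      (cell_B1 (cell_ax λ1)) (cell_B1 (cell_ax λb1)) (cube_B1 H1)).
by exists (Cube cc); split=> //=; exact: VComp.
Qed.

Lemma tcube_total g f : face_π g = face_π' f -> exists h, tcube g f h.
Proof.
case: f => A B C D A' B' C' D' Φ Ψ Φ' Ψ' Σ Θ Σ' Θ' K K' L L' π π' κ κb λ λb H.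
case: g => A1 B1 C1 D1 A'' B'' C'' D'' Φ1 Ψ1 Φ'' Ψ'' Σ1 Θ1 Σ'' Θ''.
move=> K1 K1' L1 L1' π1 π1' κ1 κb1 λ1 λb1 H1.
rewrite /face_π /face_π' /= => e; dcell_subst e.
have cc : cube_commutes π π1' (vpaste κ κ1) (vpaste κb κb1)
    (hpaste λ λ1) (hpaste λb λb1).
  split.
  - exact: (cube_at_tpaste (cell_A0 (cell_ax κ)) (cell_A0 (cell_ax κb))
      (cell_A0 (cell_ax λ)) (cell_A0 (cell_ax λb)) (cube_A0 H)
      (cell_A0 (cell_ax κ1)) (cell_A0 (cell_ax κb1))
      (cell_A0 (cell_ax λ1)) (cell_A0 (cell_ax λb1)) (cube_A0 H1)).
  - exact: (cube_at_tpaste (cell_A1 (cell_ax κ)) (cell_A1 (cell_ax κb))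
      (cell_A1 (cell_ax λ)) (cell_A1 (cell_ax λb)) (cube_A1 H)
      (cell_A1 (cell_ax κ1)) (cell_A1 (cell_ax κb1))
      (cell_A1 (cell_ax λ1)) (cell_A1 (cell_ax λb1)) (cube_A1 H1)).
  - exact: (cube_at_tpaste (cell_B0 (cell_ax κ)) (cell_B0 (cell_ax κb))
      (cell_B0 (cell_ax λ)) (cell_B0 (cell_ax λb)) (cube_B0 H)
      (cell_B0 (cell_ax κ1)) (cell_B0 (cell_ax κb1))
      (cell_B0 (cell_ax λ1)) (cell_B0 (cell_ax λb1)) (cube_B0 H1)).
  - exact: (cube_at_tpaste (cell_B1 (cell_ax κ)) (cell_B1 (cell_ax κb))
      (cell_B1 (cell_ax λ)) (cell_B1 (cell_ax λb)) (cube_B1 H)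
      (cell_B1 (cell_ax κ1)) (cell_B1 (cell_ax κb1))
      (cell_B1 (cell_ax λ1)) (cell_B1 (cell_ax λb1)) (cube_B1 H1)).
by exists (Cube cc); split=> //=; first [exact: VComp|exact: HComp].
Qed.

(** * Identity cubes *)

Section CubeIdentities.
Variables (A B C D : category).
Variables (F : functor A B) (G : functor C D) (S : functor A C) (T : functor B D).
Variable t : ob A -> arr D.
Hypothesis nt : natural (fcomp T F) (fcomp G S) t.

Lemma id1_left (f : arr D) y : tgt f = y -> ↑(id1 y) ∘ ↑f = ↑f.
Proof. by move=> e; apply: (oid_left_eq (x := ↑y)); rewrite /= e. Qed.
Lemma id1_right (f : arr D) y : src f = y -> ↑f ∘ ↑(id1 y) = ↑f.
Proof. by move=> e; apply: (oid_right_eq (x := ↑y)); rewrite /= e. Qed.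

(** Four faces are identities, and both sides of the condition reduce to the component of [t];
    likewise in the other two directions. *)
Lemma cube_at_hid : cube_at (fid A) (fid D) S T F G
  (fun x => id1 (S x)) (fun x => id1 (T x))
  (fun x => id1 (F x)) (fun x => id1 (G x)) t t.
Proof.
move=> x; apply: (@peq_via _ ↑(t x)) => //.
- by rewrite !farr_id !id1_right // (nat_src nt).
- by rewrite !farr_id !id1_left ?tgt_id1 // (nat_tgt nt).
Qed.

Lemma cube_at_vid : cube_at F G (fid A) (fid D) S T
  (fun x => id1 (F x)) (fun x => id1 (G x)) t t
  (fun x => id1 (S x)) (fun x => id1 (T x)).
Proof.
move=> x; apply: (@peq_via _ ↑(t x)) => //.
- by rewrite !farr_id !id1_left ?tgt_id1 // (nat_tgt nt).
- by rewrite !farr_id !id1_right // (nat_src nt).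
Qed.

Lemma cube_at_tid : cube_at F G S T (fid A) (fid D) t t
  (fun x => id1 (F x)) (fun x => id1 (G x))
  (fun x => id1 (S x)) (fun x => id1 (T x)).
Proof.
move=> x; apply: (@peq_via _ ↑(t x)) => //.
- rewrite !farr_id id1_left ?id1_right // ?(nat_tgt nt) ?(nat_src nt) //.
- rewrite id1_left ?id1_right //= ?(nat_tgt nt) ?(nat_src nt) //.
Qed.

End CubeIdentities.

Lemma hid_commutes (u : dcell CL_CC) : cube_commutes
  (@hident LL_CC _ _ (dcell_left u)) (@hident LL_CC _ _ (dcell_right u))
  (@hident LL_CL _ _ (dcell_top u)) (@hident LL_CL _ _ (dcell_bot u))
  (dcell_cell u) (dcell_cell u).
Proof.
have a := cell_ax (dcell_cell u); split.
- exact: (cube_at_hid (cell_A0 a)).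
- exact: (cube_at_hid (cell_A1 a)).
- exact: (cube_at_hid (cell_B0 a)).
- exact: (cube_at_hid (cell_B1 a)).
Qed.
Definition hid_cube u : cube := Cube (hid_commutes u).

Lemma vid_commutes (u : dcell LL_CL) : cube_commutes
  (@vident LL_CC _ _ (dcell_top u)) (@vident LL_CC _ _ (dcell_bot u))
  (dcell_cell u) (dcell_cell u)
  (@vident CL_CC _ _ (dcell_left u)) (@vident CL_CC _ _ (dcell_right u)).
Proof.
have a := cell_ax (dcell_cell u); split.
- exact: (cube_at_vid (cell_A0 a)).
- exact: (cube_at_vid (cell_A1 a)).
- exact: (cube_at_vid (cell_B0 a)).
- exact: (cube_at_vid (cell_B1 a)).
Qed.
Definition vid_cube u : cube := Cube (vid_commutes u).

Lemma tid_commutes (u : dcell LL_CC) : cube_commutes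
  (dcell_cell u) (dcell_cell u)
  (@vident LL_CL _ _ (dcell_top u)) (@vident LL_CL _ _ (dcell_bot u))
  (@hident CL_CC _ _ (dcell_left u)) (@hident CL_CC _ _ (dcell_right u)).
Proof.
have a := cell_ax (dcell_cell u); split.
- exact: (cube_at_tid (cell_A0 a)).
- exact: (cube_at_tid (cell_A1 a)).
- exact: (cube_at_tid (cell_B0 a)).
- exact: (cube_at_tid (cell_B1 a)).
Qed.
Definition tid_cube u : cube := Cube (tid_commutes u).

(** * The categories of cubes and the double categories over the edges *)

Lemma hcube_laws : category_laws cube_hgraph hid_cube hcube.
Proof.
apply: (face_laws (hcomp_laws LL_CL) (hcomp_laws LL_CC)); last exact: hcube_total.
- by move=> *; apply: cube_eq.
- by split=> //; case.
Qed.

Lemma vcube_laws : category_laws cube_vgraph vid_cube vcube.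
Proof.
apply: (face_laws (vcomp_laws CL_CC) (vcomp_laws LL_CC)); last exact: vcube_total.
- by move=> *; apply: cube_eq.
- by split=> //; case.
Qed.

Lemma tcube_laws : category_laws cube_tgraph tid_cube tcube.
Proof.
apply: (face_laws (vcomp_laws LL_CL) (hcomp_laws CL_CC)); last exact: tcube_total.
- by move=> *; apply: cube_eq.
- by split=> //; case.
Qed.

(** Directions 1, 2 and 3 of the facewise statement are here horizontal, vertical and
    transversal. *)
Lemma double_over_T : strict_double_category (dcell_hcat LL_CL) (dcell_vcat CL_CC)
  (rel_category hcube_laws) (rel_category vcube_laws).
Proof.
have D1 := dcell_double LL_CL; have D2 := dcell_double CL_CC.
have ext : face_ext face_λ face_λb face_κ face_κb face_π face_π'.
  by move=> *; apply: cube_eq.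
apply: (face_double (hcomp_laws LL_CL) (vcomp_laws CL_CC) (dcell_double LL_CC)
  (fun _ _ _ => iff_refl _) (fun _ _ _ => iff_refl _)
  hcube_laws vcube_laws ext
  (s1 := dom (dcell_vgraph LL_CL)) (t1 := cod (dcell_vgraph LL_CL))
  (s2 := dom (dcell_hgraph CL_CC)) (t2 := cod (dcell_hgraph CL_CC))) => //.
- move=> k h l /dcell_hcatE r.
  by split; [apply: (dc_dom_comph D1)|apply: (dc_cod_comph D1)].
- move=> k h l /dcell_vcatE r.
  by split; [apply: (dc_dom_compv D2)|apply: (dc_cod_compv D2)].
Qed.

(** Directions 1, 2 and 3 are transversal, vertical and horizontal. *)
Lemma double_over_H : strict_double_category (dcell_vcat LL_CL) (dcell_vcat LL_CC)
  (rel_category tcube_laws) (rel_category vcube_laws).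
Proof.
have D1 := dcell_double LL_CL; have D2 := dcell_double LL_CC.
have ext : face_ext face_π face_π' face_κ face_κb face_λ face_λb.
  by move=> *; apply: cube_eq.
apply: (face_double (vcomp_laws LL_CL) (vcomp_laws LL_CC) (dcell_double CL_CC)
  (fun _ _ _ => iff_refl _) (@face_comp_swap _ _ _ _ _ _ _ _ _ _ _ _) tcube_laws vcube_laws ext
  (s1 := dom (dcell_hgraph LL_CL)) (t1 := cod (dcell_hgraph LL_CL))
  (s2 := dom (dcell_hgraph LL_CC)) (t2 := cod (dcell_hgraph LL_CC))) => //.
- move=> k h l /dcell_vcatE r.
  by split; [apply: (dc_dom_compv D1)|apply: (dc_cod_compv D1)].
- move=> k h l /dcell_vcatE r.
  by split; [apply: (dc_dom_compv D2)|apply: (dc_cod_compv D2)].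
Qed.

(** Directions 1, 2 and 3 are transversal, horizontal and vertical. The [LL_CL] cells have the
    horizontal direction first, so their double category is transposed. *)
Lemma double_over_V : strict_double_category (dcell_hcat CL_CC) (dcell_hcat LL_CC)
  (rel_category tcube_laws) (rel_category hcube_laws).
Proof.
have D1 := dcell_double CL_CC; have D2 := dcell_double LL_CC.
have ext : face_ext face_π face_π' face_λ face_λb face_κ face_κb.
  by move=> *; apply: cube_eq.
apply: (face_double (hcomp_laws CL_CC) (hcomp_laws LL_CC) (transpose_double (dcell_double LL_CL))
  (@face_comp_swap _ _ _ _ _ _ _ _ _ _ _ _) (@face_comp_swap _ _ _ _ _ _ _ _ _ _ _ _) tcube_laws hcube_laws ext
  (s1 := dom (dcell_vgraph CL_CC)) (t1 := cod (dcell_vgraph CL_CC))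
  (s2 := dom (dcell_vgraph LL_CC)) (t2 := cod (dcell_vgraph LL_CC))) => //.
- move=> k h l /dcell_hcatE r.
  by split; [apply: (dc_dom_comph D1)|apply: (dc_cod_comph D1)].
- move=> k h l /dcell_hcatE r.
  by split; [apply: (dc_dom_comph D2)|apply: (dc_cod_comph D2)].
Qed.

Definition ICat : strict_triple_category ICat_graph :=
  @StrictTripleCategory ICat_graph
    (mor_cat CL) (mor_cat LL) (mor_cat CC)
    (dcell_hcat LL_CL) (dcell_vcat LL_CL) (dcell_hcat CL_CC) (dcell_vcat CL_CC)
    (dcell_hcat LL_CC) (dcell_vcat LL_CC)
    (rel_category hcube_laws) (rel_category tcube_laws) (rel_category vcube_laws)
    (dcell_double LL_CC) (dcell_double LL_CL) (dcell_double CL_CC)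
    double_over_T double_over_H double_over_V.

(** * Agreement with the prescribed operations *)

Lemma pcomp_composite l (Y0 Y1 Z0 Z1 W0 W1 : category)
    (P : pseudocat Y0 Y1) (Q : pseudocat Z0 Z1) (R : pseudocat W0 W1)
    (G : pmap Z0 Z1 W0 W1) (F : pmap Y0 Y1 Z0 Z1) :
  has_laxity l P Q F -> has_laxity l Q R G ->
  composite_comparison l G F (comp_cmp l G F).
Proof.
move=> hF hG.
(* [ocunit_pcomp] removes the default value in [comp_cmp], so that the total comparison is the
   prescribed partial composite. *)
have u a := ocunit_pcomp hF hG ↑a; have m x y := ocmul_pcomp G F l ↑x ↑y.
by case: l hF hG u m => hF hG u m; split=> [a|x y]; [exact: u|exact: m|exact: u|exact: m].
Qed.

Lemma mcomp_composite k (X Y Z : intercat)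
    (Ψ : morphism k Y Z) (Φ : morphism k X Y) :
  is_composite_morphism Ψ Φ (mcomp Ψ Φ).
Proof.
have a := mor_ax Φ; have b := mor_ax Ψ; split=> //.
- exact: pcomp_composite (mor_row0 a) (mor_row0 b).
- exact: pcomp_composite (mor_row1 a) (mor_row1 b).
- exact: pcomp_composite (mor_colA a) (mor_colA b).
- exact: pcomp_composite (mor_colB a) (mor_colB b).
Qed.

Lemma mor_cat_operations k : mor_operations (mor_cat k).
Proof.
split=> [X|X Y Z Ψ Φ]; first by exists (mident k X).
exists (mcomp Ψ Φ); split; first exact: mcomp_composite.
by apply/mor_catE; exact: MorComp.
Qed.

Lemma dcell_hcat_operations c : cell_hoperations (dcell_hcat c).
Proof.
split=> [A C Σ|A B C D B' D' Φ Ψ Φ' Ψ' Σ Θ Θ' π π'].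
  by exists (mident (hkind c) A), (mident (hkind c) C), (hident Σ).
exists (mcomp Φ' Φ), (mcomp Ψ' Ψ), (hpaste π π').
split; last by apply/dcell_hcatE; exact: HComp.
have a := cell_ax π; have a' := cell_ax π'; split=> x.
- exact: (hpaste_atE (cell_A0 a) (cell_A0 a') ↑x).
- exact: (hpaste_atE (cell_A1 a) (cell_A1 a') ↑x).
- exact: (hpaste_atE (cell_B0 a) (cell_B0 a') ↑x).
- exact: (hpaste_atE (cell_B1 a) (cell_B1 a') ↑x).
Qed.

Lemma dcell_vcat_operations c : cell_voperations (dcell_vcat c).
Proof.
split=> [A B Φ|A B C D C' D' Φ Ψ Ψ' Σ Θ Σ' Θ' π π'].
  by exists (mident (vkind c) A), (mident (vkind c) B), (vident Φ).
exists (mcomp Σ' Σ), (mcomp Θ' Θ), (vpaste π π').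
split; last by apply/dcell_vcatE; exact: VComp.
have a := cell_ax π; have a' := cell_ax π'; split=> x.
- exact: (vpaste_atE (cell_A0 a) (cell_A0 a') ↑x).
- exact: (vpaste_atE (cell_A1 a) (cell_A1 a') ↑x).
- exact: (vpaste_atE (cell_B0 a) (cell_B0 a') ↑x).
- exact: (vpaste_atE (cell_B1 a) (cell_B1 a') ↑x).
Qed.

Theorem theorem6p3 :
  exists T : strict_triple_category ICat_graph, ICat_operations T.
Proof.
exists ICat; split.
- exact: mor_cat_operations.
- exact: mor_cat_operations.
- exact: mor_cat_operations.
- exact: dcell_hcat_operations.
- exact: dcell_vcat_operations.
- exact: dcell_hcat_operations.
- exact: dcell_vcat_operations.
- exact: dcell_hcat_operations.
- exact: dcell_vcat_operations.
Qed.
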